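(* Let $\lambda>\lambda_c$, where $\lambda_c$ is the critical intensity of Gilbert's graph $G(\mathscr{P}_\lambda,1)$, and let $\mathcal{C}$ be the (almost surely unique) infinite connected component of $G(\mathscr{P}_\lambda,1)$. Then the critical probabilities for site and bond percolation on $\mathcal{C}$ satisfy the strict inequality $p_c^{\rm site} > p_c^{\rm bond}$.
   Context: For $\lambda>0$, $\mathscr{P}_\lambda$ denotes a homogeneous Poisson point process of intensity $\lambda$ in $\mathbb{R}^2$. Gilbert's graph $G(\mathscr{P}_\lambda,1)$ has vertex set $\mathscr{P}_\lambda$ and joins two vertices $x,y$ by an edge iff $|x-y|\le 1$. Its critical intensity $\lambda_c\in(0,\infty)$ is such that for $\lambda>\lambda_c$ there is almost surely a unique infinite connected component $\mathcal{C}$, and for $\lambda<\lambda_c$ almost surely none. Site percolation on $\mathcal{C}$ with parameter $p$: each vertex of $\mathcal{C}$ is independently open with probability $p$; $p_c^{\rm site}$ is the critical value of $p$ such that for $p>p_c^{\rm site}$ the subgraph induced by open vertices has an infinite component a.s. and for $p<p_c^{\rm site}$ it has none a.s. Bond percolation on $\mathcal{C}$: each edge of $\mathcal{C}$ is independently open with probability $p$; $p_c^{\rm bond}$ is the analogous critical value for the subgraph of open edges. *)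

(* Defs.v *)
From HB Require Import structures.
From mathcomp Require Import all_boot all_order all_algebra.
From mathcomp Require Import all_classical all_reals all_analysis.
Set Implicit Arguments. Unset Strict Implicit. Unset Printing Implicit Defensive.
Import Order.TTheory GRing.Theory Num.Theory.
Local Open Scope classical_set_scope.
Local Open Scope ring_scope.

Section Gilbert.
Variable R : realType.

Definition pt := (R * R)%type.

Definition gadj (x y : pt) : Prop :=
  x <> y /\ (x.1 - y.1) ^+ 2 + (x.2 - y.2) ^+ 2 <= 1.

Fixpoint walk (E : pt -> pt -> Prop) (x : pt) (s : seq pt) (y : pt) : Prop :=
  match s with
  | [::] => x = y
  | z :: s' => E x z /\ walk E z s' y
  end.

Definition gconn (V : set pt) (E : pt -> pt -> Prop) (x y : pt) : Prop :=
  x \in V /\ exists s : seq pt, (forall z, z \in s -> z \in V) /\ walk E x s y.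

Definition gcomp (V : set pt) (E : pt -> pt -> Prop) (x : pt) : set pt :=
  [set y | gconn V E x y].

Definition inf_component (V : set pt) (E : pt -> pt -> Prop) (C : set pt) : Prop :=
  exists2 x, x \in V & C = gcomp V E x /\ infinite_set C.

Definition has_inf_component (V : set pt) (E : pt -> pt -> Prop) : Prop :=
  exists C, inf_component V E C.

Definition leb2 : set (R * R) -> \bar R :=
  (@lebesgue_measure R \x @lebesgue_measure R)%E.

Definition bounded2 (B : set pt) : Prop :=
  exists M : R, forall x, B x -> `|x.1| <= M /\ `|x.2| <= M.

(** Poisson probability mass function with parameter r (also correct for r = 0). *)
Definition poisson_mass (r : R) (k : nat) : R :=
  r ^+ k / (k`!)%:R * expR (- r).

Definition is_PPP d (Omega : measurableType d) (Q : probability Omega R)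
    (eta : Omega -> set pt) (lam : R) : Prop :=
  (forall w B, bounded2 B -> finite_set (eta w `&` B)) /\
  (forall (Bs : seq (set pt)) (ks : seq nat),
     size Bs = size ks ->
     (forall B, B \in Bs -> measurable B /\ bounded2 B) ->
     (forall i j, (i < size Bs)%N -> (j < size Bs)%N -> i <> j ->
        nth set0 Bs i `&` nth set0 Bs j = set0) ->
     let ev := fun i => [set w | (eta w `&` nth set0 Bs i #= `I_(nth 0%N ks i))%card] in
     (forall i, (i < size Bs)%N -> measurable (ev i)) /\
     Q (\big[setI/setT]_(i < size Bs) ev i) =
       (\prod_(i < size Bs)
          poisson_mass (lam * fine (leb2 (nth set0 Bs i))) (nth 0%N ks i))%:E).

Definition no_inf_comp_as (lam : R) : Prop :=
  forall d (Omega : measurableType d) (Q : probability Omega R)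
         (eta : Omega -> set pt),
    is_PPP Q eta lam ->
    Q.-negligible [set w | has_inf_component (eta w) gadj].

Definition lambda_c : R := sup [set lam | 0 < lam /\ no_inf_comp_as lam].

Definition site_no_perc (V : set pt) (E : pt -> pt -> Prop) (p : R) : Prop :=
  forall d (Omega : measurableType d) (P : probability Omega R)
         (A : pt -> set Omega),
    (forall v, v \in V -> measurable (A v)) ->
    (forall s : seq pt, uniq s -> (forall v, v \in s -> v \in V) ->
       P (\big[setI/setT]_(v <- s) A v) = (p ^+ size s)%:E) ->
    P.-negligible [set w | has_inf_component [set v | V v /\ A v w] E].

Definition edge_list (V : set pt) (E : pt -> pt -> Prop) (s : seq (pt * pt)) :=
  [/\ uniq s, forall e, e \in s -> (e.2, e.1) \notin s
    & forall e, e \in s -> [/\ e.1 \in V, e.2 \in V & E e.1 e.2]].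

Definition bond_no_perc (V : set pt) (E : pt -> pt -> Prop) (p : R) : Prop :=
  forall d (Omega : measurableType d) (P : probability Omega R)
         (B : pt -> pt -> set Omega),
    (forall x y, B x y = B y x) ->
    (forall x y, x \in V -> y \in V -> E x y -> measurable (B x y)) ->
    (forall s, edge_list V E s ->
       P (\big[setI/setT]_(e <- s) B e.1 e.2) = (p ^+ size s)%:E) ->
    P.-negligible
      [set w | has_inf_component V (fun x y => E x y /\ B x y w)].

Definition pc_site (V : set pt) (E : pt -> pt -> Prop) : R :=
  sup [set p | 0 <= p <= 1 /\ site_no_perc V E p].

Definition pc_bond (V : set pt) (E : pt -> pt -> Prop) : R :=
  sup [set p | 0 <= p <= 1 /\ bond_no_perc V E p].

End Gilbert.

(* Main.v *)
(* The plane is cut into cells of side 1/(4b). The occupancies of the cells are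
   independent, and for a fixed configuration and a fixed box the graph of occupied
   cells coincides with the Gilbert graph once b is large.

   On the finite cell graph consider mixed percolation with site parameter s and
   bond parameter p, and its crossing probability theta(s, p). A pivotal edge
   enters a pivotal vertex that has no other entrance. Opening a further edge, or
   adding a vertex, turns such a vertex into a pivotal one with several entrances,
   so the two kinds of pivotal vertices have comparable expected numbers, uniformly
   in b. By Russo's formula
     theta(s, p) <= e^(2 c tau) theta(s e^tau, p e^(-(1 + c) tau))
   for some c > 0, which beats the trivial exchange of sites for bonds (c = 0).
   Starting from site percolation slightly above lambda_c one reaches bond
   percolation at intensity lambda with some p such that p lambda < lambda_c.

   Site percolation with p' lambda < lambda_c does not percolate, since thinning the
   process gives a subcritical intensity; a process of any intensity is a dilation
   of the given one. Bond percolation at p does: the inequality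
   theta_N(M) <= theta_n(M) theta_N(M') (crossings from the box M to the boxes n and
   N, and from M' to N, with M <= n < M') turns a positive crossing probability into
   one close to 1, and the infinite open cluster lies in C because the infinite
   component is unique. Uniqueness follows from the two-arm estimate of Aizenman,
   Kesten and Newman, applied to the cells uniformly in b. *)
From HB Require Import structures.
From mathcomp Require Import all_boot all_order all_algebra.
From mathcomp Require Import zify ring lra.
From mathcomp Require Import reals sequences exp.
Set Implicit Arguments. Unset Strict Implicit. Unset Printing Implicit Defensive.
Import Order.TTheory GRing.Theory Num.Theory.

Local Open Scope ring_scope.

(** * Bernoulli measures on finite sets *)

Section Bernoulli.
Context {R : realFieldType} {I : finType}.
Implicit Types (X D : {set I}) (p : R) (f g : {set I} -> R).

(** Every estimate concerns finite Bernoulli means, uniformly in the mesh. A cell is occupied with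
    probability [s] of order [b^-2] and has of order [b^2] neighbours. Adding a vertex costs a
    factor [1/s], which is recovered only because there are of order [b^2] positions for it. The
    main obstacle is that an added vertex may touch many occupied ones: the edges to them have to be
    closed, at a cost exponential in their number. Crowded vertices are therefore split off by
    Markov's inequality, and their mean crowding is controlled because a clique contains at most
    three pivotal vertices with a single entrance to which no second entrance can be opened. No
    surgery is possible on the target set; at most one pivotal vertex lies there, which is why the
    crossing probability itself enters the inequality and produces the factor [e^(2 c tau)].
    Percolation events of the process are never assumed measurable: they are covered by events about
    cells, and almost sure statements are phrased with negligible sets. *)

Definition bweight p X : R := \prod_i (if i \in X then p else 1 - p).
Definition bmean p f : R := \sum_(X : {set I}) bweight p X * f X.

Lemma bweight_ge0 p X : 0 <= p <= 1 -> 0 <= bweight p X.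
Proof.
move=> /andP[p0 p1]; apply: prodr_ge0 => i _; case: ifP => _ //.
by rewrite subr_ge0.
Qed.

Lemma bweightE p X : bweight p X = p ^+ #|X| * (1 - p) ^+ #|~: X|.
Proof.
rewrite /bweight (bigID (mem X)) /=; congr (_ * _).
  under eq_bigr => i iX do rewrite iX.
  by rewrite prodr_const.
rewrite (eq_bigl (fun i => i \in ~: X)); last by move=> i; rewrite !inE.
rewrite -prodr_const; by apply: eq_bigr => i h; rewrite in_setC in h; rewrite (negbTE h).
Qed.

Lemma bmean_sub p D : bmean p (fun X => (D \subset X)%:R) = p ^+ #|D|.
Proof.
have -> : p ^+ #|D| = \prod_i (p + (if i \in D then 0 else 1 - p)).
  rewrite (bigID (mem D)) /= [X in _ * X]big1 ?mulr1; last first.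
    by move=> i /negbTE ->; rewrite addrC subrK.
  by under eq_bigr => i iD do rewrite iD addr0; rewrite prodr_const.
rewrite bigA_distr; apply: eq_big => [X|X _]; first by rewrite inE.
rewrite /bweight; have [DX|] := boolP (D \subset X).
  rewrite mulr1; apply: eq_bigr => i _; case: ifPn => // iX.
  by case: ifPn => // iD; rewrite (subsetP DX) in iX.
case/subsetPn => i iD iX; rewrite mulr0 (bigD1 i) //= (negbTE iX) iD.
by rewrite mul0r.
Qed.

Lemma bmean_eq p f g : f =1 g -> bmean p f = bmean p g.
Proof. by move=> fg; apply: eq_bigr => X _; rewrite fg. Qed.

Lemma bmean_cst p (a : R) : bmean p (fun=> a) = a.
Proof.
have := bmean_sub p set0; rewrite cards0 expr0 => h.
rewrite /bmean -mulr_suml -[RHS]mul1r -h; congr (_ * _).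
by apply: eq_bigr => X _; rewrite sub0set mulr1.
Qed.

Lemma bmeanZ p (a : R) f : bmean p (fun X => a * f X) = a * bmean p f.
Proof. by rewrite /bmean mulr_sumr; apply: eq_bigr => X _; rewrite mulrCA. Qed.

Lemma bmeanD p f g : bmean p (fun X => f X + g X) = bmean p f + bmean p g.
Proof. by rewrite /bmean -big_split; apply: eq_bigr => X _; rewrite mulrDr. Qed.

Lemma bmeanB p f g : bmean p (fun X => f X - g X) = bmean p f - bmean p g.
Proof. by rewrite /bmean -sumrB; apply: eq_bigr => X _; rewrite mulrBr. Qed.

Lemma bmean_sum p (J : finType) (P : pred J) (F : J -> {set I} -> R) :
  bmean p (fun X => \sum_(j | P j) F j X) = \sum_(j | P j) bmean p (F j).
Proof.
rewrite /bmean exchange_big; apply: eq_bigr => X _.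
by rewrite mulr_sumr.
Qed.

Lemma ler_bmean p f g : 0 <= p <= 1 -> (forall X, f X <= g X) ->
  bmean p f <= bmean p g.
Proof.
by move=> p01 fg; apply: ler_sum => X _; rewrite ler_wpM2l ?bweight_ge0.
Qed.

Lemma bmean_ge0 p f : 0 <= p <= 1 -> (forall X, 0 <= f X) -> 0 <= bmean p f.
Proof. by move=> p01 f0; apply: sumr_ge0 => X _; rewrite mulr_ge0 ?bweight_ge0. Qed.

Lemma bmean1_id f : bmean 1 f = f [set: I].
Proof.
rewrite /bmean (bigD1 [set: I]) //= big1 ?addr0 => [|X XT].
  by rewrite /bweight big1 ?mul1r // => i _; rewrite inE.
have [i iX] : exists i, i \notin X.
  apply/existsP; apply: contraR XT; rewrite negb_exists => /forallP h.
  by apply/eqP/setP => i; rewrite inE; apply/negPn/h.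
by rewrite /bweight (bigD1 i) //= (negbTE iX) subrr !mul0r.
Qed.

(** Moebius inversion on the lattice of subsets, run downwards from the full set: [c X] is the only
    term of the up-sum at [X] that is not yet known. *)
Lemma upsum_inj (c c' : {set I} -> R) :
  (forall D, \sum_(X : {set I} | D \subset X) c X =
             \sum_(X : {set I} | D \subset X) c' X) -> c =1 c'.
Proof.
move=> h X; have [n] := ubnP #|~: X|; elim: n X => // n IH X Xn.
have := h X; rewrite (bigD1 X) //= [RHS](bigD1 X) //=.
have -> : \sum_(i : {set I} | (X \subset i) && (i != X)) c i =
          \sum_(i : {set I} | (X \subset i) && (i != X)) c' i.
  apply: eq_bigr => Y /andP[XY YX]; apply: IH.
  apply: leq_trans (_ : #|~: X| <= n)%N; last by rewrite -ltnS.
  apply: proper_card; rewrite properEneq setCS XY andbT.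
  by apply: contra YX => /eqP/(can_inj (@setCK I)) ->.
by move/addIr.
Qed.

(** The criterion by which a law is recognised as Bernoulli: only events of the form [D \subset X]
    have to be checked, never their complements. *)
Lemma bmean_upsum p (c : {set I} -> R) f :
  (forall D, \sum_(X : {set I} | D \subset X) c X = p ^+ #|D|) ->
  \sum_X c X * f X = bmean p f.
Proof.
move=> h; apply: eq_bigr => X _; congr (_ * _); apply: upsum_inj => D.
rewrite h -bmean_sub /bmean [RHS]big_mkcond; apply: eq_bigr => Y _.
by case: ifP; rewrite ?mulr1 ?mulr0.
Qed.

Lemma bmean_split p i f :
  bmean p f = bmean p (fun X => p * f (i |: X) + (1 - p) * f (X :\ i)).
Proof.
pose c X := if i \in X then p * (bweight p X + bweight p (X :\ i))
            else (1 - p) * (bweight p X + bweight p (i |: X)).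
have bwU X : i \notin X -> bweight p (i |: X) = p * \prod_(j | j != i) (if j \in X then p else 1 - p).
  move=> iX; rewrite /bweight (bigD1 i) //= setU11; congr (_ * _).
  by apply: eq_bigr => j ji; rewrite in_setU1 (negbTE ji).
have bwN X : i \notin X -> bweight p X = (1 - p) * \prod_(j | j != i) (if j \in X then p else 1 - p).
  by move=> iX; rewrite /bweight (bigD1 i) //= (negbTE iX).
have swp g : \sum_(X : {set I} | i \in X) g X = \sum_(X : {set I} | i \notin X) g (i |: X).
  rewrite (reindex_onto (fun X => i |: X) (fun X => X :\ i)) /=; last first.
    by move=> X iX; rewrite setD1K.
  apply: eq_bigl => X; rewrite setU11 /=.
  apply/eqP/idP => [<-|iX]; first by rewrite setD11.
  apply/setP => j; rewrite !inE; case: eqP => //= ->; exact/esym/negbTE.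
rewrite /bmean (bigID (fun X : {set I} => i \in X)) /= swp.
rewrite [RHS](bigID (fun X : {set I} => i \in X)) /= swp -!big_split /=.
apply: eq_bigr => X iX; rewrite bwU // (bwN _ iX).
have -> : i |: (i |: X) = i |: X by rewrite setUA setUid.
have -> : (i |: X) :\ i = X.
  apply/setP => j; rewrite !inE; case: eqP => //= ->; exact/esym/negbTE.
have -> : X :\ i = X.
  apply/setP => j; rewrite !inE; case: eqP => //= ->; exact/esym/negbTE.
ring.
Qed.

Lemma bmean_in p i f : bmean p (fun X => (i \in X)%:R * f X) = p * bmean p (fun X => f (i |: X)).
Proof.
rewrite (bmean_split _ i) -bmeanZ; apply: bmean_eq => X.
by rewrite setU11 setD11 mul0r mulr0 addr0 mul1r.
Qed.

Lemma bmean_notin p i f :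
  bmean p (fun X => (i \notin X)%:R * f X) = (1 - p) * bmean p (fun X => f (X :\ i)).
Proof.
rewrite (bmean_split _ i) -bmeanZ; apply: bmean_eq => X.
by rewrite setU11 setD11 mul0r mulr0 add0r mul1r.
Qed.

Lemma bmean_disjoint p D f :
  bmean p (fun X => [disjoint D & X]%:R * f X) = (1 - p) ^+ #|D| * bmean p (fun X => f (X :\: D)).
Proof.
have [n] := ubnP #|D|; elim: n D f => // n IH D f Dn.
have [->|[i iD]] := set_0Vmem D.
  rewrite cards0 expr0 mul1r; apply: bmean_eq => X.
  by rewrite -setI_eq0 set0I eqxx mul1r setD0.
have Di : (#|D :\ i| < n)%N by move: Dn; rewrite (cardsD1 i) iD.
rewrite (cardsD1 i) iD exprS -mulrA.
rewrite (@bmean_eq p _ (fun X => [disjoint D :\ i & X]%:R * ((i \notin X)%:R * f X))); last first.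
  move=> X; rewrite mulrA -natrM mulnb; congr (_%:R * _); congr (nat_of_bool _).
  rewrite -{1}(setD1K iD) -!setI_eq0 setIUl setU_eq0 andbC; congr (_ && _).
  apply/eqP/idP => [h|iX].
    by apply/negP => iX; have := in_set0 i; rewrite -h !inE eqxx iX.
  by apply/setP => j; rewrite !inE; case: eqP => //= ->; exact/negbTE.
rewrite IH // mulrCA; congr (_ * _).
rewrite (@bmean_eq p _ (fun X => (i \notin X)%:R * f (X :\: (D :\ i)))); last first.
  by move=> X; rewrite !inE eqxx.
rewrite bmean_notin; congr (_ * _); apply: bmean_eq => X; congr f.
apply/setP => j; rewrite !inE; case: eqP => [->|] //=; first by rewrite iD.
Qed.

Lemma bmean_thin (s p : R) f :
  bmean s (fun O => bmean p (fun U => f (O :&: U))) = bmean (s * p) f.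
Proof.
pose c X := \sum_(O : {set I}) \sum_(U : {set I} | O :&: U == X) bweight s O * bweight p U.
rewrite -(@bmean_upsum (s * p) c) => [|D].
  transitivity (\sum_(O : {set I}) \sum_(U : {set I}) bweight s O * bweight p U * f (O :&: U)).
    apply: eq_bigr => O _; rewrite /bmean mulr_sumr; apply: eq_bigr => U _.
    by rewrite mulrA.
  rewrite /c; under [RHS]eq_bigr do rewrite mulr_suml.
  rewrite [RHS]exchange_big; apply: eq_bigr => O _ /=.
  under [RHS]eq_bigr do rewrite mulr_suml.
  rewrite [RHS](exchange_big_dep xpredT) //=; apply: eq_bigr => U _.
  by rewrite (eq_bigl (pred1 (O :&: U))) ?big_pred1_eq // => X; rewrite /= eq_sym.
rewrite exprMn -!bmean_sub /c exchange_big /=.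
rewrite {1}/bmean mulr_suml; apply: eq_bigr => O _.
rewrite (exchange_big_dep xpredT) //= -mulrA -bmeanZ /bmean mulr_sumr.
apply: eq_bigr => U _.
rewrite big_mkcond (bigD1 (O :&: U)) //= big1 ?addr0; last first.
  by move=> X /negbTE XOU; case: ifP => // /andP[_]; rewrite eq_sym XOU.
rewrite eqxx andbT subsetI.
by case: (D \subset O); case: (D \subset U); rewrite /= ?(mulr0, mul0r, mulr1, mul1r).
Qed.

(** Finite-energy estimate: conditioning on [i \in X] costs at most [p^-1]. Together with
    [bmean_delle] it prices the surgeries on configurations below. *)
Lemma bmean_addle p i f : 0 < p <= 1 -> (forall X, 0 <= f X) ->
  bmean p (fun X => f (i |: X)) <= p^-1 * bmean p f.
Proof.
move=> /andP[p0 p1] f0; rewrite ler_pdivlMl // -bmean_in.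
apply: ler_bmean => [|X]; first by rewrite p1 ltW.
by case: (i \in X); rewrite ?mul1r ?mul0r.
Qed.

Lemma bmean_delle p D f : 0 <= p < 1 -> (forall X, 0 <= f X) ->
  bmean p (fun X => f (X :\: D)) <= (1 - p) ^- #|D| * bmean p f.
Proof.
move=> /andP[p0 p1] f0; have q0 : 0 < (1 - p) ^+ #|D| by rewrite exprn_gt0 ?subr_gt0.
rewrite ler_pdivlMl // -bmean_disjoint.
apply: ler_bmean => [|X]; first by rewrite p0 ltW.
by case: ([disjoint D & X]); rewrite ?mul1r ?mul0r.
Qed.

Lemma bmean_mono (s t : R) f : 0 <= s <= t -> t <= 1 ->
  (forall X Y : {set I}, X \subset Y -> f X <= f Y) -> bmean s f <= bmean t f.
Proof.
move=> /andP[s0 st] t1 fm.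
have [t0|t0] := eqVneq t 0.
  by have -> : s = t by apply/le_anti; rewrite st t0.
have tp : 0 < t by rewrite lt_neqAle eq_sym t0 (le_trans s0).
(* Coupling by thinning: the set of density [s] is a random subset of the set of density [t]. *)
have -> : s = t * (s / t) by rewrite mulrCA divff ?mulr1.
have st01 : 0 <= s / t <= 1.
  by apply/andP; split; [apply: divr_ge0 => //; exact: ltW|rewrite ler_pdivrMr // mul1r].
rewrite -bmean_thin; apply: ler_bmean => [|O]; first by rewrite t1 ltW.
rewrite -[leRHS](bmean_cst (s / t)); apply: ler_bmean => // U.
exact/fm/subsetIl.
Qed.

End Bernoulli.

(** * Pivotal vertices and edges *)

Section Percolation.
Context {V : finType}.
Variables (adj : rel V) (S T : {set V}).
Hypothesis adjC : symmetric adj.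
Hypothesis adjxx : irreflexive adj.
Implicit Types (O A : {set V}) (F : {set {set V}}) (x y z u : V).

(** An edge is the two-element set [[set x; z]], so that edge configurations are plain sets and
    carry [bmean] as well. *)
Definition step O F : rel V :=
  fun x z => [&& x \in O, z \in O, adj x z & [set x; z] \in F].
Fact reach_key : unit. Proof. exact: tt. Qed.
Definition reach O F :=
  locked_with reach_key [set z | [exists x in S :&: O, connect (step O F) x z]].
Definition perc O F := [exists z in T, z \in reach O F].
(** The entrances of [y]; removing [y] first ensures that none of them is reached through [y]
    itself. *)
Definition inn O F y := [set x in reach (O :\ y) F | adj x y && ([set x; y] \in F)].
Definition piv O F := [set y in O | perc O F && ~~ perc (O :\ y) F].
(* [solo]: pivotal vertices that are entered through exactly one open edge, so
   that this edge is pivotal too; [blob]: all the other pivotal vertices. *)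
Definition solo O F := [set y in piv O F | (y \notin S) && (#|inn O F y| == 1)%N].
Definition blob O F := piv O F :\: solo O F.
Definition pive O F := [set e in F | perc O F && ~~ perc O (F :\ e)].

Lemma in_reach O F z :
  (z \in reach O F) = [exists x in S :&: O, connect (step O F) x z].
Proof. by rewrite /reach; case: reach_key; rewrite /= inE. Qed.

Lemma reach_sub O F : reach O F \subset O.
Proof.
apply/subsetP => z; rewrite in_reach => /exists_inP[x]; rewrite inE => /andP[_ xO].
case/connectP => p; elim: p x xO => [|w p IH] x xO /=; first by move=> _ ->.
by case/andP => /and4P[_ wO _ _]; apply: IH.
Qed.

Lemma reachS O F x : x \in S -> x \in O -> x \in reach O F.
Proof.
by move=> xS xO; rewrite in_reach; apply/exists_inP; exists x; rewrite ?inE ?xS ?connect0.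
Qed.

Lemma reach_step O F x z : x \in reach O F -> step O F x z -> z \in reach O F.
Proof.
rewrite !in_reach => /exists_inP[w wS wx] xz; apply/exists_inP; exists w => //.
exact: connect_trans wx (connect1 xz).
Qed.

Lemma reach_min O F A : (forall x, x \in S -> x \in O -> x \in A) ->
  (forall x z, x \in A -> step O F x z -> z \in A) -> reach O F \subset A.
Proof.
move=> SA cA; apply/subsetP => z; rewrite in_reach => /exists_inP[x].
rewrite inE => /andP[xS xO]; move: (SA x xS xO) => xA.
case/connectP => p pp ->; elim: p x {xS xO} xA pp => //= w p IH x xA /andP[xw].
exact/IH/(cA x).
Qed.

Lemma reach_mono O O' F F' : O \subset O' -> F \subset F' -> reach O F \subset reach O' F'.
Proof.
move=> OO FF; apply: reach_min => [x xS xO|x z xA /and4P[xO zO a e]].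
  by apply: reachS => //; apply: (subsetP OO).
apply: reach_step xA _; rewrite /step a (subsetP FF) // !(subsetP OO) //.
Qed.

Lemma eq_reach O F F' :
  (forall x z, x \in O -> z \in O -> adj x z -> ([set x; z] \in F) = ([set x; z] \in F')) ->
  reach O F = reach O F'.
Proof.
move=> h; apply/setP => z; rewrite !in_reach; apply: eq_existsb => x.
congr (_ && _); apply: eq_connect => a b; rewrite /step.
by have [aO|] := boolP (a \in O); have [bO|] := boolP (b \in O); have [ab|] := boolP (adj a b); rewrite //= h.
Qed.

Lemma percP O F : reflect (exists2 z, z \in T & z \in reach O F) (perc O F).
Proof. exact: exists_inP. Qed.

Lemma perc_mono O O' F F' : O \subset O' -> F \subset F' -> perc O F -> perc O' F'.
Proof.
move=> OO FF /percP[z zT zr]; apply/percP; exists z => //.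
exact: (subsetP (reach_mono OO FF)).
Qed.

Lemma Nperc_sub O F O' F' : reach O F \subset reach O' F' -> ~~ perc O' F' -> ~~ perc O F.
Proof.
move=> h; apply: contra => /percP[z zT zr]; apply/percP; exists z => //.
exact: (subsetP h).
Qed.

Lemma set2_eqr x x' y : x' != y -> [set x'; y] = [set x; y] -> x' = x.
Proof.
move=> xy e; have := set21 x' y; rewrite e !inE (negbTE xy) orbF.
by move/eqP.
Qed.

Lemma pivP O F y : y \in piv O F -> [/\ y \in O, perc O F & ~~ perc (O :\ y) F].
Proof. by rewrite inE => /and3P[]. Qed.

Lemma exit_step O F A : (forall x, x \in S -> x \in O -> x \in A) ->
  ~~ (reach O F \subset A) -> exists x z, [/\ x \in A, z \notin A & step O F x z].
Proof.
move=> SA nA.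
have [/existsP[x /existsP[z /and3P[]]]|h] := boolP [exists x, exists z, [&& x \in A, z \notin A & step O F x z]].
  by exists x, z.
case/negP: nA; apply: reach_min => // x z xA xz.
move: h; rewrite negb_exists => /forallP/(_ x); rewrite negb_exists => /forallP/(_ z).
by rewrite xA xz andbT /= negbK.
Qed.

(** Let [A] be what is reached without [e]. The only step out of [A] is [e] itself, into some [y];
    deleting the vertex [y] leaves the same [A], so [y] is pivotal and the other end of [e] is its
    single entrance. The formula for [e] makes the passage from edges to vertices injective. *)
Lemma pive_solo O F e : e \in pive O F ->
  exists2 y, y \in solo O F & e = y |: inn O F y.
Proof.
rewrite inE => /and3P[eF pOF nOF].
set A := reach O (F :\ e).
have SA x : x \in S -> x \in O -> x \in A by exact: reachS.
have nA : ~~ (reach O F \subset A).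
  by apply/negP => h; move: (Nperc_sub h nOF); rewrite pOF.
have [x [y [xA yA xy]]] := exit_step SA nA.
have [xO yO axy exy] := and4P xy.
have ee : [set x; y] = e.
  apply/eqP; apply: contraNT yA => ne; apply: (reach_step xA).
  by rewrite /step xO yO axy !inE ne exy.
have yS : y \notin S by apply: contra yA => yS; exact: SA.
have ynx : x != y by apply: contraTneq axy => ->; rewrite adjxx.
set W := reach (O :\ y) F.
have WA : W \subset A.
  apply: reach_min => [z zS|z w zA]; first by rewrite inE => /andP[_]; exact: SA.
  case/and4P => /setD1P[zy zO] /setD1P[wy wO] azw ezw; apply: (reach_step zA).
  rewrite /step zO wO azw !inE ezw andbT /=; apply: contraTneq (set22 x y) => h.
  by rewrite ee -h !inE negb_or ![y == _]eq_sym zy wy.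
have AW : A \subset W.
  apply: reach_min => [z zS zO|z w zW zw].
    by apply: reachS => //; rewrite !inE zO andbT; apply: contraNneq yS => <-.
  have wA : w \in A := reach_step (subsetP WA _ zW) zw.
  have [zO wO azw] := and4P zw; rewrite inE => /andP[_ ezw].
  apply: (reach_step zW); rewrite /step azw ezw !inE zO wO !andbT.
  apply/andP; split; last by apply: contraNneq yA => <-.
  by apply: contraNneq yA => <-; exact: (subsetP WA _ zW).
have innE : inn O F y = [set x].
  apply/setP => z; rewrite !inE; apply/idP/eqP => [/and3P[zW azy ezy]|->].
    apply: (@set2_eqr _ _ y); first by apply: contraTneq azy => ->; rewrite adjxx.
    rewrite ee; apply/eqP; apply: contraNT yA => ne.
    have zA : z \in A by exact: (subsetP WA).
    apply: (reach_step zA); rewrite /step (subsetP (reach_sub _ _) _ zA) yO azy.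
    by rewrite !inE ne ezy.
  by rewrite (subsetP AW) //= axy.
exists y; last by rewrite innE finset.setUC -ee.
rewrite !inE yO pOF yS innE cards1 eqxx !andbT /=.
exact: Nperc_sub WA nOF.
Qed.

Lemma card_pive O F : (#|pive O F| <= #|solo O F|)%N.
Proof.
apply: leq_trans (leq_imset_card (fun y => y |: inn O F y) _).
apply: subset_leq_card; apply/subsetP => e /pive_solo[y y1 ->].
by apply/imsetP; exists y.
Qed.

(** All pivotal vertices lie on each crossing path, and the one met first is reached without the
    other. The proof avoids paths: if neither were reached, [A] could only be left into [y'], from a
    vertex that is also reached without [y]. *)
Lemma piv_total O F y y' : y \in piv O F -> y' \in piv O F -> y != y' ->
  (y \in reach (O :\ y') F) || (y' \in reach (O :\ y) F).
Proof.
move=> /pivP[yO pO ny] /pivP[yO' _ ny'] yy'.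
apply/negPn/negP; rewrite negb_or => /andP[h h'].
set A := reach (O :\ y') F in h.
have SA x : x \in S -> x \in O -> x \in A.
  move=> xS xO; apply: reachS => //; rewrite !inE xO andbT.
  apply: contraNneq h' => xy; apply: reachS; first by rewrite -xy.
  by rewrite !inE yO' eq_sym yy'.
have AW : A \subset A :&: reach (O :\ y) F.
  apply: reach_min => [x xS xO|x z /setIP[xA xW] xz].
    apply/setIP; split; first exact: reachS.
    move: xO => /setD1P[_ xO]; apply: reachS => //; rewrite !inE xO andbT.
    by apply: contraNneq h => xy; apply: reachS; [rewrite -xy|rewrite !inE yy'].
  have zA := reach_step xA xz; rewrite inE zA /=.
  have [/setD1P[xy' xO] /setD1P[zy' zO] axz exz] := and4P xz.
  apply: (reach_step xW); have := subsetP (reach_sub _ _) _ xW.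
  rewrite /step axz exz !inE zO xO !andbT => -> /=.
  by apply: contraNneq h => <-.
have nA : ~~ (reach O F \subset A).
  by apply/negP => hs; move: (Nperc_sub hs ny'); rewrite pO.
have [x [z [xA zA xz]]] := exit_step SA nA.
have [xO zO axz exz] := and4P xz.
have /setIP[_ xW] := subsetP AW _ xA.
have xO' : x \in O :\ y' := subsetP (reach_sub _ _) _ xA.
have xO2 : x \in O :\ y := subsetP (reach_sub _ _) _ xW.
have zy : z = y'.
  apply/eqP; apply: contraNT zA => zy'; apply: (reach_step xA).
  by rewrite /step xO' axz exz !inE zy' zO.
case/negP: h'; rewrite -zy; apply: (reach_step xW).
by rewrite /step xO2 axz exz !inE zO zy eq_sym yy'.
Qed.

(** Of two pivotal vertices in the target, one would be reached, and a crossing completed, without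
    the other. *)
Lemma card_pivT O F : (#|piv O F :&: T| <= perc O F)%N.
Proof.
have [pO|pO] := boolP (perc O F); last first.
  by rewrite leqn0 cards_eq0; apply/eqP/setP => y; rewrite !inE (negbTE pO) andbF.
rewrite leqNgt; apply/negP => /card_gt1P[y [y' [/setIP[yp yT] /setIP[yp' yT'] yy']]].
have [_ _ ny] := pivP yp; have [_ _ ny'] := pivP yp'.
case/orP: (piv_total yp yp' yy') => h.
  by case/percP: ny'; exists y.
by case/percP: ny; exists y'.
Qed.

Lemma soloP O F y : y \in solo O F -> exists u,
  [/\ y \in piv O F, y \notin S, inn O F y = [set u] & u \in reach (O :\ y) F].
Proof.
rewrite inE => /and3P[yp yS /cards1P[u iu]]; exists u; split => //.
by have := set11 u; rewrite -iu inE => /andP[].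
Qed.

Lemma blob_intro O F y : y \in piv O F -> #|inn O F y| = 2%N -> y \in blob O F.
Proof. by move=> yp i2; rewrite inE yp andbT inE i2 !andbF. Qed.

(** Rigid vertices: no closed edge joins [y] to the set reached without it, so a second entrance
    cannot be created by opening an edge. *)
Definition rig O F := [set y in solo O F |
  [forall s, (s \in reach (O :\ y) F) && adj s y ==> (s \in inn O F y)]].

(** An edge at [y] does not affect what is reached without [y], so [y] stays pivotal and merely
    gains the entrance [s]. The exact value of [inn] is recorded so that preimages can be
    counted. *)
Lemma flip_blob O F y s : y \in solo O F -> s \in reach (O :\ y) F -> adj s y ->
  s \notin inn O F y ->
  y \in blob O ([set s; y] |: F) /\
  exists2 u, u != s & inn O ([set s; y] |: F) y = [set u; s].
Proof.
move=> /soloP[u [yp yS iu ur]] sr asy si; set F' := _ |: F.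
have rE : reach (O :\ y) F' = reach (O :\ y) F.
  apply: eq_reach => x z; rewrite !inE => /andP[xy _] /andP[zy _] _.
  suff /negbTE -> : [set x; z] != [set s; y] by [].
  apply: contraTneq (set22 s y) => <-.
  by rewrite !inE negb_or ![y == _]eq_sym xy zy.
have iE : inn O F' y = [set u; s].
  apply/setP => x; rewrite inE rE; apply/idP/set2P => [/and3P[xr axy]|[->|->]].
  - rewrite 2!inE => /orP[/eqP e|e]; [right|left].
      by apply: set2_eqr e; apply: contraTneq axy => ->; rewrite adjxx.
    by apply/set1P; rewrite -iu inE xr axy e.
  - have : u \in inn O F y by rewrite iu set11.
    by rewrite inE => /and3P[-> -> e]; rewrite 2!inE e orbT.
  - by rewrite sr asy 2!inE eqxx.
have us : u != s by apply: contraNneq si => <-; rewrite iu set11.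
have [yO pO ny] := pivP yp.
split; last by exists u.
apply: blob_intro; last by rewrite iE cards2 us.
rewrite inE yO (perc_mono _ _ pO) ?subsetUr //=.
by apply: Nperc_sub ny; rewrite rE.
Qed.

(** All edges from [x] to occupied vertices are closed except those to [u] and [y]. Without [y] the
    new vertex is a dead end attached to [u], outside [T], so no crossing avoids [y]; with [y] it is
    a second entrance. *)
Lemma surgery_blob O F y u x : y \in solo O F -> inn O F y = [set u] ->
  x \notin O -> x \notin T -> adj x u -> adj x y ->
  let F' := [set x; u] |: ([set x; y] |: (F :\: [set [set x; v] | v in [set v in O | adj x v]])) in
  y \in blob (x |: O) F' /\ inn (x |: O) F' y = [set u; x].
Proof.
move=> /soloP[u' [yp yS iu' ur]] iu xO xT axu axy F'.
have uu : u' = u by apply/eqP; rewrite -in_set1 -iu iu' set11.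
rewrite {u' iu'}uu in ur.
have uO : u \in O :\ y := subsetP (reach_sub _ _) _ ur.
have [yO pO ny] := pivP yp.
have xy : x != y by apply: contraTneq axy => ->; rewrite adjxx.
have FE a b : a != x -> b != x -> ([set a; b] \in F') = ([set a; b] \in F).
  move=> ax bx.
  have N c : [set a; b] != [set x; c].
    apply: contraTneq (set21 x c) => <-.
    by rewrite !inE negb_or ![x == _]eq_sym ax bx.
  rewrite !inE !(negbTE (N _)) /= andbC; apply: andb_idr => _.
  by apply/imsetP => -[c _ /eqP]; apply/negP.
have OE : (x |: O) :\ y = x |: (O :\ y).
  by apply/setP => z; rewrite !inE; case: (eqVneq z x) => [->|] //=; rewrite ?xy.
have xF v : v \in O -> adj x v -> v != u -> v != y -> [set x; v] \notin F'.
  have set2_eql a : v != x -> [set x; v] = [set x; a] -> v = a.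
    by rewrite ![[set x; _]]finset.setUC; exact: set2_eqr.
  move=> vO axv vu vy; have vx : v != x by apply: contraNneq xO => <-.
  apply/negP => /setU1P[/(set2_eql _ vx)/eqP|/setU1P[/(set2_eql _ vx)/eqP|/setDP[_ /negP[]]]].
  - by rewrite (negbTE vu).
  - by rewrite (negbTE vy).
  - by apply/imset_f; rewrite inE vO.
have rE : reach ((x |: O) :\ y) F' = x |: reach (O :\ y) F.
  apply/eqP; rewrite eqEsubset; apply/andP; split.
    apply: reach_min => [z zS|z w].
      rewrite OE !inE => /orP[->//|/andP[zy zO]].
      by rewrite reachS ?orbT // !inE zy.
    rewrite OE => /setU1P[->|zr] /and4P[_ wO azw ezw].
      case/setU1P: wO => [->|wO]; first by rewrite setU11.
      have [wy wO'] := setD1P wO.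
      have [->|wu] := eqVneq w u; first by rewrite inE ur orbT.
      by rewrite (negbTE (xF w _ _ _ _)) in ezw.
    case/setU1P: wO => [->|wO]; first by rewrite setU11.
    have zO : z \in O :\ y := subsetP (reach_sub _ _) _ zr.
    have [[_ zO'] [_ wO']] := (setD1P zO, setD1P wO).
    rewrite inE; apply/orP; right; apply: (reach_step zr).
    rewrite /step zO wO azw -FE //; by apply: contraNneq xO => <-.
  have sub : reach (O :\ y) F \subset reach ((x |: O) :\ y) F'.
    apply: reach_min => [z zS zO|z w zr /and4P[zO wO azw ezw]].
      by apply: reachS => //; rewrite OE inE zO orbT.
    have [[_ zO'] [_ wO']] := (setD1P zO, setD1P wO).
    have [zx wx] : z != x /\ w != x by split; apply: contraNneq xO => <-.
    by apply: (reach_step zr); rewrite /step azw FE // ezw OE !in_setU1 zO wO !orbT.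
  rewrite finset.subUset sub andbT finset.sub1set.
  apply: (reach_step (subsetP sub _ ur)).
  have eux : [set u; x] \in F' by rewrite [[set u; x]]finset.setUC setU11.
  by rewrite /step adjC axu eux OE setU11 in_setU1 uO orbT.
have ux : u != x by apply: contraNneq xO => <-; case/setD1P: uO.
have iE : inn (x |: O) F' y = [set u; x].
  apply/setP => z; rewrite inE rE.
  apply/idP/set2P => [/and3P[/setU1P[->|zr] azy ezy]|[->|->]]; first by right.
  - left; apply/set1P; rewrite -iu inE zr azy -FE // ?ezy //.
      have /setD1P[_ zO] := subsetP (reach_sub _ _) _ zr.
      by apply: contraNneq xO => <-.
    by rewrite eq_sym.
  - have : u \in inn O F y by rewrite iu set11.
    rewrite inE => /and3P[_ -> e]; rewrite in_setU1 ur orbT /= FE //.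
    by rewrite eq_sym.
  - by rewrite setU11 axy !inE eqxx orbT.
split=> //; apply: blob_intro; last by rewrite iE cards2 ux.
rewrite inE setU1r //=; apply/andP; split.
  have [z zT zr] := percP _ _ pO; apply/percP; exists z => //.
  move: zr; apply/subsetP; apply: reach_min => [w wS wO|w v wr /and4P[wO vO awv ewv]].
    by apply: reachS => //; rewrite inE wO orbT.
  have [wx vx] : w != x /\ v != x by split; apply: contraNneq xO => <-.
  by apply: (reach_step wr); rewrite /step awv FE // ewv !in_setU1 wO vO !orbT.
apply/percP => -[z zT]; rewrite rE => /setU1P[zx|zr].
  by rewrite -zx zT in xT.
by case/percP: ny; exists z.
Qed.

End Percolation.

(** * Mean numbers of pivotal vertices of the two kinds *)

Section MixedPercolation.
Context {R : realFieldType} {V : finType}.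
Variables (adj : rel V) (S T : {set V}).
Hypothesis adjC : symmetric adj.
Hypothesis adjxx : irreflexive adj.
Implicit Types (O A : {set V}) (F : {set {set V}}) (x y z u : V) (s p : R).
Local Notation reach := (reach adj S).
Local Notation perc := (perc adj S T).
Local Notation inn := (inn adj S).
Local Notation piv := (piv adj S T).
Local Notation solo := (solo adj S T).
Local Notation blob := (blob adj S T).
Local Notation rig := (rig adj S T).

Definition mean2 s p (f : {set V} -> {set {set V}} -> R) :=
  bmean s (fun O => bmean p (fun F => f O F)).

Lemma ler_mean2 s p f g : 0 <= s <= 1 -> 0 <= p <= 1 ->
  (forall O F, f O F <= g O F) -> mean2 s p f <= mean2 s p g.
Proof. by move=> s01 p01 fg; apply: ler_bmean => // O; apply: ler_bmean. Qed.

Lemma mean2_ge0 s p f : 0 <= s <= 1 -> 0 <= p <= 1 ->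
  (forall O F, 0 <= f O F) -> 0 <= mean2 s p f.
Proof. by move=> s01 p01 f0; apply: bmean_ge0 => // O; apply: bmean_ge0. Qed.

Lemma mean2D s p f g : mean2 s p (fun O F => f O F + g O F) = mean2 s p f + mean2 s p g.
Proof. by rewrite /mean2 -bmeanD; apply: bmean_eq => O; rewrite bmeanD. Qed.

Lemma mean2Z s p a f : mean2 s p (fun O F => a * f O F) = a * mean2 s p f.
Proof. by rewrite /mean2 -bmeanZ; apply: bmean_eq => O; rewrite bmeanZ. Qed.

Lemma mean2_sum s p (J : finType) (P : pred J) (f : J -> {set V} -> {set {set V}} -> R) :
  mean2 s p (fun O F => \sum_(j | P j) f j O F) = \sum_(j | P j) mean2 s p (f j).
Proof. by rewrite /mean2 -bmean_sum; apply: bmean_eq => O; rewrite bmean_sum. Qed.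

Lemma natr_card (J : finType) (A : {set J}) : #|A|%:R = \sum_j (j \in A)%:R :> R.
Proof.
rewrite -sum1_card natr_sum big_mkcond; apply: eq_bigr => j _.
by case: (j \in A).
Qed.

Lemma ler_bool (b : bool) (a : R) : 0 <= a -> (b -> 1 <= a) -> b%:R <= a.
Proof. by case: b => // _; exact. Qed.

(** Exchanging the closed state of one edge for the open state costs [(1 - p) / p]. The 2 counts
    preimages: the flipped edge comes from one of the two entrances of [y]. *)
Lemma flip_mean s p : 0 <= s <= 1 -> 0 < p <= 1 ->
  mean2 s p (fun O F => #|solo O F :\: rig O F|%:R) <=
  (1 - p) / p * 2 * mean2 s p (fun O F => #|blob O F|%:R).
Proof.
move=> s01 /[dup] pp /andP[p0 p1]; have p01 : 0 <= p <= 1 by rewrite p1 ltW.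
rewrite /mean2 -bmeanZ; apply: ler_bmean => // O.
pose psi y v F : R := [&& y \in blob O F, v \in inn O F y & #|inn O F y| == 2%N]%:R.
have h y v : bmean p (fun F => ([&& y \in solo O F, v \in reach (O :\ y) F, adj v y &
     [set v; y] \notin F] : bool)%:R) <= (1 - p) / p * bmean p (psi y v).
  pose e := [set v; y].
  apply: (@le_trans _ _ (bmean p (fun F => (e \notin F)%:R * psi y v (e |: F)))).
    apply: ler_bmean => // F; apply: ler_bool => [|/and4P[y1 vr ay nF]].
      by rewrite mulr_ge0.
    have [|yb [w wv iE]] := flip_blob adjxx y1 vr ay.
      by rewrite inE (negbTE nF) !andbF.
    by rewrite nF mul1r /psi yb /= iE set22 cards2 wv.
  rewrite bmean_notin -mulrA ler_wpM2l ?subr_ge0 //.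
  apply: le_trans (_ : bmean p (fun F => psi y v (e |: F)) <= _).
    apply: ler_bmean => // F; have -> // : e |: (F :\ e) = e |: F.
    by apply/setP => c; rewrite !inE; case: eqP.
  by apply: bmean_addle => // F.
apply: (@le_trans _ _ (bmean p (fun F => \sum_y \sum_v ([&& y \in solo O F,
   v \in reach (O :\ y) F, adj v y & [set v; y] \notin F] : bool)%:R))).
  apply: ler_bmean => // F; rewrite natr_card; apply: ler_sum => y _.
  apply: ler_bool; first by apply: sumr_ge0.
  rewrite inE => /andP[nr y1]; move: nr; rewrite inE y1 /= negb_forall => /existsP[v].
  rewrite negb_imply => /andP[/andP[vr ay]]; rewrite inE vr ay /= => nF.
  by rewrite (bigD1 v) //= vr ay nF lerDl sumr_ge0.
rewrite bmean_sum; under eq_bigr do rewrite bmean_sum.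
apply: (@le_trans _ _ (\sum_y \sum_v (1 - p) / p * bmean p (psi y v))).
  by apply: ler_sum => y _; apply: ler_sum => v _; apply: h.
under eq_bigr do rewrite -mulr_sumr.
rewrite -mulr_sumr -[leRHS]mulrA ler_wpM2l ?divr_ge0 ?subr_ge0 ?(ltW p0) //.
under eq_bigr do rewrite -bmean_sum.
rewrite -bmean_sum -bmeanZ; apply: ler_bmean => // F.
rewrite natr_card mulr_sumr; apply: ler_sum => y _; rewrite /psi.
case: (y \in blob O F) => /=; last by rewrite big1 // mulr0.
have [i2|i2] := eqVneq #|inn O F y| 2%N; last first.
  by rewrite big1 ?mulr1 // => v _; rewrite andbF.
under eq_bigr do rewrite andbT.
by rewrite -natr_card i2 mulr1.
Qed.

Definition nb2 y z := [exists x, adj y x && adj x z].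
(** The crowding of [y]: for every neighbour [x] of [y] it bounds the number of occupied neighbours
    of [x], hence of the edges that a surgery adding [x] has to close. *)
Definition nocc O y := #|[set z in O | nb2 y z]|.

Lemma nb2C : symmetric nb2.
Proof. by move=> y z; apply: eq_existsb => x; rewrite andbC adjC (adjC y). Qed.

(** Vacating a non-pivotal [z] keeps the crossing and keeps [y] pivotal, and it changes the weight
    by [s / (1 - s)]. *)
Lemma piv_nonpiv_mean s p y z : 0 <= s < 1 -> 0 <= p <= 1 ->
  mean2 s p (fun O F => [&& y \in piv O F, z \in O & z \notin piv O F]%:R) <=
  s / (1 - s) * mean2 s p (fun O F => (y \in piv O F)%:R).
Proof.
move=> /andP[s0 s1] p01; have s01 : 0 <= s <= 1 by rewrite s0 ltW.
pose h O := bmean p (fun F => (y \in piv O F)%:R : R).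
apply: (@le_trans _ _ (bmean s (fun O => (z \in O)%:R * h (O :\ z)))).
  apply: ler_bmean => // O; rewrite /h -bmeanZ; apply: ler_bmean => // F.
  apply: ler_bool => [|/and3P[yp zO zp]]; first by rewrite mulr_ge0.
  rewrite zO mul1r; have [yO pO ny] := pivP yp.
  have yz : y != z by apply: contraNneq zp => <-.
  have pz : perc (O :\ z) F by move: zp; rewrite inE zO pO /= negbK.
  have -> : y \in piv (O :\ z) F; last by [].
  rewrite inE pz !inE yz yO /=; apply: contra ny; apply: perc_mono => //.
  by apply/subsetP => w; rewrite !inE => /and3P[-> _ ->].
rewrite bmean_in -mulrA ler_wpM2l //.
apply: le_trans (_ : bmean s (fun O => h (O :\: [set z])) <= _).
  rewrite le_eqVlt; apply/orP; left; apply/eqP/bmean_eq => O; congr h.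
  by apply/setP => w; rewrite !inE; case: eqP.
have := @bmean_delle R V s [set z] h; rewrite cards1 expr1; apply; first by rewrite s0.
by move=> O; apply: bmean_ge0.
Qed.

Context {K : finType}.
Variable cl : V -> K.
Hypothesis cl_adj : forall x y, cl x = cl y -> x != y -> adj x y.

(** A class is a clique. Of two rigid vertices in it one is reached without the other by
    [piv_total], and rigidity makes it the entrance of the other. As entrances are unique, [n] such
    vertices satisfy [n * n <= n + (n + n)]. *)
Lemma card_rig_class O F k : (#|[set y in rig O F | cl y == k]| <= 3)%N.
Proof.
set A := [set y in _ | _]; set n := #|A|.
pose P := [set w : V * V | [&& w.1 \in A, w.2 \in A & w.1 \in inn O F w.2]].
pose P' := [set w : V * V | [&& w.1 \in A, w.2 \in A & w.2 \in inn O F w.1]].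
have rA y : y \in A -> [/\ y \in piv O F, #|inn O F y| = 1%N & forall v, v \in reach (O :\ y) F -> adj v y -> v \in inn O F y].
  rewrite inE => /andP[]; rewrite inE => /andP[]; rewrite inE => /and3P[yp _ /eqP i1] /forallP h _.
  by split => // v vr vy; apply: (implyP (h v)); rewrite vr.
have uniq_inn y a b : y \in A -> a \in inn O F y -> b \in inn O F y -> a = b.
  by move=> /rA[_ /eqP/cards1P[u ->] _] /set1P -> /set1P ->.
have cP : (#|P| <= n)%N.
  rewrite -(@card_in_imset _ _ snd) => [|[a b] [a' b']].
    by apply/subset_leq_card/subsetP => _ /imsetP[w + ->]; rewrite inE => /and3P[].
  rewrite inE /= => /and3P[_ bA ab]; rewrite inE /= => /and3P[_ _ ab'] bb; rewrite -bb in ab' *.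
  by congr pair; exact: (uniq_inn b).
have cP' : (#|P'| <= n)%N.
  rewrite -(@card_in_imset _ _ fst) => [|[a b] [a' b']].
    by apply/subset_leq_card/subsetP => _ /imsetP[w + ->]; rewrite inE => /and3P[].
  rewrite inE /= => /and3P[aA _ ab]; rewrite inE /= => /and3P[_ _ ab'] aa; rewrite -aa in ab' *.
  by congr pair; exact: (uniq_inn a).
have : (#|finset.setX A A| <= #|[set (y, y) | y in A] :|: (P :|: P')|)%N.
  apply/subset_leq_card/subsetP => -[a b]; rewrite inE /= => /andP[aA bA].
  have [<-|ab] := eqVneq a b; first by apply/setUP; left; apply/imsetP; exists a.
  have [ap _ ha] := rA a aA; have [bp _ hb] := rA b bA.
  have cab : cl a = cl b.
    by move: aA bA; rewrite !inE => /andP[_ /eqP->] /andP[_ /eqP->].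
  apply/setUP; right; apply/setUP.
  case/orP: (piv_total ap bp ab) => h; [left|right]; rewrite inE /= aA bA /=.
    by apply: hb => //; exact: cl_adj.
  by apply: ha => //; apply: cl_adj; rewrite // eq_sym.
rewrite cardsX -/n => h.
have h2 : (n * n <= n + (n + n))%N.
  apply: leq_trans h (leq_trans (leq_card_setU _ _) _); apply: leq_add.
    exact: leq_imset_card.
  exact: leq_trans (leq_card_setU _ _) (leq_add cP cP').
nia.
Qed.

Variable m : nat.
Hypothesis cl_nb2 : forall z, (#|[set cl y | y in [set y | nb2 z y]]| <= m)%N.

Lemma card_rig_nb2 O F z : (#|[set y in rig O F | nb2 z y]| <= 3 * m)%N.
Proof.
set A := [set y in _ | _]; rewrite -sum1_card.
rewrite (partition_big_imset cl) /=.
apply: (@leq_trans (\sum_(k in [set cl y | y in A]) 3)).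
  apply: leq_sum => k _; rewrite sum1dep_card; apply: leq_trans (card_rig_class O F k).
  by apply/subset_leq_card/subsetP => y; rewrite !inE => /andP[/andP[-> _] ->].
rewrite sum_nat_const mulnC leq_mul2l /=; apply: leq_trans (cl_nb2 z).
by apply/subset_leq_card/imsetS/subsetP => y; rewrite !inE => /andP[].
Qed.

Variable D : nat.
Hypothesis card_nb2 : forall z, (#|[set y | nb2 z y]| <= D)%N.

(** The occupied vertices [z] near a rigid [y] are split. Non-pivotal ones cost [s / (1 - s)] for
    each of at most [D] positions; a pivotal [z] is charged to itself, as it has at most [3 * m]
    rigid vertices around it. *)
Lemma rig_nocc_mean s p : 0 <= s < 1 -> 0 <= p <= 1 ->
  mean2 s p (fun O F => \sum_(y in rig O F) (nocc O y)%:R) <=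
  (s / (1 - s) * D%:R + (3 * m)%:R) * mean2 s p (fun O F => #|piv O F|%:R).
Proof.
move=> /[dup] ss /andP[s0 s1] p01; have s01 : 0 <= s <= 1 by rewrite s0 ltW.
apply: (@le_trans _ _ (mean2 s p (fun O F =>
   \sum_y \sum_(z | nb2 y z) [&& y \in piv O F, z \in O & z \notin piv O F]%:R +
   (3 * m)%:R * #|piv O F|%:R))).
  apply: ler_mean2 => // O F.
  apply: (@le_trans _ _ (\sum_y \sum_(z | nb2 y z) [&& y \in piv O F, z \in O & z \notin piv O F]%:R +
     \sum_y \sum_(z | nb2 y z) [&& y \in rig O F & z \in piv O F]%:R)).
    rewrite big_mkcond -big_split /=; apply: ler_sum => y _.
    rewrite -big_split /=; case: ifPn => [yr|_]; last by apply: sumr_ge0 => z _; rewrite addr_ge0.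
    have yp : y \in piv O F by move: yr; rewrite inE => /andP[]; rewrite inE => /andP[].
    rewrite natr_card [leRHS]big_mkcond /=; apply: ler_sum => z _.
    rewrite inE; case: (nb2 y z); rewrite ?andbF // ?andbT yp /=.
    by case: (z \in O); case: (z \in piv O F); rewrite /= ?add0r ?addr0 ?ler01 ?lexx // lerDl.
  rewrite lerD2l (exchange_big_dep xpredT) //= natr_card mulr_sumr.
  apply: ler_sum => z _; case: (z \in piv O F); last by rewrite mulr0 big1 // => y _; rewrite andbF.
  rewrite mulr1; under eq_bigr do rewrite andbT.
  apply: le_trans (_ : #|[set y in rig O F | nb2 z y]|%:R <= _); last by rewrite ler_nat card_rig_nb2.
  rewrite natr_card big_mkcond; apply: ler_sum => y _; rewrite !inE nb2C.
  by case: (nb2 z y); rewrite ?andbT ?andbF.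
rewrite mean2D mean2Z mulrDl lerD2r mean2_sum.
rewrite [X in _ <= _ * X](_ : _ = \sum_y mean2 s p (fun O F => (y \in piv O F)%:R)); last first.
  by rewrite -mean2_sum; apply: bmean_eq => O; apply: bmean_eq => F; rewrite natr_card.
rewrite mulr_sumr; apply: ler_sum => y _; rewrite mean2_sum.
apply: (@le_trans _ _ (\sum_(z | nb2 y z) s / (1 - s) * mean2 s p (fun O F => (y \in piv O F)%:R))).
  by apply: ler_sum => z _; apply: piv_nonpiv_mean.
rewrite sumr_const -[leLHS]mulr_natl mulrA ler_wpM2r ?mean2_ge0 //.
rewrite mulrC ler_wpM2l ?divr_ge0 ?subr_ge0 ?(ltW s1) // ler_nat.
by rewrite -(cardsE (nb2 y)); exact: card_nb2.
Qed.

Variables L N : nat.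
Hypothesis common_nb : forall u y, u \notin T -> y \notin T -> adj u y ->
  (L <= #|[set x | [&& x \notin T, adj x u & adj x y]]|)%N.

Definition rigN O F := [set y in rig O F | (y \notin T) && (nocc O y <= N)%N].

Lemma pairs_set2 (A : {set V}) :
  \sum_u \sum_x [&& u != x & A == [set u; x]]%:R <= 2 :> R.
Proof.
rewrite pair_big /=.
under eq_bigr => w _ do rewrite -[[&& _ & _]](in_set (fun w : V * V => [&& w.1 != w.2 & A == [set w.1; w.2]])).
rewrite -natr_card ler_nat; set P := finset _.
have [->|[[a b] abP]] := set_0Vmem P; first by rewrite cards0.
move: (abP); rewrite inE /= => /andP[ab /eqP AE].
apply: (@leq_trans #|[set (a, b); (b, a)]|); last by rewrite cards2; case: (_ != _).
apply/subset_leq_card/subsetP => -[c d]; rewrite inE /= => /andP[cd /eqP AE'].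
have : c \in A by rewrite AE' set21.
have : d \in A by rewrite AE' set22.
move: cd; rewrite AE !inE => cd /orP[/eqP dE|/eqP dE] /orP[/eqP cE|/eqP cE];
  by move: cd; rewrite dE cE ?eqxx ?orbT.
Qed.

(** At most [N] of the [L] common neighbours of [y] and its entrance are occupied, which leaves
    [L - N] choices of [x]. The price is [(1 - s) / s] for the vertex, [p ^- 2] for its two open
    edges and [(1 - p) ^- N] for the closed ones; the 2 counts the ways to read [(u, x)] off the two
    entrances. *)
Lemma surgery_mean s p : 0 < s <= 1 -> 0 < p < 1 ->
  (L - N)%:R * mean2 s p (fun O F => #|rigN O F|%:R) <=
  (1 - s) / s * (p ^- 2 * (1 - p) ^- N) * 2 * mean2 s p (fun O F => #|blob O F|%:R).
Proof.
move=> /[dup] ss /andP[s0 s1] /andP[p0 p1].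
have s01 : 0 <= s <= 1 by rewrite s1 ltW.
have p01 : 0 <= p <= 1 by rewrite !ltW.
have q0 : 0 < 1 - p by rewrite subr_gt0.
set c := p ^- 2 * (1 - p) ^- N.
have c0 : 0 <= c by apply: mulr_ge0; rewrite invr_ge0 exprn_ge0 // ltW.
pose phi y u x O F : bool := [&& y \in rigN O F, inn O F y == [set u], x \notin O,
  x \notin T, adj x u & adj x y].
pose psi y u x O F : bool := [&& y \in blob O F, u != x & inn O F y == [set u; x]].
have h y u x : mean2 s p (fun O F => (phi y u x O F)%:R) <=
  (1 - s) / s * c * mean2 s p (fun O F => (psi y u x O F)%:R).
  pose g O := bmean p (fun F => (psi y u x O F)%:R : R).
  have g0 O : 0 <= g O by apply: bmean_ge0.
  apply: (@le_trans _ _ (bmean s (fun O => (x \notin O)%:R * (c * g (x |: O))))).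
    apply: ler_bmean => // O; have [xO|xO] := boolP (x \in O).
      rewrite mul0r /phi (@bmean_eq _ _ _ _ (fun=> 0)) ?bmean_cst // => F.
      by rewrite xO !andbF.
    rewrite mul1r; have [nO|nO] := leqP (nocc O y) N; last first.
      rewrite (@bmean_eq _ _ _ _ (fun=> 0)) ?bmean_cst => [|F]; first exact: mulr_ge0.
      by rewrite /phi /rigN inE leqNgt nO !andbF.
    have [axy|axy] := boolP (adj x y); last first.
      rewrite (@bmean_eq _ _ _ _ (fun=> 0)) ?bmean_cst => [|F]; first exact: mulr_ge0.
      by rewrite /phi (negbTE axy) !andbF.
    pose E := [set [set x; v] | v in [set v in O | adj x v]].
    have cE : (#|E| <= N)%N.
      apply: leq_trans (leq_imset_card _ _) (leq_trans _ nO).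
      apply/subset_leq_card/subsetP => v; rewrite !inE => /andP[-> axv].
      by apply/existsP; exists x; rewrite adjC axy.
    pose G F : R := (psi y u x (x |: O) ([set x; u] |: ([set x; y] |: F)))%:R.
    apply: (@le_trans _ _ (bmean p (fun F => G (F :\: E)))).
      apply: ler_bmean => // F; apply: ler_bool => // /and4P[yr /eqP iE _ /and3P[xT axu _]].
      have y1 : y \in solo O F by move: yr; rewrite inE => /andP[]; rewrite inE => /andP[].
      have [yb iE'] := surgery_blob adjC adjxx y1 iE xO xT axu axy.
      have ux : u != x.
        apply: contraNneq xO => <-; have : u \in inn O F y by rewrite iE set11.
        by rewrite inE => /andP[/(subsetP (reach_sub _ _ _ _))/setD1P[]].
      by rewrite /G /psi yb ux iE' eqxx.
    apply: le_trans (bmean_delle _ _ _) _; [by rewrite p1 ltW|by []|].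
    rewrite /c [leRHS]mulrAC [leRHS]mulrC; apply: ler_pM.
    - by rewrite invr_ge0 exprn_ge0 // ltW.
    - exact: bmean_ge0.
    - rewrite lef_pV2 ?posrE ?exprn_gt0 //.
      by apply: ler_wiXn2l => //; rewrite ?gerBl ltW.
    have pp : 0 < p <= 1 by rewrite p0 ltW.
    pose G1 F : R := (psi y u x (x |: O) F)%:R.
    have G10 F : 0 <= G1 F by [].
    have G20 F : 0 <= G1 ([set x; u] |: F) by [].
    apply: le_trans (@bmean_addle _ _ p [set x; y] (fun F => G1 ([set x; u] |: F)) pp G20) _.
    rewrite expr2 invfM -mulrA ler_wpM2l ?invr_ge0 ?(ltW p0) //.
    exact: (@bmean_addle _ _ p [set x; u] G1 pp G10).
  rewrite bmean_notin -[leRHS]mulrA -[leRHS]mulrA ler_wpM2l ?subr_ge0 //.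
  rewrite /mean2 -[c * _]bmeanZ; apply: le_trans (_ : bmean s (fun O => c * g (x |: O)) <= _).
    rewrite le_eqVlt; apply/orP; left; apply/eqP/bmean_eq => O; congr (_ * g _).
    by apply/setP => w; rewrite !inE; case: eqP.
  apply: (@bmean_addle _ _ s x (fun O => c * g O)) => // O.
  exact: mulr_ge0.
apply: (@le_trans _ _ (\sum_y \sum_u \sum_x mean2 s p (fun O F => (phi y u x O F)%:R))).
  rewrite -mean2Z.
  rewrite [leRHS](_ : _ = mean2 s p (fun O F => \sum_y \sum_u \sum_x (phi y u x O F)%:R)); last first.
    rewrite mean2_sum; apply: eq_bigr => y _; rewrite mean2_sum; apply: eq_bigr => u _.
    by rewrite mean2_sum.
  apply: ler_mean2 => // O F; rewrite natr_card mulr_sumr; apply: ler_sum => y _.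
  have [yr|_] := boolP (y \in rigN O F); last first.
    by rewrite mulr0; apply: sumr_ge0 => u _; apply: sumr_ge0.
  rewrite mulr1; move: (yr); rewrite inE => /and3P[yrig yT nO].
  have y1 : y \in solo O F by move: yrig; rewrite inE => /andP[].
  have [u [yp yS iE ur]] := soloP y1; have [_ _ ny] := pivP yp.
  have uT : u \notin T by apply: contra ny => uT; apply/percP; exists u.
  have auy : adj u y by have := set11 u; rewrite -iE inE => /and3P[].
  rewrite (bigD1 u) //=; apply: le_trans (_ : \sum_x (phi y u x O F)%:R <= _); last first.
    by rewrite lerDl; apply: sumr_ge0 => v _; apply: sumr_ge0.
  set C := [set x | [&& x \notin T, adj x u & adj x y]].
  apply: le_trans (_ : #|C :\: O|%:R <= _).
    (* An occupied common neighbour of [u] and [y] is linked to [y] through [u], hence is counted by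
       [nocc O y]. *)
    rewrite ler_nat leq_subLR; apply: leq_trans (common_nb uT yT auy) _.
    rewrite -/C -(cardsID O C) leq_add2r; apply: leq_trans nO.
    apply/subset_leq_card/subsetP => x; rewrite !inE => /andP[/and3P[_ xu xy] ->] /=.
    by apply/existsP; exists u; rewrite adjC auy adjC.
  rewrite natr_card; apply: ler_sum => x _; apply: ler_bool => //.
  rewrite !inE => /andP[xO /and3P[xT xu xy]].
  by rewrite /phi yr iE eqxx xO xT xu xy.
apply: (@le_trans _ _ (\sum_y \sum_u \sum_x (1 - s) / s * c * mean2 s p (fun O F => (psi y u x O F)%:R))).
  by do 3 (apply: ler_sum => ? _); apply: h.
rewrite [leLHS](_ : _ = (1 - s) / s * c *
    \sum_y \sum_u \sum_x mean2 s p (fun O F => (psi y u x O F)%:R)); last first.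
  rewrite [RHS]mulr_sumr. apply: eq_bigr => y _; rewrite [RHS]mulr_sumr; apply: eq_bigr => u _.
  by rewrite [RHS]mulr_sumr.
have sc0 : 0 <= (1 - s) / s * c.
  by apply: mulr_ge0 => //; apply: divr_ge0; rewrite ?subr_ge0 // ltW.
rewrite -[leRHS]mulrA; apply: (ler_wpM2l sc0).
rewrite [leLHS](_ : _ = mean2 s p (fun O F => \sum_y \sum_u \sum_x (psi y u x O F)%:R)); last first.
  rewrite [RHS]mean2_sum; apply: eq_bigr => y _; rewrite [RHS]mean2_sum; apply: eq_bigr => u _.
  by rewrite [RHS]mean2_sum.
rewrite -mean2Z; apply: ler_mean2 => // O F; rewrite natr_card mulr_sumr.
apply: ler_sum => y _; rewrite /psi; case: (y \in blob O F) => /=.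
  by rewrite mulr1; exact: pairs_set2.
by rewrite mulr0 big1 // => u _; rewrite big1.
Qed.

(* [solo] splits into flippable vertices, rigid ones in [T], rigid ones with a
   crowded neighbourhood and rigid ones on which the surgery applies. *)
Lemma solo_le_blob s p (C1 : R) : 0 < s <= 2^-1 -> 0 < p < 1 -> (N < L)%N ->
  2 * s * D%:R + (3 * m)%:R <= C1 -> 2 * C1 <= N.+1%:R ->
  mean2 s p (fun O F => #|solo O F|%:R) <=
  (1 + 4 * ((1 - p) / p) + 4 * ((1 - s) / s / (L - N)%:R * (p ^- 2 * (1 - p) ^- N))) *
    mean2 s p (fun O F => #|blob O F|%:R) +
  2 * mean2 s p (fun O F => (perc O F)%:R).
Proof.
move=> /andP[s0 s2] /andP[p0 p1] NL hC1 hN.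
have s1 : s < 1 by lra.
have s01 : 0 <= s <= 1 by rewrite !ltW.
have p01 : 0 <= p <= 1 by rewrite !ltW.
have LN0 : 0 < (L - N)%:R :> R by rewrite ltr0n subn_gt0.
set b := mean2 s p (fun O F => #|blob O F|%:R).
set e := mean2 s p (fun O F => #|solo O F|%:R).
set th := mean2 s p (fun O F => (perc O F)%:R).
pose r := mean2 s p (fun O F => #|rig O F|%:R).
pose r' := mean2 s p (fun O F => #|rigN O F|%:R).
pose v := mean2 s p (fun O F => #|piv O F|%:R).
pose n := mean2 s p (fun O F => \sum_(y in rig O F) (nocc O y)%:R).
have b0 : 0 <= b by exact: mean2_ge0.
have sub1 O F : solo O F \subset piv O F by apply/subsetP => y; rewrite inE => /andP[].
have sub2 O F : rig O F \subset solo O F by apply/subsetP => y; rewrite inE => /andP[].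
have vE : v = e + b.
  rewrite /v /e /b -mean2D; apply: bmean_eq => O; apply: bmean_eq => F.
  rewrite -natrD /blob cardsD (setIidPr (sub1 O F)) addnC subnK //.
  exact: subset_leq_card.
have eE : e <= r + (1 - p) / p * 2 * b.
  apply: le_trans (_ : r + mean2 s p (fun O F => #|solo O F :\: rig O F|%:R) <= _); last first.
    by rewrite lerD2l; apply: flip_mean => //; rewrite p0 ltW.
  rewrite /e /r -mean2D; apply: ler_mean2 => // O F.
  rewrite -natrD ler_nat cardsD (setIidPr (sub2 O F)) addnC subnK //.
  exact: subset_leq_card.
have nE : n <= C1 * v.
  apply: le_trans (rig_nocc_mean _ _) _; [by rewrite ltW|by []|].
  apply: ler_wpM2r; first exact: mean2_ge0.
  apply: le_trans hC1; rewrite lerD2r ler_wpM2r // ler_pdivrMr ?subr_gt0 //.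
  by nra.
(* Markov's inequality for the crowded vertices; those in [T] number at most one, and only if there
   is a crossing. *)
have rE : r <= N.+1%:R^-1 * n + th + r'.
  rewrite /r /n /th /r' -mean2Z -!mean2D; apply: ler_mean2 => // O F.
  apply: (@le_trans _ _ (N.+1%:R^-1 * (\sum_(y in rig O F) (nocc O y)%:R) +
     #|piv O F :&: T|%:R + #|rigN O F|%:R)); last first.
    by rewrite lerD2r lerD2l ler_nat card_pivT.
  rewrite [in leLHS]natr_card [in _ * _]big_mkcond mulr_sumr !natr_card -!big_split /=.
  apply: ler_sum => y _; have [yr|_] := boolP (y \in rig O F); last first.
    by rewrite mulr0 add0r addr_ge0.
  have yp : y \in piv O F by apply/(subsetP (sub1 O F))/(subsetP (sub2 O F)).
  rewrite (in_setI y) yp [y \in rigN _ _]inE yr /=.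
  have i0 : 0 <= N.+1%:R^-1 * (nocc O y)%:R :> R by rewrite mulr_ge0 ?invr_ge0.
  have [yT|yT] /= := boolP (y \in T); first by rewrite addr0 lerDr.
  have [_|nO] := leqP (nocc O y) N; first by rewrite addr0 lerDr.
  by rewrite !addr0 ler_pdivlMl // mulr1 ler_nat.
have r'E : r' <= (1 - s) / s / (L - N)%:R * (p ^- 2 * (1 - p) ^- N) * 2 * b.
  have sS : 0 < s <= 1 by rewrite s0 ltW.
  have pP : 0 < p < 1 by rewrite p0.
  have := surgery_mean sS pP; rewrite -/r' -/b -ler_pdivlMl // => /le_trans; apply.
  rewrite le_eqVlt; apply/orP; left; apply/eqP.
  move: (p ^- 2 * _) => w; move: ((L - N)%:R^-1) (s^-1) => a1 a2; ring.
move: r'E; set c3 := _ / (L - N)%:R * _ => r'E.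
have {}r'E : r' <= 2 * (c3 * b) by rewrite mulrA [2 * _]mulrC.
have {}eE : e <= r + 2 * ((1 - p) / p * b) by rewrite mulrA [2 * _]mulrC.
(* By the choice of [N] the crowded vertices make up at most half of [e + b]; absorbing [e / 2] on
   the left doubles all other constants. *)
have nv : N.+1%:R^-1 * n <= 2^-1 * v.
  have v0 : 0 <= v by exact: mean2_ge0.
  rewrite ler_pdivrMl //; apply: le_trans nE _.
  have : 2 * C1 * v <= N.+1%:R * v by exact: ler_wpM2r.
  lra.
rewrite vE in nv; rewrite 2!mulrDl mul1r -[4 * (_ / p) * b]mulrA -[4 * c3 * b]mulrA.
move: eE rE nv r'E; move: (N.+1%:R^-1 * n) ((1 - p) / p * b) (c3 * b) => X Y Z.
lra.
Qed.

End MixedPercolation.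

(** * Images and independence for Bernoulli means *)

Section BernoulliTransport.
Context {R : realFieldType}.
Implicit Types p s : R.

Lemma bmean_push (I K : finType) p (w : K -> R) (h : K -> {set I}) (f : {set I} -> R) :
  (forall D : {set I}, \sum_k w k * (D \subset h k)%:R = p ^+ #|D|) ->
  \sum_k w k * f (h k) = bmean p f.
Proof.
move=> hD; pose c X := \sum_(k | h k == X) w k.
rewrite -(@bmean_upsum _ _ p c) => [|D].
  rewrite (partition_big h xpredT) //=; apply: eq_bigr => X _.
  by rewrite /c mulr_suml; apply: eq_bigr => k /eqP ->.
rewrite -hD [RHS](partition_big h xpredT) //= big_mkcond; apply: eq_bigr => X _.
case: ifPn => DX.
  by apply: eq_bigr => k /eqP ->; rewrite DX mulr1.
by rewrite big1 // => k /eqP ->; rewrite (negbTE DX) mulr0.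
Qed.

Lemma bmean_inj (I J : finType) (h : J -> I) p (f : {set J} -> R) : injective h ->
  bmean p (fun X => f (h @^-1: X)) = bmean p f.
Proof.
move=> hI; apply: (bmean_push (w := bweight p) (h := fun X : {set I} => h @^-1: X)) => D.
rewrite -(card_imset _ hI) -bmean_sub; apply: eq_bigr => X _; congr (_ * _%:R).
congr (nat_of_bool _); apply/subsetP/subsetP => hD x; first by case/imsetP => y /hD; rewrite inE => ? ->.
by move=> xD; rewrite inE hD // imset_f.
Qed.

Lemma bmeanC (I : finType) p (f : {set I} -> R) :
  bmean p (fun X => f (~: X)) = bmean (1 - p) f.
Proof.
rewrite /bmean (reindex_inj (@setC_inj I)) /=; apply: eq_bigr => X _.
rewrite setCK !bweightE setCK; congr (_ * _); rewrite mulrC; congr (_ * _).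
by rewrite opprB addrC subrK.
Qed.

(** Two independent copies glued along [D] have the same law as one; the product formula for
    functions with disjoint supports is read off from this. *)
Lemma bmean_resample (I : finType) p (D : {set I}) (f : {set I} -> R) :
  bmean p (fun X => bmean p (fun Y => f ((X :&: D) :|: (Y :\: D)))) = bmean p f.
Proof.
transitivity (\sum_(k : {set I} * {set I}) (bweight p k.1 * bweight p k.2) * f ((k.1 :&: D) :|: (k.2 :\: D))).
  rewrite -(pair_bigA _ (fun X Y => (bweight p X * bweight p Y) * f ((X :&: D) :|: (Y :\: D)))) /=.
  apply: eq_bigr => X _; rewrite mulr_sumr; apply: eq_bigr => Y _.
  by rewrite mulrA.
apply: (bmean_push (w := fun k => bweight p k.1 * bweight p k.2)
  (h := fun k => (k.1 :&: D) :|: (k.2 :\: D))) => E.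
rewrite -(pair_bigA _ (fun X Y => (bweight p X * bweight p Y) * (E \subset (X :&: D) :|: (Y :\: D))%:R)) /=.
transitivity (bmean p (fun X => (E :&: D \subset X)%:R) * bmean p (fun Y => (E :\: D \subset Y)%:R)).
  rewrite /bmean mulr_suml; apply: eq_bigr => X _; rewrite mulr_sumr; apply: eq_bigr => Y _.
  rewrite -mulrA -[RHS]mulrA [(E :&: D \subset X)%:R * _]mulrCA -natrM mulnb; congr (_ * (_ * (nat_of_bool _)%:R)).
  apply/subsetP/andP => [h|[/subsetP h1 /subsetP h2] x xE].
    by split; apply/subsetP => x; rewrite !inE => /andP[a c]; have := h x; rewrite !inE a ?c ?(negbTE a) ?(negbTE c) ?andbF ?andbT ?orbF => /(_ isT).
  rewrite !inE; have [xD|xD] := boolP (x \in D).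
    by rewrite h1 // inE xE.
  by rewrite /= h2 ?orbT // inE xD.
by rewrite !bmean_sub -exprD cardsID.
Qed.

Lemma bmean_indep (I : finType) p (D : {set I}) (f g : {set I} -> R) :
  (forall X, f X = f (X :&: D)) -> (forall X, g X = g (X :\: D)) ->
  bmean p (fun X => f X * g X) = bmean p f * bmean p g.
Proof.
move=> hf hg; rewrite -(bmean_resample p D).
transitivity (bmean p (fun X => f X * bmean p g)).
  apply: bmean_eq => X; rewrite -bmeanZ; apply: bmean_eq => Y; congr (_ * _).
    rewrite hf [RHS]hf; congr f; apply/setP => x; rewrite !inE.
    by case: (x \in D); rewrite ?andbF ?andbT ?orbF.
  rewrite hg [RHS]hg; congr g; apply/setP => x; rewrite !inE.
  by case: (x \in D); rewrite ?andbF ?andbT.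
by rewrite mulrC -bmeanZ; apply: bmean_eq => X; rewrite mulrC.
Qed.

Lemma mean2_inj (V W : finType) (h : W -> V) s p (f : {set W} -> {set {set W}} -> R) :
  injective h ->
  mean2 s p (fun O F => f (h @^-1: O) [set e : {set W} | h @: e \in F]) = mean2 s p f.
Proof.
move=> hI; rewrite /mean2 -(@bmean_inj _ _ h s) //; apply: bmean_eq => O.
rewrite -(@bmean_inj _ _ (fun e : {set W} => h @: e) p) //; exact: imset_inj.
Qed.

Lemma mean2_indep (V : finType) s p (D : {set V}) (E : {set {set V}}) (f g : {set V} -> {set {set V}} -> R) :
  (forall O F, f O F = f (O :&: D) (F :&: E)) -> (forall O F, g O F = g (O :\: D) (F :\: E)) ->
  mean2 s p (fun O F => f O F * g O F) = mean2 s p f * mean2 s p g.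
Proof.
move=> hf hg; rewrite /mean2.
rewrite -(@bmean_indep _ s D) => [|O|O].
- apply: bmean_eq => O; apply: (@bmean_indep _ p E) => F.
    by rewrite hf [RHS]hf -setIA setIid.
  by rewrite hg [RHS]hg setDDl setUid.
- by apply: bmean_eq => F; rewrite hf [RHS]hf -setIA setIid.
- by apply: bmean_eq => F; rewrite hg [RHS]hg setDDl setUid.
Qed.

End BernoulliTransport.

Local Close Scope ring_scope.

(** * The cell graph *)

(* The number of cells strictly between the columns [i] and [j]: up to the mesh,
   the distance of the closed cells. *)
Definition gap (i j : nat) := (maxn i j - minn i j).-1.

(** [m] is the block of the midpoint. A cell of this block is within [b] of the midpoint, hence at
    most half the gap plus [b] away from either end. *)
Lemma mid_block b w i1 i2 t (m := (i1 + i2)./2 %/ b) : t < b ->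
  5 * b <= i1 -> i1 < w * b -> 5 * b <= i2 -> i2 < w * b ->
  [/\ 5 * b <= m * b + t, m * b + t < w * b,
      2 * gap (m * b + t) i1 <= gap i1 i2 + 2 * b & 2 * gap (m * b + t) i2 <= gap i1 i2 + 2 * b].
Proof.
move=> tb h1 h2 h3 h4; have b0 : 0 < b by lia.
have m5 : 5 <= m by rewrite leq_divRL //; lia.
have mw : m < w by rewrite ltn_divLR //; lia.
have mb1 : m * b <= (i1 + i2)./2 by rewrite leq_trunc_div.
have mb2 : (i1 + i2)./2 < m * b + b by rewrite -mulSnr -ltn_divLR.
have e5 : 5 * b <= m * b by rewrite leq_mul2r m5 orbT.
have ew : m * b + b <= w * b by rewrite -mulSnr leq_mul2r mw orbT.
move: (m * b) mb1 mb2 e5 ew => x mb1 mb2 e5 ew.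
move: (w * b) ew h2 h4 => y ew h2 h4.
rewrite /gap; clear m5 mw; clear m; split; lia.
Qed.

(** The left side is at most [(g1 ^ 2 + g2 ^ 2) / 4 + (g1 + g2) * b + 2 * b ^ 2], that is
    [(4 + 6 + 2) * b ^ 2], below [16 * b ^ 2]. *)
Lemma mid_dist b g1 g2 a1 a2 : 2 * a1 <= g1 + 2 * b -> 2 * a2 <= g2 + 2 * b ->
  g1 ^ 2 + g2 ^ 2 <= (4 * b) ^ 2 -> g1 + g2 <= 6 * b -> a1 ^ 2 + a2 ^ 2 <= (4 * b) ^ 2.
Proof.
move=> k1 k2 hg g12.
have e1 : (2 * a1) ^ 2 <= (g1 + 2 * b) ^ 2 by rewrite leq_exp2r.
have e2 : (2 * a2) ^ 2 <= (g2 + 2 * b) ^ 2 by rewrite leq_exp2r.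
have e3 : (g1 + g2) * b <= 6 * b * b by rewrite leq_mul2r g12 orbT.
move: e1 e2 hg e3; rewrite !expnMn !sqrnD !mulnDl -!mulnn; clear; lia.
Qed.

Section Cells.
Variables b n : nat.
Local Notation q := (4 * b).

Definition side := 2 * n * (4 * b).
Definition cell : Type := 'I_side * 'I_side.
HB.instance Definition _ := Finite.on cell.

(** Closed cells at distance at most 1, with [q] cells per unit length; points joined in the Gilbert
    graph thus lie in equal or adjacent cells. *)
Definition cadj : rel cell :=
  fun x y => (x != y) && (gap x.1 y.1 ^ 2 + gap x.2 y.2 ^ 2 <= q ^ 2).
(** The square of half side [M] around the centre, which has index [n * q]; adding [M * q] on one
    side avoids truncated subtraction. *)
Definition cS M : {set cell} :=
  [set x : cell | (n * q <= x.1 + M * q) && (x.1 < n * q + M * q) &&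
                  ((n * q <= x.2 + M * q) && (x.2 < n * q + M * q))].
(* The outer ring has thickness 5/4, more than the at most [4 * b + 1] cells that
   one step can cross. *)
Definition cT : {set cell} :=
  [set x : cell | ~~ ((5 * b <= x.1 < side - 5 * b) && (5 * b <= x.2 < side - 5 * b))].

Lemma gapC i j : gap i j = gap j i. Proof. by rewrite /gap maxnC minnC. Qed.

Lemma cadjC : symmetric cadj.
Proof. by move=> x y; rewrite /cadj eq_sym !(gapC x.1) !(gapC x.2). Qed.

Lemma cadjxx : irreflexive cadj.
Proof. by move=> x; rewrite /cadj eqxx. Qed.

Lemma cadj_dist x y : cadj x y ->
  [/\ x.1 <= y.1 + q.+1, y.1 <= x.1 + q.+1, x.2 <= y.2 + q.+1 & y.2 <= x.2 + q.+1].
Proof.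
rewrite /cadj /gap => /andP[_ h].
have h1 : (maxn x.1 y.1 - minn x.1 y.1).-1 <= q.
  by rewrite -(@leq_exp2r _ _ 2) // (leq_trans _ h) ?leq_addr.
have h2 : (maxn x.2 y.2 - minn x.2 y.2).-1 <= q.
  by rewrite -(@leq_exp2r _ _ 2) // (leq_trans _ h) ?leq_addl.
split; lia.
Qed.

Lemma nb2_dist x y : nb2 cadj x y ->
  [/\ x.1 <= y.1 + 2 * q.+1, y.1 <= x.1 + 2 * q.+1, x.2 <= y.2 + 2 * q.+1 & y.2 <= x.2 + 2 * q.+1].
Proof.
by move=> /existsP[z /andP[/cadj_dist[? ? ? ?] /cadj_dist[? ? ? ?]]]; split; lia.
Qed.

Lemma block_ord (i : 'I_side) : i %/ b < side.
Proof. exact: leq_ltn_trans (leq_div _ _) (ltn_ord i). Qed.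

(** Squares of [b] by [b] cells, of side 1/4: small enough to be cliques, while the number of them
    near a given cell is bounded independently of [b]. *)
Definition block (x : cell) : cell := (Ordinal (block_ord x.1), Ordinal (block_ord x.2)).

Lemma block_adj x y : 0 < b -> block x = block y -> x != y -> cadj x y.
Proof.
move=> b0 [h1 h2] xy; rewrite /cadj xy /= /gap.
have k1 : (maxn x.1 y.1 - minn x.1 y.1).-1 <= b by move: h1; lia.
have k2 : (maxn x.2 y.2 - minn x.2 y.2).-1 <= b by move: h2; lia.
move: k1 k2; move: (_.-1) (_.-1) => g1 g2; clear => k1 k2.
have e1 : g1 ^ 2 <= b ^ 2 by rewrite leq_exp2r.
have e2 : g2 ^ 2 <= b ^ 2 by rewrite leq_exp2r.
rewrite expnMn; lia.
Qed.

Lemma card_window M (i r : nat) : #|[set j : 'I_M | (i <= j + r) && (j <= i + r)]| <= r + r.+1.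
Proof.
rewrite cardE -(size_map val) -[leqRHS](size_iota (i - r)).
apply: uniq_leq_size; first by rewrite map_inj_uniq ?enum_uniq //; exact: val_inj.
move=> j /mapP[k]; rewrite mem_enum inE => /andP[h1 h2] ->; rewrite mem_iota.
have : i - r <= k < i - r + (r + r.+1) by apply/andP; split; lia.
by [].
Qed.

Lemma card_window2 M (i j r : nat) (A : {set 'I_M * 'I_M}) :
  (forall x, x \in A -> [/\ i <= x.1 + r, x.1 <= i + r, j <= x.2 + r & x.2 <= j + r]) ->
  #|A| <= (r + r.+1) ^ 2.
Proof.
move=> h; apply: (@leq_trans #|finset.setX [set k : 'I_M | (i <= k + r) && (k <= i + r)]
    [set k : 'I_M | (j <= k + r) && (k <= j + r)]|).
  by apply/subset_leq_card/subsetP => x /h[? ? ? ?]; rewrite !inE; apply/andP; split; apply/andP; split.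
by rewrite cardsX -mulnn; apply: leq_mul; exact: card_window.
Qed.

(** Two steps cross at most [2 * (4 * b + 1) <= 10 * b] cells, so ten blocks either way in each
    coordinate, and 441 is the square of 21. *)
Lemma card_block_nb2 (z : cell) : 2 <= b -> #|[set block y | y in [set y | nb2 cadj z y]]| <= 441.
Proof.
move=> b2; apply: (@card_window2 _ (z.1 %/ b) (z.2 %/ b) 10).
move=> _ /imsetP[y + ->]; rewrite inE => /nb2_dist[h1 h2 h3 h4] /=.
have H u v : u <= v + 2 * q.+1 -> u %/ b <= v %/ b + 10.
  move=> uv; rewrite addnC -(divnMDl _ _ (ltnW b2)); apply: leq_div2r.
  by apply: leq_trans uv _; lia.
by split; apply: H.
Qed.

Lemma card_nb2_cell (z : cell) : 5 <= q -> #|[set y | nb2 cadj z y]| <= 25 * q ^ 2.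
Proof.
move=> q5; apply: (@leq_trans ((2 * q.+1 + (2 * q.+1).+1) ^ 2)); last first.
  by rewrite -[25]/(5 ^ 2) -expnMn leq_exp2r //; lia.
apply: (@card_window2 _ z.1 z.2) => y; by rewrite inE => /nb2_dist.
Qed.

(** The whole block of the midpoint is adjacent to both cells, and it avoids [cT] because the
    complement of [cT] consists of whole blocks. The 2 accounts for [u] and [y], which may lie in
    that block. *)
Lemma common_nb_cell u y : 1 < b -> u \notin cT -> y \notin cT -> cadj u y ->
  b * b - 2 <= #|[set x | [&& x \notin cT, cadj x u & cadj x y]]|.
Proof.
rewrite !inE !negbK => b1 /andP[/andP[u1 u2] /andP[u3 u4]] /andP[/andP[y1 y2] /andP[y3 y4]].
rewrite {1}/cadj => /andP[uy]; set g1 := gap u.1 y.1; set g2 := gap u.2 y.2 => hg.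
have g12 : g1 + g2 <= 6 * b.
  rewrite -(@leq_exp2r _ _ 2) // sqrnD; have := (nat_Cauchy g1 g2).1.
  by move: hg; rewrite !expnMn; lia.
have g10 : maxn u.1 y.1 - minn u.1 y.1 <= g1.+1 by rewrite /g1 /gap; lia.
have g20 : maxn u.2 y.2 - minn u.2 y.2 <= g2.+1 by rewrite /g2 /gap; lia.
pose m1 := ((u.1 + y.1)./2 %/ b); pose m2 := ((u.2 + y.2)./2 %/ b).
have sE : side = 8 * n * b by rewrite /side; lia.
have B i1 i2 (t : 'I_b) := @mid_block b (8 * n - 5) i1 i2 t (ltn_ord t).
have W : side - 5 * b = (8 * n - 5) * b by rewrite sE mulnBl.
have sW : (8 * n - 5) * b <= side by rewrite -W leq_subr.
rewrite W in u2 u4 y2 y4.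
have lt1 (t : 'I_b) : m1 * b + t < side by have [//|//|//|//|_ h _ _] := B u.1 y.1 t; exact: leq_trans h sW.
have lt2 (t : 'I_b) : m2 * b + t < side by have [//|//|//|//|_ h _ _] := B u.2 y.2 t; exact: leq_trans h sW.
pose f (t : 'I_b * 'I_b) : cell := (Ordinal (lt1 t.1), Ordinal (lt2 t.2)).
have fI : injective f.
  by move=> [t1 t2] [t3 t4] [] /addnI/val_inj -> /addnI/val_inj ->.
have fA t z : f t != z -> (2 * gap (f t).1 z.1 <= g1 + 2 * b) -> (2 * gap (f t).2 z.2 <= g2 + 2 * b) -> cadj (f t) z.
  move=> ne k1 k2; rewrite /cadj ne /=.
  exact: mid_dist k1 k2 hg g12.
set A := [set x | _].
apply: (@leq_trans #|[set f t | t in [set: 'I_b * 'I_b]] :\: [set u; y]|).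
  rewrite cardsD leq_sub // ?card_imset ?cardsT ?card_prod ?card_ord //.
  by apply: leq_trans (subset_leq_card (subsetIr _ _)) _; rewrite cards2; case: (_ != _).
apply/subset_leq_card/subsetP => _ /setDP[/imsetP[t _ ->]].
rewrite !inE negb_or => /andP[fu fy].
have [k1 k2 k3 k4] := B u.1 y.1 t.1 u1 u2 y1 y2.
have [l1 l2 l3 l4] := B u.2 y.2 t.2 u3 u4 y3 y4.
rewrite -/m1 in k1 k2 k3 k4; rewrite -/m2 in l1 l2 l3 l4.
by rewrite !fA //= negbK W k1 k2 l1 l2.
Qed.

End Cells.
Arguments cadj {b n}.
Arguments cT {b n}.
Arguments cS {b n}.
Arguments block {b n}.

Lemma large_square N N' b : 2 * N + 4 + N' <= b ->
  [/\ 2 <= b, N' <= b, N < b * b - 2, b * b <= 2 * (b * b - 2 - N) & (b <= b * b) && (5 <= 4 * b)].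
Proof.
move=> h; have b4 : 4 <= b by lia.
have : 4 * b <= b * b by rewrite leq_mul2r b4 orbT.
by move: (b * b) => B hB; split; lia.
Qed.

(** * The comparison of pivotal vertices, uniformly in the mesh *)

Section CellInequality.
Context {R : archiRealFieldType}.
Local Open Scope ring_scope.

(** In [solo_le_blob] the degree enters through [s * D], which stays bounded, and the room for
    surgery through [s * (L - N)], which stays away from 0, as [s] is of order [b ^- 2] and both [D]
    and [L] are of order [b ^ 2]. Hence one [c] serves all fine meshes. *)
Lemma solo_le_blob_cell (k1 k2 plo phi : R) : 0 < k1 -> 0 < k2 ->
  0 < plo -> phi < 1 -> exists c : R, [/\ 0 < c, c <= 1 & exists b0 : nat,
  forall b n M s p, (b0 <= b)%N ->
    k1 / (4 * b)%:R ^+ 2 <= s -> s <= k2 / (4 * b)%:R ^+ 2 -> plo <= p -> p <= phi ->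
  c * mean2 s p (fun O F => #|solo (@cadj b n) (@cS b n M) (@cT b n) O F|%:R) <=
  mean2 s p (fun O F => #|blob (@cadj b n) (@cS b n M) (@cT b n) O F|%:R) +
  2 * c * mean2 s p (fun O F => (perc (@cadj b n) (@cS b n M) (@cT b n) O F)%:R)].
Proof.
move=> k10 k20 plo0 phi1.
have [C1 C10 hC1] : exists2 C1 : R, 0 < C1 & forall (s : R) (b : nat), s * (16 * (b * b)%:R) <= k2 ->
    2 * s * (25 * (4 * b) ^ 2)%:R + (3 * 441)%:R <= C1.
  exists (50 * k2 + (3 * 441)%:R); first by rewrite ltr_wpDr ?ler0n // mulr_gt0.
  move=> s b h; rewrite lerD2r.
  have -> : (25 * (4 * b) ^ 2)%:R = 25 * (16 * (b * b)%:R) :> R by rewrite natrM natrX !natrM; ring.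
  by lra.
have [N hN] : exists N : nat, 2 * C1 <= N.+1%:R.
  exists (Num.bound (2 * C1)); have : 2 * C1 < (Num.bound (2 * C1))%:R by apply: archi_boundP; lra.
  by move=> /ltW h; apply: le_trans h _; rewrite ler_nat.
have [N' hN'] : exists N' : nat, k2 <= N'%:R.
  by exists (Num.bound k2); apply/ltW/archi_boundP/ltW.
pose X := plo ^- 2 * (1 - phi) ^- N.
have X0 : 0 < X by rewrite mulr_gt0 ?invr_gt0 ?exprn_gt0 // subr_gt0.
(* [32 / k1] bounds [1 / (s * (L - N))], since [s >= k1 / (16 * b ^ 2)] and [L - N >= b ^ 2 / 2]. *)
pose C := 1 + 4 * plo^-1 + 4 * (32 / k1 * X).
have C0 : 1 <= C.
  have : 0 < plo^-1 by rewrite invr_gt0.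
  have : 0 < 32 / k1 * X by rewrite mulr_gt0 // divr_gt0.
  by rewrite /C; lra.
have C0' : 0 < C by lra.
exists C^-1; split; first by rewrite invr_gt0.
  by rewrite invf_le1.
exists (2 * N + 4 + N')%N => b n M s p hb s1 s2 p1 p2.
have {hb}[b2 bN' NL LN2 /andP[bb q5]] := large_square hb.
have bR : 0 < (b%:R : R) by rewrite ltr0n (leq_trans _ b2).
have bk : k2 <= b%:R.
  by apply: le_trans hN' _; rewrite ler_nat.
have q2 : ((4 * b)%:R ^+ 2 : R) = 16 * (b * b)%:R by rewrite !natrM; ring.
have bb0 : 0 < (b * b)%:R :> R by rewrite natrM mulr_gt0.
rewrite q2 in s1 s2.
have q20 : 0 < 16 * (b * b)%:R :> R by rewrite mulr_gt0.
rewrite ler_pdivrMr // in s1; rewrite ler_pdivlMr // in s2.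
have s0 : 0 < s by rewrite -(pmulr_lgt0 _ q20); exact: lt_le_trans s1.
have shalf : s <= 2^-1.
  have : s * (16 * (b * b)%:R) <= 2^-1 * (16 * (b * b)%:R).
    apply: (le_trans s2); apply: (le_trans bk).
    have : (b%:R <= (b * b)%:R :> R) by rewrite ler_nat.
    lra.
  by rewrite ler_pM2r.
have h := @solo_le_blob R _ (@cadj b n) (@cS b n M) (@cT b n) (@cadjC b n) (@cadjxx b n)
  _ (@block b n) (fun x y => @block_adj b n x y (ltnW b2)) 441 (fun z => @card_block_nb2 b n z b2)
  (25 * (4 * b) ^ 2) (fun z => @card_nb2_cell b n z _) (b * b - 2) N
  (fun u y => @common_nb_cell b n u y b2) s p C1.
have {h} := h _ _ _ _ _ hN; rewrite s0 shalf.
have -> : 0 < p < 1 by apply/andP; split; lra.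
move=> h; have {h} : forall H1 : (5 <= 4 * b)%N, mean2 s p (fun O F => #|solo (@cadj b n) (@cS b n M) (@cT b n) O F|%:R) <=
  C * mean2 s p (fun O F => #|blob (@cadj b n) (@cS b n M) (@cT b n) O F|%:R) +
  2 * mean2 s p (fun O F => (perc (@cadj b n) (@cS b n M) (@cT b n) O F)%:R).
  move=> H1; apply: le_trans (h _ _ _ _ _) _ => //.
  - exact: hC1.
  rewrite lerD2r; apply: ler_wpM2r.
    by apply: mean2_ge0 => [||O F]; rewrite ?ler0n //; apply/andP; split; lra.
  have pp : (1 - p) / p <= plo^-1.
    rewrite ler_pdivrMr; last lra.
    by rewrite ler_pdivlMl //; nra.
  have LN : (1 - s) / s / (b * b - 2 - N)%:R <= 32 / k1.
    have L0 : 0 < (b * b - 2 - N)%:R :> R by rewrite ltr0n subn_gt0.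
    rewrite -mulrA -invfM ler_pdivrMr ?mulr_gt0 // mulrAC ler_pdivlMr //.
    have : ((b * b)%:R <= 2 * (b * b - 2 - N)%:R :> R) by rewrite -natrM ler_nat.
    move: s1 s0 k10 shalf L0; move: (b * b - 2 - N)%N%:R => L; clear => *.
    nra.
  have XX : p ^- 2 * (1 - p) ^- N <= X.
    apply: ler_pM; rewrite ?invr_ge0 ?exprn_ge0 //; try lra.
    - by rewrite lef_pV2 ?posrE ?exprn_gt0 //; [apply: lerXn2r; rewrite ?nnegrE|]; lra.
    - rewrite lef_pV2 ?posrE ?exprn_gt0 //; [|lra..].
      by apply: lerXn2r; rewrite ?nnegrE; lra.
  have : (1 - s) / s / (b * b - 2 - N)%:R * (p ^- 2 * (1 - p) ^- N) <= 32 / k1 * X.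
    apply: ler_pM => //.
    - by rewrite !divr_ge0 // ?ler0n // ?subr_ge0; lra.
    - by rewrite mulr_ge0 // invr_ge0 exprn_ge0 //; lra.
  by rewrite /C; lra.
move=> /(_ q5); rewrite -(ler_pM2l (x := C^-1)) ?invr_gt0 // mulrDr mulKf ?gt_eqF //.
by rewrite mulrA [_ * 2]mulrC.

Qed.
End CellInequality.

Local Open Scope ring_scope.

(** * Vertices adjacent to two large clusters *)

Section Clusters.
Context {V : finType}.
Variable adj : rel V.
Hypothesis adjC : symmetric adj.
Implicit Types (O S X Y C : {set V}) (x y z : V).

Definition rc S O := reach adj S O [set: {set V}].
(** The vertices whose state is examined when the cluster of [S] is explored and [X] is the part
    found occupied. *)
Definition bd S X := [set y | (y \in S) || [exists x in X, adj x y]].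
Definition clu O x := rc [set x] O.

Lemma rc_sub S O : rc S O \subset O. Proof. exact: reach_sub. Qed.

Lemma rcS S O x : x \in S -> x \in O -> x \in rc S O. Proof. exact: reachS. Qed.

Lemma rc_step S O x z : x \in rc S O -> adj x z -> z \in O -> z \in rc S O.
Proof.
move=> xr xz zO; apply: (reach_step xr).
by rewrite /step xz zO in_setT (subsetP (rc_sub S O) x xr).
Qed.

Lemma rc_min S O X : (forall x, x \in S -> x \in O -> x \in X) ->
  (forall x z, x \in X -> adj x z -> z \in O -> z \in X) -> rc S O \subset X.
Proof. by move=> h1 h2; apply: reach_min => // x z xX /and4P[_ zO xz _]; apply: h2 xz zO. Qed.

Lemma rc_mono S O O' : O \subset O' -> rc S O \subset rc S O'.
Proof. by move=> h; apply: reach_mono. Qed.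

Lemma rc_bd S O : rc S O \subset bd S (rc S O).
Proof.
have : rc S O \subset [set x in rc S O | x \in bd S (rc S O)].
  apply: rc_min => [x xS xO|x z]; first by rewrite inE rcS //= inE xS.
  rewrite inE => /andP[xr _] xz zO; rewrite inE (rc_step xr xz zO) inE /=.
  by apply/orP; right; apply/exists_inP; exists x.
by move=> h; apply: subset_trans h _; apply/subsetP => x; rewrite inE => /andP[].
Qed.

Lemma bd_mono S X X' : X \subset X' -> bd S X \subset bd S X'.
Proof.
move=> h; apply/subsetP => y; rewrite !inE => /orP[->//|/exists_inP[x xX xy]].
by apply/orP; right; apply/exists_inP; exists x => //; apply: (subsetP h).
Qed.

Lemma rcU1 S X z : rc S X = X -> z \in bd S X -> rc S (z |: X) = z |: X.
Proof.
move=> hX hz; apply/eqP; rewrite eqEsubset rc_sub; apply/subsetP => x.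
have sX : X \subset rc S (z |: X) by rewrite -{1}hX rc_mono // subsetUr.
rewrite in_setU1 => /orP[/eqP->|/(subsetP sX)//].
move: hz; rewrite inE => /orP[zS|/exists_inP[y yX yz]]; first by rewrite rcS // setU11.
by apply: rc_step (subsetP sX y yX) yz _; rewrite setU11.
Qed.

Lemma rc_closed S X O : rc S X = X -> X \subset O -> bd S X :&: O \subset X -> rc S O = X.
Proof.
move=> hX XO h; apply/eqP; rewrite eqEsubset; apply/andP; split.
  apply: rc_min => [x xS xO|x z xX xz zO]; apply: (subsetP h); rewrite !inE ?xS ?xO //.
  by rewrite zO andbT; apply/orP; right; apply/exists_inP; exists x.
by rewrite -{1}hX rc_mono.
Qed.

Context {R : realFieldType}.

(* Exploring the cluster of [S] one vertex at a time turns [Phi] into a supermartingale. *)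
Lemma explore_supermart (s : R) (Phi : nat -> nat -> R) S : 0 <= s <= 1 ->
  (forall i t, s * Phi i.+1 t.+1 + (1 - s) * Phi i t.+1 <= Phi i t) ->
  bmean s (fun O => Phi #|rc S O| #|bd S (rc S O)|) <= Phi 0%N 0%N.
Proof.
move=> s01 hPhi; pose G O := Phi #|rc S O| #|bd S (rc S O)|.
have GE O : G O = Phi #|rc S O| #|bd S (rc S O)| by [].
change (bmean s G <= Phi 0%N 0%N); move: G GE => G GE.
(* [X] is the occupied and [Y] the vacant part explored so far; the other vertices are still
   independent, and the induction is on their number. *)
suff H N X Y : (#|~: (X :|: Y)| < N)%N -> rc S X = X -> X :|: Y \subset bd S X -> [disjoint X & Y] ->
    bmean s (fun O => G (X :|: (O :\: Y))) <=
    Phi #|X| #|X :|: Y|.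
  have r0 : rc S set0 = set0 by apply/eqP; rewrite -subset0 rc_sub.
  have := H #|~: (set0 :|: set0 : {set V})|.+1 set0 set0 (leqnn _) r0.
  rewrite !setU0 sub0set -setI_eq0 set0I eqxx cards0 => /(_ isT isT).
  by apply: le_trans; rewrite (@bmean_eq _ _ _ (fun O => G (set0 :|: O :\: set0)) G) // => O; rewrite set0U setD0.
elim: N X Y => // N IH X Y XN hX XY dXY.
have [bXY|/subsetPn[z zb zXY]] := boolP (bd S X \subset X :|: Y).
  rewrite (@bmean_eq _ _ _ _ (fun=> Phi #|X| #|X :|: Y|)) ?bmean_cst // => O; rewrite GE.
  rewrite (rc_closed hX (subsetUl _ _)); last first.
    apply/subsetP => x; rewrite !inE => /andP[xb]; case: (boolP (x \in X)) => //= xX /andP[xY _].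
    by have := subsetP bXY x; rewrite inE xb !inE (negbTE xX) (negbTE xY) => /(_ isT).
  by congr (Phi _ _); apply/eqP; rewrite (_ : _ :|: _ = bd S X) //; apply/eqP; rewrite eqEsubset XY.
have [zX zY] : z \notin X /\ z \notin Y by apply/andP; move: zXY; rewrite inE negb_or.
have cz : #|z |: (X :|: Y)| = #|X :|: Y|.+1 by rewrite cardsU1 zXY.
have cN : (#|~: (z |: (X :|: Y))| < N)%N.
  rewrite cardsCs setCK cz; move: XN; rewrite cardsCs setCK; have := max_card (mem (z |: (X :|: Y))).
  by rewrite cz; lia.
rewrite (bmean_split _ z) bmeanD !bmeanZ; apply: le_trans (hPhi #|X| #|X :|: Y|).
have /andP[s0 s1] := s01; rewrite -cz.
apply: lerD; apply: ler_wpM2l => //; rewrite ?subr_ge0 //.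
  have := IH (z |: X) Y; rewrite -setUA => /(_ cN (rcU1 hX zb)).
  have -> : z |: (X :|: Y) \subset bd S (z |: X).
    rewrite subUset sub1set (subsetP (bd_mono _ (subsetUr _ _))) // (subset_trans XY) //.
    exact: bd_mono (subsetUr _ _).
  rewrite cardsU1 zX => /(_ isT); rewrite -setI_eq0 setIUl setU_eq0 !setI_eq0 dXY andbT disjoints1 zY => /(_ isT).
  apply: le_trans; rewrite le_eqVlt; apply/orP; left; apply/eqP; apply: bmean_eq => O; congr G.
  by apply/setP => x; rewrite !inE; have [->|] := eqVneq x z; rewrite ?zY ?orbT.
have := IH X (z |: Y); rewrite setUCA => /(_ cN hX).
rewrite subUset sub1set zb XY => /(_ isT).
rewrite -setI_eq0 setIUr setU_eq0 !setI_eq0 dXY andbT disjoint_sym disjoints1 zX => /(_ isT).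
by apply: le_trans; rewrite le_eqVlt; apply/orP; left; apply/eqP; apply: bmean_eq => O; rewrite setDDl.
Qed.

Lemma clu_sym O x y : x \in O -> y \in clu O x -> x \in clu O y.
Proof.
move=> xO yx; have yO := subsetP (rc_sub [set x] O) y yx.
rewrite /clu /rc !in_reach; move: yx; rewrite /clu /rc in_reach => /exists_inP[u].
rewrite !inE => /andP[/eqP -> _] c; apply/exists_inP; exists y; first by rewrite !inE eqxx yO.
rewrite sym_connect_sym // => {c xO yO}x {}y; apply/idP/idP => /and4P[? ? ? ?]; apply/and4P; split => //; try by rewrite inE.
  by rewrite adjC.
by rewrite adjC.
Qed.

Lemma clu_refl O x : x \in O -> x \in clu O x.
Proof. by move=> xO; rewrite rcS // set11. Qed.

Lemma clu_in S O x : x \in rc S O -> clu O x \subset rc S O.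
Proof.
move=> xr; apply: rc_min => [y|y z yr yz zO]; first by rewrite inE => /eqP->.
exact: rc_step yr yz zO.
Qed.

Lemma clu_eq O x y : x \in O -> y \in clu O x -> clu O y = clu O x.
Proof.
move=> xO yx; apply/eqP; rewrite eqEsubset clu_in //=.
by apply: clu_in; apply: clu_sym.
Qed.

Variables (K : finType) (cl : V -> K) (B : {set K}) (m : nat).
Hypothesis cl_adj : forall x y, cl x = cl y -> x != y -> adj x y.
Hypothesis cl_nb : forall y, (#|[set cl x | x in [set x | (x == y) || adj x y]]| <= m)%N.

Definition beta k := [set x | cl x == k].
Definition srcs := [set x | cl x \in B].
Fact big_key : unit. Proof. exact: tt. Qed.
(** The clusters that meet a class of [B]. Indexing by classes matters: a class is a clique and
    meets at most one cluster, so the number of large clusters is at most [#|B|] rather than the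
    number of source vertices. *)
Definition big O := locked_with big_key ([set rc (beta k) O | k in B] :\ set0).

Lemma in_big O C : (C \in big O) = (C != set0) && (C \in [set rc (beta k) O | k in B]).
Proof. by rewrite /big; case: big_key; rewrite /= in_setD1. Qed.

(* The vertices adjacent to two distinct large clusters [C] are those counted
   twice in the sum of the [#|bd C C|], compared with the boundary of the union. *)
Definition dbl O := [set y | (1 < #|[set C in big O | y \in bd C C]|)%N].

Lemma rc_beta k O x : x \in rc (beta k) O -> rc (beta k) O = clu O x.
Proof.
move=> xr; apply/eqP; rewrite eqEsubset clu_in // andbT.
suff [y yb yc] : exists2 y, y \in beta k & y \in clu O x.
  have yO := subsetP (rc_sub _ _) y yc.
  apply: rc_min => [z zb zO|z u zc zu uO]; last exact: rc_step zc zu uO.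
  have [->//|zy] := eqVneq z y; apply: rc_step yc _ zO.
  by rewrite adjC; apply: cl_adj zy; move: zb yb; rewrite !inE => /eqP-> /eqP->.
have xO := subsetP (rc_sub _ _) x xr.
have : rc (beta k) O \subset [set z | [exists y in beta k, y \in clu O z]].
  apply: rc_min => [z zb zO|z u]; rewrite !inE.
    by apply/exists_inP; exists z => //; apply: clu_refl.
  case/exists_inP => y yb yz zu uO; apply/exists_inP; exists y => //.
  have yO := subsetP (rc_sub _ _) y yz.
  have [zO|zO] := boolP (z \in O).
    have zuc : z \in clu O u by apply: (rc_step (clu_refl uO)); rewrite // adjC.
    exact: (subsetP (clu_in zuc)).
  have : clu O z = set0.
    apply/eqP; rewrite -subset0; apply: rc_min => [v|v w]; last by rewrite inE.
    by rewrite inE => /eqP->; rewrite (negbTE zO).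
  by move=> e; rewrite e inE in yz.
by move=> /subsetP/(_ x xr); rewrite inE => /exists_inP[y]; exists y.
Qed.

Lemma bigP O C : reflect (exists x, [/\ x \in O, cl x \in B & C = clu O x]) (C \in big O).
Proof.
apply: (iffP idP) => [|[x [xO xB ->]]].
  rewrite in_big => /andP[C0 /imsetP[k kB e]]; have /set0Pn[x xC] := C0.
  have xr : x \in rc (beta k) O by rewrite -e.
  have [y yr yb] : exists2 y, y \in rc (beta k) O & cl y = k.
    have : ~~ (rc (beta k) O \subset set0) by rewrite subset0 -e.
    have [/exists_inP[y yb yO] _|h /negP[]] := boolP [exists y in beta k, y \in O].
      by exists y; [apply: rcS|move: yb; rewrite inE => /eqP].
    apply: rc_min => [y yb yO|y z]; last by rewrite inE.
    by case/negP: h; apply/exists_inP; exists y.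
  exists y; split; rewrite ?yb //; first exact: (subsetP (rc_sub _ _) y yr).
  by rewrite e (rc_beta yr).
rewrite in_big; apply/andP; split; first by apply/set0Pn; exists x; apply: clu_refl.
by apply/imsetP; exists (cl x) => //; rewrite (@rc_beta _ _ x) // rcS // inE.
Qed.

Lemma big_sub O C : C \in big O -> C \subset O.
Proof. by case/bigP => x [_ _ ->]; apply: rc_sub. Qed.

Lemma big_clu O C x : C \in big O -> x \in C -> C = clu O x.
Proof. by case/bigP => y [yO _ ->] xC; rewrite (clu_eq yO xC). Qed.

Lemma trivIset_big O : trivIset (big O).
Proof.
apply/trivIsetP => C C' CO CO' ne; rewrite -setI_eq0; apply/set0Pn => -[x].
rewrite inE => /andP[xC xC']; move/eqP: ne; apply.
by rewrite (big_clu CO xC) (big_clu CO' xC').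
Qed.

Lemma cover_big O : cover (big O) = rc srcs O.
Proof.
apply/eqP; rewrite eqEsubset; apply/andP; split.
  apply/bigcupsP => C /bigP[x [xO xB ->]]; apply: clu_in; apply: rcS => //.
  by rewrite inE.
apply: rc_min => [x|x z].
  rewrite inE => xB xO; apply/bigcupP; exists (clu O x); last exact: clu_refl.
  by apply/bigP; exists x.
case/bigcupP => C CO xC xz zO; apply/bigcupP; exists C => //.
have e := big_clu CO xC; rewrite e in xC *; exact: rc_step xC xz zO.
Qed.

Lemma sum_card_bd O :
  (\sum_(C in big O) #|bd C C| = \sum_y #|[set C in big O | y \in bd C C]|)%N.
Proof.
rewrite (eq_bigr (fun C : {set V} => \sum_y (y \in bd C C))%N) => [|C _]; last first.
  by rewrite -sum1_card [LHS]big_mkcond; apply: eq_bigr => y _; case: ifP.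
rewrite exchange_big; apply: eq_bigr => y _ /=.
by rewrite -sum1dep_card big_mkcondr; apply: eq_bigr => C _; case: ifP.
Qed.

(** A boundary vertex of the union either borders a large cluster or is a source touched by none of
    them; the vertices of [dbl] are counted at least twice. *)
Lemma sum_bd_big O :
  (#|bd srcs (rc srcs O)| + #|dbl O| <= #|srcs| + \sum_(C in big O) #|bd C C|)%N.
Proof.
rewrite sum_card_bd; pose n y := #|[set C in big O | y \in bd C C]|.
have c (A : {set V}) : (#|A| = \sum_(y : V) (y \in A))%N.
  by rewrite -sum1_card [LHS]big_mkcond; apply: eq_bigr => y _; case: ifP.
rewrite !c -!big_split /=; apply: leq_sum => y _; rewrite -/(n y).
have -> : (y \in dbl O) = (1 < n y)%N by rewrite inE.
suff h : (y \in bd srcs (rc srcs O) -> (y \in srcs) || (0 < n y))%N.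
  by move: h; case: (y \in bd _ _) => [/(_ isT)/orP[->|]|_]; case: (n y) => [|[|]] //=; lia.
rewrite inE => /orP[->//|/exists_inP[x xr xy]]; apply/orP; right.
move: xr; rewrite -cover_big => /bigcupP[C CO xC]; apply/card_gt0P; exists C.
by rewrite !inE CO; apply/orP; right; apply/exists_inP; exists x.
Qed.

(** Distinct clusters next to [y] occupy distinct classes, since two occupied vertices of one class
    are adjacent, and only [m] classes are available. *)
Lemma sum_bd_big_le O : (\sum_(C in big O) #|bd C C| <= m * #|V|)%N.
Proof.
rewrite sum_card_bd; pose n y := #|[set C in big O | y \in bd C C]|.
rewrite mulnC -sum_nat_const; apply: leq_sum => y _; apply: leq_trans (cl_nb y).
pose g (C : {set V}) := odflt y [pick x in C | (x == y) || adj x y].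
have gP C : C \in big O -> y \in bd C C -> g C \in C /\ ((g C == y) || adj (g C) y).
  move=> CO yC; rewrite /g; case: pickP => [x /andP[]//|h].
  move: yC; rewrite inE => /orP[yC|/exists_inP[x xC xy]].
    by have := h y; rewrite yC eqxx.
  by have := h x; rewrite xC xy orbT.
rewrite -(@card_in_imset _ _ (cl \o g)); last first.
  move=> C C' /setIdP[CO yC] /setIdP[CO' yC'] /= e.
  have [gC _] := gP _ CO yC; have [gC' _] := gP _ CO' yC'.
  rewrite (big_clu CO gC) (big_clu CO' gC').
  have [->//|ne] := eqVneq (g C) (g C').
  have gO := subsetP (big_sub CO) _ gC; have gO' := subsetP (big_sub CO') _ gC'.
  apply/esym/clu_eq => //; apply: (rc_step (clu_refl gO)) => //.
  exact: cl_adj.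
apply: subset_leq_card; apply/subsetP => _ /imsetP[C /setIdP[CO yC] ->].
by have [_ h] := gP _ CO yC; apply/imsetP; exists (g C); rewrite ?inE.
Qed.

(** Each large cluster [C] is the cluster of some class, and exploring it from that class examines
    exactly [bd C C], because the class is a clique met by [C]. *)
Lemma sum_big_le O (f : nat -> nat -> R) : (forall i t, 0 <= f i t) ->
  \sum_(C in big O) f #|C| #|bd C C| <=
  \sum_(k in B) f #|rc (beta k) O| #|bd (beta k) (rc (beta k) O)|.
Proof.
move=> f0.
rewrite [leRHS](bigID (fun k => rc (beta k) O == set0)) /= ler_wpDl ?sumr_ge0 //.
rewrite [leRHS](partition_big (fun k => rc (beta k) O) (fun C => C \in big O)) /=; last first.
  by move=> k /andP[kB ne]; rewrite in_big ne; apply/imsetP; exists k.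
apply: ler_sum => C; rewrite in_big => /andP[C0 /imsetP[k kB e]].
rewrite (bigD1 k) /=; last by rewrite kB -e C0 eqxx.
rewrite -e ler_wpDr ?sumr_ge0 //.
suff -> : bd C C = bd (beta k) C by [].
have bb : beta k \subset bd C C.
  have /set0Pn[x xC] := C0.
  have [y yC yb] : exists2 y, y \in C & cl y = k.
    have CO : C \in big O by rewrite in_big C0; apply/imsetP; exists k.
    have : ~~ (rc (beta k) O \subset set0) by rewrite subset0 -e.
    have [/exists_inP[y yb yO] _|h /negP[]] := boolP [exists y in beta k, y \in O].
      by exists y; [rewrite e; apply: rcS|move: yb; rewrite inE => /eqP].
    apply: rc_min => [y yb yO|y z]; last by rewrite inE.
    by case/negP: h; apply/exists_inP; exists y.
  apply/subsetP => z; rewrite !inE => /eqP zk; have [->|zy] := eqVneq z y; first by rewrite yC.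
  by apply/orP; right; apply/exists_inP; exists y => //; rewrite adjC cl_adj // yb.
apply/setP => y; apply/idP/idP; last first.
  rewrite inE => /orP[/(subsetP bb)//|h]; by rewrite inE h orbT.
rewrite inE => /orP[yC|h]; last by rewrite inE h orbT.
by have := subsetP (rc_bd (beta k) O) y; rewrite -e => /(_ yC).
Qed.

(** Bounds the accumulated conditional variance of the exploration martingale, each step being
    divided by the weight reached; it grows like a logarithm. *)
Definition harm (s : R) t := \sum_(i < t) s / (s * i.+1%:R + 1).

Lemma harm_le (s : R) t t' : 0 <= s -> (t <= t')%N -> harm s t <= harm s t'.
Proof.
move=> s0 tt; rewrite /harm -!(big_mkord xpredT (fun i => s / (s * i.+1%:R + 1))).
rewrite [leRHS](@big_cat_nat _ _ _ t) //= ler_wpDr // sumr_ge0 // => i _.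
by rewrite divr_ge0 // addr_ge0 // mulr_ge0.
Qed.

(* [#|C| - s * #|bd C|] is a martingale along the exploration; its absolute value
   is split by AM-GM with weight [s * #|bd C| + 1]. *)
Lemma dbl_mean (s e : R) : 0 < s <= 1 -> 0 < e ->
  s * bmean s (fun O => #|dbl O|%:R) <=
  s * #|srcs|%:R + e / 2 * (s * (m * #|V|)%:R + #|B|%:R) + (2 * e)^-1 * (#|B|%:R * harm s #|V|).
Proof.
move=> /andP[s0 s1] e0; have s01 : 0 <= s <= 1 by rewrite s1 ltW.
pose f (i t : nat) : R := (i%:R - s * t%:R) ^+ 2 / (s * t%:R + 1).
have w0 t : 0 < s * t%:R + 1 by rewrite ltr_wpDl // mulr_ge0 // ltW.
have f0 i t : 0 <= f i t by rewrite divr_ge0 ?sqr_ge0 // ltW.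
(* [f - harm] is a supermartingale: at each examined vertex the mean numerator of [f] grows by
   [s * (1 - s)], while its denominator only increases. *)
have fm k : bmean s (fun O => f #|rc (beta k) O| #|bd (beta k) (rc (beta k) O)|) <= harm s #|V|.
  have := @explore_supermart s (fun i t => f i t - harm s t) (beta k) s01.
  rewrite /f /harm big_ord0 mulr0 subrr expr0n mul0r subrr => h.
  apply: le_trans (_ : bmean s (fun O => f #|rc (beta k) O| #|bd (beta k) (rc (beta k) O)|
     - harm s #|bd (beta k) (rc (beta k) O)| + harm s #|V|) <= _).
    apply: ler_bmean => // O; rewrite -addrA lerDl addrC subr_ge0.
    by apply: harm_le; [exact: ltW|exact: max_card].
  rewrite bmeanD bmean_cst gerDr; apply: h => i t; rewrite big_ord_recr /=.
  set a := s * t.+1%:R + 1; have a0 : 0 < a by exact: w0.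
  have aE : a = (s * t%:R + 1) + s by rewrite /a -natr1; ring.
  have c0 := w0 t; set c := s * t%:R + 1 in aE c0 *.
  set H := \sum_(i < t) _.
  have -> : s * ((i.+1%:R - s * t.+1%:R) ^+ 2 / a - (H + s / a)) +
     (1 - s) * ((i%:R - s * t.+1%:R) ^+ 2 / a - (H + s / a)) =
     ((i%:R - s * t%:R) ^+ 2 - s ^+ 2) / a - H.
    rewrite -!natr1; field; lra.
  rewrite lerD2r ler_pdivrMr // mulrAC ler_pdivlMr // aE.
  have := sqr_ge0 (i%:R - s * t%:R); set Z := (i%:R - s * t%:R) ^+ 2 => Z0.
  have : 0 <= s ^+ 2 * c by rewrite mulr_ge0 ?sqr_ge0 // ltW.
  have : 0 <= Z * s by rewrite mulr_ge0 // ltW.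
  by clearbody c Z => *; rewrite mulrBl [leRHS]mulrDr; lra.
have U0 : bmean s (fun O => #|rc srcs O|%:R - s * #|bd srcs (rc srcs O)|%:R) <= 0.
  have := @explore_supermart s (fun i t => i%:R - s * t%:R) srcs s01.
  rewrite mulr0 subrr; apply=> i t; rewrite -!natr1.
  by rewrite le_eqVlt; apply/orP; left; apply/eqP; ring.
rewrite -bmeanZ.
apply: le_trans (_ : bmean s (fun O => s * #|srcs|%:R + (#|rc srcs O|%:R - s * #|bd srcs (rc srcs O)|%:R)
   + (e / 2 * (s * (m * #|V|)%:R + #|B|%:R) + (2 * e)^-1 * \sum_(k in B) f #|rc (beta k) O| #|bd (beta k) (rc (beta k) O)|)) <= _); last first.
  rewrite !bmeanD !bmean_cst bmeanZ bmean_sum.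
  have : \sum_(k in B) bmean s (fun O => f #|rc (beta k) O| #|bd (beta k) (rc (beta k) O)|) <= #|B|%:R * harm s #|V|.
    rewrite mulr_natl -sumr_const; apply: ler_sum => k _; exact: fm.
  move=> h; have : 0 <= (2 * e)^-1 by rewrite invr_ge0; lra.
  by move=> /(ler_wpM2l)/(_ _ _ h); move: U0; rewrite !bmeanD; lra.
apply: ler_bmean => // O.
have h1 : (#|bd srcs (rc srcs O)|%:R + #|dbl O|%:R <= #|srcs|%:R + \sum_(C in big O) #|bd C C|%:R :> R).
  by rewrite -natr_sum -!natrD ler_nat sum_bd_big.
have h2 : #|rc srcs O|%:R = \sum_(C in big O) #|C|%:R :> R.
  by rewrite -cover_big -natr_sum (eqP (trivIset_big O)).
have h3 : \sum_(C in big O) (s * #|bd C C|%:R - #|C|%:R) <=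
  \sum_(C in big O) (e / 2 * (s * #|bd C C|%:R + 1) + (2 * e)^-1 * f #|C| #|bd C C|).
  apply: ler_sum => C _; rewrite /f; have := w0 #|bd C C|; set a := s * _; set c := #|C|%:R => a0.
  have : 0 <= (e * (a + 1) - (a - c)) ^+ 2 / (2 * e * (a + 1)).
    by rewrite divr_ge0 ?sqr_ge0 // ltW // !mulr_gt0.
  have -> : (e * (a + 1) - (a - c)) ^+ 2 / (2 * e * (a + 1)) =
     e / 2 * (a + 1) + (2 * e)^-1 * ((c - a) ^+ 2 / (a + 1)) - (a - c).
    by field; rewrite !gt_eqF.
  by rewrite subr_ge0.
have h4 : \sum_(C in big O) #|bd C C|%:R <= (m * #|V|)%:R :> R.
  by rewrite -natr_sum ler_nat sum_bd_big_le.
have h5 := sum_big_le O f0.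
have h6 : #|big O|%:R <= #|B|%:R :> R.
  rewrite ler_nat; apply: leq_trans (leq_imset_card (fun k => rc (beta k) O) B).
  by apply/subset_leq_card/subsetP => C; rewrite in_big => /andP[].
rewrite sumrB -mulr_sumr big_split /= -!mulr_sumr big_split /= -mulr_sumr sumr_const in h3.
have h4' := ler_wpM2l (ltW s0) h4; have h1' := ler_wpM2l (ltW s0) h1.
rewrite !mulrDr in h1'.
have e2 : 0 <= e / 2 by lra.
have h7 := ler_wpM2l e2 (lerD h4' h6).
have ei : 0 <= (2 * e)^-1 by rewrite invr_ge0; lra.
have h8 := ler_wpM2l ei h5.
rewrite h2; move: h3; set Z := \sum_(C in big O) f _ _ in h8 *; lra.
Qed.

End Clusters.

(** * Two distinct large clusters in a window *)

Section TwoArms.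
Context {R : realFieldType} {V : finType}.
Variable adj : rel V.
Hypothesis adjC : symmetric adj.
Variables (K : finType) (cl : V -> K) (B : {set K}) (dist : V -> V -> nat).
Hypothesis cl_adj : forall x y, cl x = cl y -> x != y -> adj x y.
Hypothesis dist_adj : forall x y, (dist x y <= 1)%N -> x != y -> adj x y.
Implicit Types (O D : {set V}) (x y z : V).

Local Notation srcs := (srcs cl B).
Local Notation clu := (clu adj).
Local Notation rc := (rc adj).
Local Notation dbl := (dbl adj cl B).

Definition two D r O := [exists x in D, exists y in D,
  [&& (dist x y <= r)%N, x \in rc srcs O, y \in rc srcs O & y \notin clu O x]].

Lemma twoP D r O : reflect (exists x y, [/\ x \in D, y \in D, (dist x y <= r)%N &
  [/\ x \in rc srcs O, y \in rc srcs O & y \notin clu O x]]) (two D r O).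
Proof.
apply: (iffP exists_inP) => [[x xD /exists_inP[y yD /and4P[? ? ? ?]]]|[x [y [xD yD ? [? ? ?]]]]].
  by exists x, y.
by exists x => //; apply/exists_inP; exists y => //; apply/and4P.
Qed.

Lemma two1 D O : two D 1 O = false.
Proof.
apply/negbTE/negP => /twoP -[x [y [_ _ d1 [xr yr yx]]]]; move/negP: yx; apply.
have xO := subsetP (rc_sub _ _ _) x xr; have yO := subsetP (rc_sub _ _ _) y yr.
have [->|ne] := eqVneq y x; first exact: clu_refl.
by apply: (rc_step (clu_refl adj xO)) yO; apply: dist_adj => //; rewrite eq_sym.
Qed.

(** Either the cluster of [y] also touches [z], which then borders two large clusters of [O], or [z]
    joins the side of [x] only and the pair [(z, y)] takes the place of [(x, y)]. *)
Lemma add_merge D O x y z r : x \in rc srcs O -> y \in rc srcs O -> y \notin clu O x ->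
  z \in D -> y \in D -> z \notin O -> adj z x -> (dist z y <= r)%N ->
  (z \in dbl O) || two D r (z |: O).
Proof.
move=> xr yr yx zD yD zO zx dz.
have xO := subsetP (rc_sub _ _ _) x xr; have yO := subsetP (rc_sub _ _ _) y yr.
have sO : O \subset z |: O by exact: subsetUr.
have [yz|yz] := boolP (y \in clu (z |: O) z); last first.
  apply/orP; right; apply/twoP; exists z, y; split => //; split => //.
    apply: (rc_step (subsetP (rc_mono adj srcs sO) x xr)); first by rewrite adjC.
    by rewrite setU11.
  exact: (subsetP (rc_mono adj srcs sO)).
have cz u : u \in clu O y \/ u \in clu O x -> u \in O by case => /(subsetP (rc_sub _ _ _)).
have [/exists_inP[u uy uz]|h] := boolP [exists u in clu O y, adj u z]; last first.
  have : clu (z |: O) y \subset clu O y.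
    apply: rc_min => [u|u v uy uv]; first by rewrite inE => /eqP-> _; apply: clu_refl.
    rewrite in_setU1 => /orP[/eqP e|]; last exact: rc_step uy uv.
    by case/negP: h; apply/exists_inP; exists u; rewrite // -e.
  move=> /subsetP/(_ z); rewrite clu_sym ?setU11 // => /(_ isT) zy.
  by rewrite (subsetP (rc_sub _ _ _) z zy) in zO.
apply/orP; left; rewrite inE.
have bigr w : w \in rc srcs O -> clu O w \in big adj cl B O.
  rewrite -(cover_big adjC B cl_adj) => /bigcupP[C CO wC].
  by rewrite -(big_clu adjC cl_adj CO wC).
have ne : clu O x != clu O y by apply: contra yx => /eqP->; apply: clu_refl.
rewrite (cardsD1 (clu O x)) (cardsD1 (clu O y)).
have -> : clu O x \in [set C in big adj cl B O | z \in bd adj C C].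
  apply/setIdP; split; first exact: bigr.
  by rewrite inE; apply/orP; right; apply/exists_inP; exists x; [exact: clu_refl|rewrite adjC].
have -> : clu O y \in [set C in big adj cl B O | z \in bd adj C C] :\ clu O x.
  rewrite in_setD1 eq_sym ne; apply/setIdP; split; first exact: bigr.
  by rewrite inE; apply/orP; right; apply/exists_inP; exists u.
by [].
Qed.

Variables (D : {set V}) (L : nat).
Hypothesis closer : forall x y r, x \in D -> y \in D -> dist x y = r.+2 ->
  (L <= #|[set z in D | adj z x && (dist z y <= r.+1)]|)%N.

(** The cap [k] on the occupied vertices of [D] leaves vacant positions for a new vertex and bounds
    the number of candidates for the vertex that was added. *)
Definition twoK r k O := two D r O && (#|O :&: D| <= k)%N.

(* Adding a vertex next to [x] and closer to [y] either merges two large clusters,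
   and then it lies in [dbl], or decreases the distance between them. *)
Lemma two_step (s : R) r k : 0 < s <= 1 -> (k <= L)%N ->
  (L - k)%:R * s * bmean s (fun O => (twoK r.+2 k O)%:R) <=
  s * bmean s (fun O => #|dbl O :&: D|%:R) + k.+1%:R * bmean s (fun O => (twoK r.+1 k.+1 O)%:R)
   + (L - k)%:R * s * bmean s (fun O => (twoK r.+1 k O)%:R).
Proof.
move=> /andP[s0 s1] kL; have s01 : 0 <= s <= 1 by rewrite s1 ltW.
have step O : (L - k)%:R * (twoK r.+2 k O)%:R <= #|dbl O :&: D|%:R +
   \sum_(z in D) (z \notin O)%:R * (twoK r.+1 k.+1 (z |: O))%:R + (L - k)%:R * (twoK r.+1 k O)%:R :> R.
  have nn : 0 <= #|dbl O :&: D|%:R + \sum_(z in D) (z \notin O)%:R * (twoK r.+1 k.+1 (z |: O))%:R :> R.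
    by rewrite addr_ge0 // sumr_ge0 // => z _; rewrite -natrM.
  have [tk|] := boolP (twoK r.+1 k O).
    by rewrite ler_wpDl // ler_wpM2l // ler_nat; case: twoK.
  have [|_ _] := boolP (twoK r.+2 k O); last by rewrite !mulr0 addr0.
  rewrite mulr0 addr0 mulr1 /twoK => /andP[/twoP[x [y [xD yD dr [xr yr yx]]]] cO]; rewrite cO andbT => nt.
  have {dr}dr : dist x y = r.+2.
    apply/eqP; rewrite eqn_leq dr ltnNge; apply: contra nt => dr'.
    by apply/twoP; exists x, y.
  have := closer xD yD dr; set Z := [set z in D | _] => cZ.
  apply: le_trans (_ : #|Z :\: O|%:R <= _).
    rewrite ler_nat -(cardsID O) in cZ *; rewrite leq_subLR (leq_trans cZ) // leq_add2r.
    apply: leq_trans cO; apply/subset_leq_card/subsetP => z.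
    by rewrite !inE => /andP[/andP[-> _] ->].
  rewrite -sum1_card natr_sum [X in _ <= X + _](_ : _ = \sum_(z in D) (z \in dbl O)%:R); last first.
    rewrite -sum1_card natr_sum (eq_bigl (fun z => (z \in D) && (z \in dbl O))) => [|z]; last by rewrite in_setI andbC.
    by rewrite big_mkcondr; apply: eq_bigr => z _; case: ifP.
  rewrite -big_split /= big_mkcond [leRHS]big_mkcond; apply: ler_sum => z _.
  have [|zZ] := boolP (z \in Z :\: O); last by case: ifP => // _; rewrite -natrM -natrD.
  case/setDP => /setIdP[zD /andP[zx dz]] zO; rewrite zD zO mul1r -natrD ler_nat.
  have := add_merge xr yr yx zD yD zO zx dz; rewrite /twoK.
  have -> : (#|(z |: O) :&: D| <= k.+1)%N.
    rewrite setIUl; apply: leq_trans (leq_card_setU _ _) _; rewrite -(add1n k).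
    apply: leq_add => //; apply: leq_trans (subset_leq_card (subsetIl _ _)) _.
    by rewrite cards1.
  by rewrite andbT; case/orP => ->; rewrite ?add1n ?addn1.
have {step} := @ler_bmean R V s _ _ s01 step; rewrite !bmeanD !bmeanZ -(ler_pM2l s0) mulrA [s * _%:R]mulrC.
move/le_trans; apply; rewrite !mulrDr mulrA [s * (L - k)%:R]mulrC lerD2r lerD2l bmean_sum mulr_sumr.
apply: le_trans (_ : \sum_(z in D) bmean s (fun O => (z \in O)%:R * (twoK r.+1 k.+1 O)%:R) <= _).
  apply: ler_sum => z _; rewrite bmean_notin bmean_in ler_pM2l //.
  rewrite (@bmean_eq _ _ _ _ (fun O => (twoK r.+1 k.+1 (z |: O))%:R)); last first.
    move=> O; congr (twoK _ _ _)%:R; apply/setP => x; rewrite !inE.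
    by case: eqP.
  by rewrite ler_piMl ?bmean_ge0 // ?gerBl // ltW.
rewrite -bmean_sum -bmeanZ; apply: ler_bmean => // O.
rewrite -mulr_suml; have [/andP[_ cO]|] := boolP (twoK r.+1 k.+1 O); last by rewrite !mulr0.
rewrite !mulr1 (_ : \sum_(z in D) _ = #|O :&: D|%:R) ?ler_nat //.
rewrite -sum1_card natr_sum (eq_bigl (fun z => (z \in D) && (z \in O))) => [|z]; last by rewrite in_setI andbC.
by rewrite big_mkcondr; apply: eq_bigr => z _; case: ifP.
Qed.

(** The recursion of [two_step] unfolded down to adjacent vertices, [a] being a common lower bound
    of the factors [(L - k) * s]; no mesh appears in it. *)
Fixpoint tcst (a : R) (r k : nat) : R :=
  if r is r'.+1 then a^-1 * (1 + k.+1%:R * tcst a r' k.+1) + tcst a r' k else 0.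

Lemma twoK_le (s a : R) r k : 0 < s <= 1 -> 0 < a -> (k + r <= L)%N -> a <= (L - (k + r))%:R * s ->
  bmean s (fun O => (twoK r.+1 k O)%:R) <= tcst a r k * (s * bmean s (fun O => #|dbl O :&: D|%:R)).
Proof.
move=> s01 a0; elim: r k => [|r IH] k kL ha /=.
  by rewrite (@bmean_eq _ _ _ _ (fun=> 0)) ?bmean_cst ?mul0r // => O; rewrite /twoK two1.
have s0 : 0 < s by case/andP: s01.
have s01' : 0 <= s <= 1 by case/andP: s01 => _ ->; rewrite ltW.
have h := two_step r s01 (leq_trans (leq_addr _ _) kL).
have h1 := IH k.+1; rewrite addSnnS in h1; move: (h1 kL ha) => {}h1.
have ha' : a <= (L - (k + r))%:R * s.
  by apply: le_trans ha _; rewrite ler_pM2r // ler_nat leq_sub2l // leq_add2l.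
have h2 := IH k (leq_trans (leq_add (leqnn k) (leqnSn r)) kL) ha'.
have a1 : a <= (L - k)%:R * s.
  by apply: le_trans ha _; rewrite ler_pM2r // ler_nat leq_sub2l // leq_addr.
move: h h1 h2; set A := bmean s _; set Y := s * _; set P1 := bmean s _; set P2 := bmean s _.
set c1 := tcst _ _ _; set c2 := tcst _ _ _; set l := _%:R * s in a1 * => h h1 h2.
have l0 : 0 < l by exact: lt_le_trans a1.
have Y0 : 0 <= Y by rewrite mulr_ge0 ?bmean_ge0 // ltW.
have P10 : 0 <= P1 by rewrite bmean_ge0.
have h3 : A <= l^-1 * (Y + k.+1%:R * P1) + P2.
  by rewrite -(ler_pM2l l0) mulrDr mulVKf ?gt_eqF.
apply: le_trans h3 _; rewrite mulrDl lerD // -mulrA; apply: ler_pM.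
- by rewrite invr_ge0 ltW.
- by rewrite addr_ge0 // mulr_ge0.
- by rewrite lef_pV2 ?posrE.
by rewrite mulrDl mul1r lerD2l -mulrA ler_wpM2l.
Qed.

End TwoArms.

Local Close Scope ring_scope.

(** * Windows of blocks in the cell graph *)

Section CellTwoArms.

Lemma card_interval M (lo h : nat) : #|[set j : 'I_M | lo <= j < lo + h]| <= h.
Proof.
rewrite cardE -(size_map val) -[leqRHS](size_iota lo).
apply: uniq_leq_size; first by rewrite map_inj_uniq ?enum_uniq //; exact: val_inj.
by move=> j /mapP[k]; rewrite mem_enum inE => h1 ->; rewrite mem_iota.
Qed.

Lemma card_ring M h w (A : {set 'I_M * 'I_M}) :
  (forall x, x \in A -> [/\ x.1 < w, x.2 < w &
     [|| x.1 < h, w <= x.1 + h, x.2 < h | w <= x.2 + h]]) -> #|A| <= 4 * (h * w).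
Proof.
move=> hA; pose X lo := [set j : 'I_M | lo <= j < lo + h].
pose W := [set j : 'I_M | 0 <= j < 0 + w].
have cX lo : #|setX (X lo) W| <= h * w by rewrite cardsX; apply: leq_mul; exact: card_interval.
have cX' lo : #|setX W (X lo)| <= h * w by rewrite cardsX mulnC; apply: leq_mul; exact: card_interval.
have le4 (A1 A2 A3 A4 : {set 'I_M * 'I_M}) : #|A1 :|: A2 :|: A3 :|: A4| <= #|A1| + #|A2| + #|A3| + #|A4|.
  do 2! (apply: leq_trans (leq_card_setU _ _) _; rewrite leq_add2r).
  exact: leq_card_setU.
apply: leq_trans (_ : #|setX (X 0) W :|: setX (X (w - h)) W :|: setX W (X 0) :|: setX W (X (w - h))| <= _).
  apply/subset_leq_card/subsetP => x /hA[x1 x2]; rewrite !inE !add0n x1 x2 /=.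
  move: (nat_of_ord x.1) (nat_of_ord x.2) x1 x2 => i j x1 x2 /or4P[] k; apply/orP.
  - by left; apply/orP; left; apply/orP; left; rewrite k.
  - left; apply/orP; left; apply/orP; right; lia.
  - by left; apply/orP; right; rewrite k.
  - right; lia.
apply: leq_trans (le4 _ _ _ _) _.
by rewrite (_ : 4 * _ = h * w + h * w + h * w + h * w) ?leq_add //; lia.
Qed.

Variables b n : nat.
Hypothesis b0 : 0 < b.
Local Notation q := (4 * b).
Local Notation cell := (cell b n).
Local Notation cadj := (@cadj b n).
Local Notation cT := (@cT b n).
Local Notation side := (side b n).
Local Notation block := (@block b n).
Implicit Types x y z : cell.

Definition cheb (i j k l : nat) := maxn (maxn i j - minn i j) (maxn k l - minn k l).
Definition bdist x y := cheb (x.1 %/ b) (y.1 %/ b) (x.2 %/ b) (y.2 %/ b).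

Lemma sideE : side = 8 * n * b. Proof. by clear b0; rewrite /side; lia. Qed.

Lemma div_side x : x.1 %/ b < 8 * n /\ x.2 %/ b < 8 * n.
Proof. by split; rewrite ltn_divLR // -sideE ltn_ord. Qed.

Lemma div_close i j k : i %/ b <= j %/ b + k -> i <= j + k.+1 * b.
Proof.
move=> h; have h1 := ltn_ceil i b0; have h2 := leq_trunc_div j b.
have h3 : (i %/ b).+1 * b <= (j %/ b + k).+1 * b by rewrite leq_mul2r ltnS h orbT.
apply: ltnW; apply: leq_trans h1 _; apply: leq_trans h3 _.
by rewrite -addnS mulnDl leq_add2r.
Qed.

Lemma bdist_adj x y : bdist x y <= 1 -> x != y -> cadj x y.
Proof.
rewrite /bdist /cheb => h xy; rewrite /cadj xy /= /gap.
have k1 : (maxn x.1 y.1 - minn x.1 y.1).-1 <= 2 * b.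
  have := @div_close x.1 y.1 1; have := @div_close y.1 x.1 1; move: h.
  by move: (x.1 %/ b) (y.1 %/ b) (x.2 %/ b) (y.2 %/ b) => *; lia.
have k2 : (maxn x.2 y.2 - minn x.2 y.2).-1 <= 2 * b.
  have := @div_close x.2 y.2 1; have := @div_close y.2 x.2 1; move: h.
  by move: (x.1 %/ b) (y.1 %/ b) (x.2 %/ b) (y.2 %/ b) => *; lia.
move: k1 k2; move: (_.-1) (_.-1) => g1 g2; clear => k1 k2.
have e1 : g1 ^ 2 <= (2 * b) ^ 2 by rewrite leq_exp2r.
have e2 : g2 ^ 2 <= (2 * b) ^ 2 by rewrite leq_exp2r.
by move: e1 e2; rewrite !expnMn; lia.
Qed.

Definition wnd (lo : nat * nat) (w : nat) : {set cell} :=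
  [set x : cell | (lo.1 <= x.1 %/ b < lo.1 + w) && (lo.2 <= x.2 %/ b < lo.2 + w)].

Definition toward (i j : nat) := if i < j then i.+1 else if j < i then i.-1 else i.

Lemma toward_in lo hi i j : lo <= i < hi -> lo <= j < hi -> lo <= toward i j < hi.
Proof. by rewrite /toward => *; do ![case: ifP => ?]; lia. Qed.

Lemma toward_dist i j r : maxn i j - minn i j <= r.+2 ->
  maxn (toward i j) j - minn (toward i j) j <= r.+1 /\ maxn (toward i j) i - minn (toward i j) i <= 1.
Proof. by rewrite /toward => h; case: ifP => h1; [|case: ifP => h2]; split; lia. Qed.

Lemma cheb_toward i j k l r : cheb i j k l = r.+2 ->
  cheb (toward i j) j (toward k l) l <= r.+1 /\ cheb (toward i j) i (toward k l) k <= 1.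
Proof.
move=> h; have : cheb i j k l <= r.+2 by rewrite h.
rewrite /cheb !geq_max => /andP[/toward_dist[h1 h2] /toward_dist[h3 h4]].
by rewrite h1 h2 h3 h4.
Qed.

(** One block towards [y] in each coordinate lowers the Chebyshev distance, and all [b * b] cells of
    the block arrived at are adjacent to [x]. *)
Lemma closer_cell lo w x y r : x \in wnd lo w -> y \in wnd lo w -> bdist x y = r.+2 ->
  b * b <= #|[set z in wnd lo w | cadj z x && (bdist z y <= r.+1)]|.
Proof.
rewrite !inE => /andP[/andP[x1 x2] /andP[x3 x4]] /andP[/andP[y1 y2] /andP[y3 y4]] dxy.
pose m1 := toward (x.1 %/ b) (y.1 %/ b); pose m2 := toward (x.2 %/ b) (y.2 %/ b).
have [X1 X2] := div_side x; have [Y1 Y2] := div_side y.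
have lt m (t : 'I_b) : m < 8 * n -> m * b + t < side.
  move=> mn; rewrite sideE; have : m.+1 * b <= 8 * n * b by rewrite leq_mul2r mn orbT.
  by rewrite mulSn; have := ltn_ord t; lia.
have m1n : m1 < 8 * n by have := @toward_in 0 (8 * n) _ _ X1 Y1.
have m2n : m2 < 8 * n by have := @toward_in 0 (8 * n) _ _ X2 Y2.
pose f (t : 'I_b * 'I_b) : cell := (Ordinal (lt m1 t.1 m1n), Ordinal (lt m2 t.2 m2n)).
have fI : injective f by move=> [t1 t2] [t3 t4] [] /addnI/val_inj -> /addnI/val_inj ->.
have fd1 t : (f t).1 %/ b = m1 by rewrite /= divnMDl // divn_small ?addn0.
have fd2 t : (f t).2 %/ b = m2 by rewrite /= divnMDl // divn_small ?addn0.
have dz t : bdist (f t) y <= r.+1 /\ bdist (f t) x <= 1.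
  by rewrite /bdist fd1 fd2; apply: cheb_toward.
apply: leq_trans (_ : #|[set f t | t in [set: 'I_b * 'I_b]]| <= _).
  by rewrite card_imset // cardsT card_prod card_ord.
apply/subset_leq_card/subsetP => _ /imsetP[t _ ->]; have [dy dx] := dz t.
rewrite inE dy andbT; apply/andP; split.
  by rewrite inE fd1 fd2 !toward_in // ?x1 ?x3 ?y1 ?y3.
apply: bdist_adj => //; apply: contraTneq dy => ->.
by rewrite dxy -ltnNge.
Qed.

Lemma cl_nb_cell y : #|[set block x | x in [set x | (x == y) || cadj x y]]| <= 441.
Proof.
apply: (@card_window2 _ (y.1 %/ b) (y.2 %/ b) 10).
move=> _ /imsetP[x + ->]; rewrite inE => /orP[/eqP->|/cadj_dist[h1 h2 h3 h4]] /=.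
  by split; exact: leq_addr.
have H u v : u <= v + q.+1 -> u %/ b <= v %/ b + 10.
  move=> uv; rewrite addnC -(divnMDl _ _ b0); apply: leq_div2r.
  by apply: leq_trans uv _; lia.
by split; apply: H.
Qed.

Lemma in_cT x : (x \in cT) = ~~ ((5 <= x.1 %/ b < 8 * n - 5) && (5 <= x.2 %/ b < 8 * n - 5)).
Proof. by rewrite inE !leq_divRL // !ltn_divLR // mulnBl -sideE. Qed.

Lemma srcs_cT : srcs block [set block x | x in cT] = cT.
Proof.
apply/setP => x; rewrite [in LHS]inE; apply/imsetP/idP => [[t tT [e1 e2]]|xT]; last by exists x.
by rewrite in_cT e1 e2 -in_cT.
Qed.

Lemma card_cT : #|cT| <= 160 * n * b ^ 2.
Proof.
apply: leq_trans (@card_ring _ (5 * b) side _ _) _; last by rewrite sideE; lia.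
move=> x; rewrite inE !negb_and => h; split; rewrite ?ltn_ord //.
have := ltn_ord x.1; have := ltn_ord x.2; move: h; rewrite -!leqNgt -!ltnNge.
move: (nat_of_ord x.1) (nat_of_ord x.2) => i j {x}; move: side => s.
by move=> /orP[/orP[]|/orP[]] k h1 h2; apply/or4P; [constructor 1|constructor 2|constructor 3|constructor 4]; lia.
Qed.

(** Four strips of 5 by [8 * n] blocks: the ring has of order [n] blocks against [n ^ 2] in the box,
    which makes the density estimate below work. *)
Lemma card_block_cT : #|[set block x | x in cT]| <= 160 * n.
Proof.
apply: leq_trans (@card_ring _ 5 (8 * n) _ _) _; last by lia.
move=> _ /imsetP[x xT ->] /=; have [h1 h2] := div_side x; split => //.
move: xT h1 h2; rewrite in_cT; move: (x.1 %/ b) (x.2 %/ b) => i j {x}.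
by rewrite !negb_and => /orP[/orP[]|/orP[]] k h1 h2;
   apply/or4P; [constructor 1|constructor 2|constructor 3|constructor 4]; lia.
Qed.

Lemma card_cell : #|{: cell}| = 64 * n ^ 2 * b ^ 2.
Proof. by rewrite card_prod card_ord sideE; lia. Qed.

End CellTwoArms.
Arguments bdist {b n}.

(** * Translates of a box inside a larger box *)

Section Shift.
Variables (b n N t1 t2 : nat).
Hypotheses (b0 : 0 < b) (ht1 : t1 + 8 * n <= 8 * N) (ht2 : t2 + 8 * n <= 8 * N).

Lemma shift_ord t (i : 'I_(side b n)) : t + 8 * n <= 8 * N -> i + t * b < side b N.
Proof.
move=> h; have := ltn_ord i; move: (nat_of_ord i) => j; rewrite !sideE.
have : (t + 8 * n) * b <= 8 * N * b by rewrite leq_mul2r h orbT.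
by rewrite mulnDl; lia.
Qed.

(** The offsets are multiples of [b], so that blocks are mapped to blocks. *)
Definition sh (x : cell b n) : cell b N :=
  (Ordinal (shift_ord x.1 ht1), Ordinal (shift_ord x.2 ht2)).

Lemma sh_inj : injective sh.
Proof. by move=> [x1 x2] [y1 y2] [] /addIn/val_inj -> /addIn/val_inj ->. Qed.

Lemma gap_addr i j c : gap (i + c) (j + c) = gap i j.
Proof. by rewrite /gap; lia. Qed.

Lemma sh_adj x y : cadj (sh x) (sh y) = cadj x y.
Proof. by rewrite /cadj (inj_eq sh_inj) /= !gap_addr. Qed.

Lemma sh_bdist x y : bdist (sh x) (sh y) = bdist x y.
Proof. by rewrite /bdist /= !divnDMl // /cheb -!addn_maxl -!addn_minl !subnDr. Qed.

Lemma sh_onto (x : cell b N) : t1 * b <= x.1 < t1 * b + side b n ->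
  t2 * b <= x.2 < t2 * b + side b n -> exists y, x = sh y.
Proof.
case: x => x1 x2 /= /andP[h1 h2] /andP[h3 h4].
have k1 : x1 - t1 * b < side b n by rewrite ltn_subLR.
have k2 : x2 - t2 * b < side b n by rewrite ltn_subLR.
exists (Ordinal k1, Ordinal k2); rewrite /sh /=.
by congr (_, _); apply: val_inj => /=; rewrite subnK.
Qed.

Lemma sh_cT x : x \notin cT -> sh x \notin cT.
Proof.
rewrite !inE !negbK /=; move: (nat_of_ord x.1) (nat_of_ord x.2) => i j; rewrite !sideE.
have : (t1 + 8 * n) * b <= 8 * N * b by rewrite leq_mul2r ht1 orbT.
have : (t2 + 8 * n) * b <= 8 * N * b by rewrite leq_mul2r ht2 orbT.
rewrite !mulnDl; move: (8 * N * b) (8 * n * b) (t1 * b) (t2 * b) => A B c d h1 h2.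
by move=> /andP[/andP[? ?] /andP[? ?]]; lia.
Qed.

(** The ring of the small box is at least as thick as one step is long, [4 * b + 1 <= 5 * b], so a
    step from a cell off the ring stays in the translate. *)
Lemma sh_step x z : x \notin cT -> cadj (sh x) z -> exists y, z = sh y.
Proof.
rewrite inE negbK => /andP[/andP[h1 h2] /andP[h3 h4]] /cadj_dist[/= k1 k2 k3 k4].
apply: sh_onto; move: h1 h2 h3 h4 k1 k2 k3 k4.
  move: (nat_of_ord x.1) (nat_of_ord x.2) => i j.
  by move: (side b n) (t1 * b) => A B *; lia.
move: (nat_of_ord x.1) (nat_of_ord x.2) => i j.
by move: (side b n) (t2 * b) => A B *; lia.
Qed.

Definition pullF (F : {set {set cell b N}}) := [set e : {set cell b n} | sh @: e \in F].

Lemma pull_step (O : {set cell b N}) F x y :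
  step cadj O F (sh x) (sh y) = step cadj (sh @^-1: O) (pullF F) x y.
Proof. by rewrite /step !inE sh_adj imsetU !imset_set1. Qed.

Lemma pull_reach (O : {set cell b N}) F (S : {set cell b n}) (S' : {set cell b N}) :
  sh @: S \subset S' -> sh @: reach cadj S (sh @^-1: O) (pullF F) \subset reach cadj S' O F.
Proof.
move=> SS; rewrite sub_imset_pre.
apply: reach_min => [x xS|x z]; rewrite !inE => xO.
  by apply: reachS => //; apply: (subsetP SS); apply: imset_f.
by rewrite -pull_step; apply: reach_step.
Qed.

(** As long as the small box is not crossed, the exploration never gets onto its ring, hence never
    leaves the translate. *)
Lemma pull_exit (O : {set cell b N}) F (S : {set cell b n}) (S' : {set cell b N}) :
  S' \subset sh @: S -> ~~ perc cadj S cT (sh @^-1: O) (pullF F) ->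
  reach cadj S' O F \subset sh @: reach cadj S (sh @^-1: O) (pullF F).
Proof.
move=> SS np; apply: reach_min => [x /(subsetP SS)/imsetP[y yS ->] xO|x z /imsetP[y yr ->] st].
  by apply: imset_f; apply: reachS => //; rewrite inE.
have yT : y \notin cT by apply: contra np => yT; apply/percP; exists y.
have [w e] : exists w, z = sh w by case/and4P: st => _ _ a _; exact: sh_step a.
by rewrite e pull_step in st *; apply: imset_f; apply: reach_step st.
Qed.

Lemma pull_perc (O : {set cell b N}) F (S : {set cell b n}) (S' : {set cell b N}) :
  S' \subset sh @: S -> perc cadj S' cT O F -> perc cadj S cT (sh @^-1: O) (pullF F).
Proof.
move=> SS /percP[z zT zr]; have [//|np] := boolP (perc cadj S cT (sh @^-1: O) (pullF F)).
have /imsetP[y yr e] := subsetP (pull_exit SS np) z zr.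
case/negP: np; apply/percP; exists y => //; apply/negPn/negP => /sh_cT.
by rewrite -e zT.
Qed.

Lemma pullFT : pullF [set: _] = [set: _].
Proof. by apply/setP => e; rewrite !inE. Qed.

Lemma pull_clu (O : {set cell b N}) x y :
  y \in clu cadj (sh @^-1: O) x -> sh y \in clu cadj O (sh x).
Proof.
move=> yx; have := @pull_reach O [set: _] [set x] [set sh x]; rewrite imset_set1 pullFT => /(_ (subxx _)).
by move/subsetP; apply; apply: imset_f.
Qed.

(** Connection is symmetric; this puts the arms of the two-arm event into the form that [pull_perc]
    accepts. *)
Lemma rc_srcs_perc (V : finType) (adj : rel V) (T O : {set V}) x : symmetric adj ->
  (x \in rc adj T O) = perc adj [set x] T O [set: {set V}].
Proof.
move=> aC; apply/idP/percP => [xr|[z zT zr]].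
  have [/exists_inP[z zT zr]|h] := boolP [exists z in T, z \in clu adj O x]; first by exists z.
  have : rc adj T O \subset O :\: clu adj O x.
    apply: rc_min => [z zT zO|z w]; rewrite !inE.
      by rewrite zO andbT; apply: contra h => zr; apply/exists_inP; exists z.
    move=> /andP[zx zO] zw wO; rewrite wO andbT; apply: contra zx => wx.
    by apply: (rc_step wx); rewrite // aC.
  by move/subsetP/(_ x xr); rewrite inE clu_refl // (subsetP (rc_sub adj T O) x xr).
have zO := subsetP (rc_sub _ _ _) z zr.
have xO : x \in O.
  apply: contraLR zr => xO; suff : rc adj [set x] O \subset set0 by move/subsetP/(_ z) => h; apply/negP => /h; rewrite inE.
  by apply: rc_min => [y|y w]; rewrite !inE // => /eqP->; rewrite (negbTE xO).
by apply: (subsetP (clu_in (rcS adj zT zO))); apply: clu_sym.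
Qed.

(** Arms that reach the outer ring also reach the ring of the small box, and cells not connected in
    the large box are not connected in the small one. A window of the large box is thus compared
    with any position of that window inside a small box. *)
Lemma pull_two (O : {set cell b N}) lo lo' w r k : lo'.1 = lo.1 + t1 -> lo'.2 = lo.2 + t2 ->
  lo.1 + w <= 8 * n -> lo.2 + w <= 8 * n ->
  twoK cadj (@block b N) (block @: @cT b N) (@bdist b N) (wnd b N lo' w) r k O ->
  twoK cadj (@block b n) (block @: @cT b n) (@bdist b n) (wnd b n lo w) r k (sh @^-1: O).
Proof.
move=> l1 l2 w1 w2 /andP[/twoP[x [y [xD yD d [xr yr yx]]]] ck].
have shD z : (sh z \in wnd b N lo' w) = (z \in wnd b n lo w).
  rewrite !inE /= !divnDMl // l1 l2.
  move: (z.1 %/ b) (z.2 %/ b) => i j.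
  by congr (_ && _); congr (_ && _); lia.
have onto z : z \in wnd b N lo' w -> exists u, z = sh u.
  rewrite inE l1 l2 => /andP[/andP[h1 h2] /andP[h3 h4]]; apply: sh_onto.
    rewrite leq_divRL in h1 => //; rewrite ltn_divLR in h2 => //; rewrite (sideE b n).
    have : (lo.1 + w) * b <= 8 * n * b by rewrite leq_mul2r w1 orbT.
    move: h1 h2; rewrite !mulnDl; move: (lo.1 * b) (w * b) (t1 * b) (8 * n * b) => *; lia.
  rewrite leq_divRL in h3 => //; rewrite ltn_divLR in h4 => //; rewrite (sideE b n).
  have : (lo.2 + w) * b <= 8 * n * b by rewrite leq_mul2r w2 orbT.
  move: h3 h4; rewrite !mulnDl; move: (lo.2 * b) (w * b) (t2 * b) (8 * n * b) => *; lia.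
have [x' ex] := onto x xD; have [y' ey] := onto y yD; subst x y.
have pr z : sh z \in rc cadj (srcs block (block @: @cT b N)) O ->
    z \in rc cadj (srcs block (block @: @cT b n)) (sh @^-1: O).
  rewrite !srcs_cT // !rc_srcs_perc; try exact: cadjC.
  by rewrite -pullFT; apply: pull_perc; rewrite imset_set1.
apply/andP; split.
  apply/twoP; exists x', y'; split; rewrite -?shD // -?sh_bdist //; split; [exact: pr|exact: pr|].
  by apply: contra yx; exact: pull_clu.
rewrite -(card_imset _ sh_inj); apply: leq_trans ck; apply/subset_leq_card/subsetP => _ /imsetP[z + ->].
by rewrite inE [z \in _ @^-1: _]inE -shD => /andP[zO zD]; rewrite inE zO.
Qed.

End Shift.

Local Open Scope ring_scope.

(** * Decay of the two-arm probability *)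

Section TwoArmDecay.
Context {R : realType}.

Lemma harm_ln (s : R) t : 0 <= s -> harm s t <= ln (1 + s * t%:R).
Proof.
move=> s0; rewrite /harm; elim: t => [|t IH]; first by rewrite big_ord0 mulr0 addr0 ln1.
rewrite big_ord_recr /=; set c := 1 + s * t%:R in IH *.
have c1 : 1 <= c by rewrite lerDl mulr_ge0.
have -> : s * t.+1%:R + 1 = c + s by rewrite /c -natr1; ring.
have -> : 1 + s * t.+1%:R = c + s by rewrite /c -natr1; ring.
have cs : 0 < c + s by lra.
apply: (le_trans (lerD IH (lexx _))); rewrite -lerBrDl -ln_div ?posrE //; try lra.
have e : c / (c + s) <= expR (- (s / (c + s))).
  apply: le_trans (expR_ge1Dx _); rewrite ler_pdivrMr // mulrDl mul1r mulNr divfK ?gt_eqF //; lra.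
rewrite -[leRHS]opprK lerNr -lnV ?posrE ?divr_gt0 //; last lra.
by rewrite invf_div -[leRHS]expRK ler_ln ?posrE ?expR_gt0 // divr_gt0 //; lra.
Qed.

Lemma ln_small (c d : R) : 0 < c -> 0 < d ->
  exists n0 : nat, forall n : nat, (n0 <= n)%N -> ln (1 + c * n%:R ^+ 2) <= d * n%:R.
Proof.
move=> c0 d0; pose x := d / 3; have x0 : 0 < x by rewrite /x; lra.
pose B := (1 + c) / x ^+ 3; have B0 : 0 < B by rewrite divr_gt0 ?exprn_gt0 //; lra.
exists (Num.bound B).+1 => n hn.
have n1 : 1 <= n%:R :> R by rewrite ler1n; exact: leq_trans hn.
have nB : B <= n%:R.
  by apply/ltW/(lt_le_trans (archi_boundP (ltW B0))); rewrite ler_nat ltnW.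
have c2 : 0 < 1 + c * n%:R ^+ 2 by rewrite ltr_wpDr // mulr_ge0 ?sqr_ge0 // ltW.
rewrite -ler_expR lnK ?posrE //.
have -> : d * n%:R = x * n%:R * 3%:R by rewrite /x; field.
rewrite expRM_natr.
have h : x * n%:R <= expR (x * n%:R) by apply: le_trans (expR_ge1Dx _); lra.
apply: le_trans (_ : (x * n%:R) ^+ 3 <= _); last first.
  by apply: lerXn2r; rewrite ?nnegrE ?expR_ge0 // mulr_ge0 // ltW.
rewrite exprMn; move: nB; rewrite ler_pdivrMr ?exprn_gt0 // mulrC => nB.
have -> : x ^+ 3 * n%:R ^+ 3 = x ^+ 3 * n%:R * n%:R ^+ 2 by ring.
apply: le_trans (_ : (1 + c) * n%:R ^+ 2 <= _); last by rewrite ler_wpM2r ?sqr_ge0.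
rewrite mulrDl mul1r lerD2r; exact: exprn_ege1.
Qed.

(** [e] is fixed first, so that the area term takes a quarter of [eps]; what remains is of order [n]
    and [n * ln n]. *)
Lemma quad_small (c1 c2 c3 c4 c5 eps : R) : 0 < c1 -> 0 < c2 -> 0 < c3 -> 0 < c4 -> 0 < c5 -> 0 < eps ->
  exists2 e : R, 0 < e & exists n0 : nat, forall n : nat, (n0 <= n)%N ->
  c1 * n%:R + e / 2 * (c2 * n%:R ^+ 2 + c3 * n%:R) + (2 * e)^-1 * (c4 * n%:R * ln (1 + c5 * n%:R ^+ 2)) <=
  eps * n%:R ^+ 2.
Proof.
move=> p1 p2 p3 p4 p5 p0; exists (eps / (2 * c2)); first by rewrite divr_gt0 ?mulr_gt0.
set e := eps / (2 * c2); have e0 : 0 < e by rewrite divr_gt0 ?mulr_gt0.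
have ee : e * c2 = eps / 2 by rewrite /e; field; rewrite gt_eqF.
clearbody e.
pose d := eps / 4 * (2 * e) / c4; have d0 : 0 < d.
  have h4 : 0 < eps / 4 by lra.
  have h2 : 0 < 2 * e by lra.
  by rewrite /d divr_gt0 // mulr_gt0.
have [n1 h1] := ln_small p5 d0.
pose A := (c1 + e / 2 * c3) / (eps / 4).
have e2 : 0 < e / 2 by lra.
have A0 : 0 < A.
  by apply: divr_gt0; [rewrite addr_gt0 // mulr_gt0|lra].
exists (maxn n1 (Num.bound A)) => n; rewrite geq_max => /andP[nn1 nA].
have {h1} := h1 n nn1; set l := ln _ => hl.
have {}nA : A <= n%:R by apply/ltW/(lt_le_trans (archi_boundP (ltW A0))); rewrite ler_nat.
have n0 : 0 <= n%:R :> R by [].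
have t3 : (2 * e)^-1 * (c4 * n%:R * l) <= eps / 4 * n%:R ^+ 2.
  apply: le_trans (_ : (2 * e)^-1 * (c4 * n%:R * (d * n%:R)) <= _).
    by rewrite ler_wpM2l ?invr_ge0 ?mulr_ge0 // ?ler_wpM2l ?mulr_ge0 // ltW.
  by rewrite le_eqVlt; apply/orP; left; apply/eqP; rewrite /d; field; rewrite !gt_eqF.
have t1 : (c1 + e / 2 * c3) * n%:R <= eps / 4 * n%:R ^+ 2.
  move: nA; rewrite ler_pdivrMr; last lra.
  by move=> /(ler_wpM2r n0) /le_trans; apply; rewrite expr2; lra.
have t2 : e / 2 * (c2 * n%:R ^+ 2) = eps / 4 * n%:R ^+ 2 
  by have -> : e / 2 * (c2 * n%:R ^+ 2) = e * c2 / 2 * n%:R ^+ 2; [field|rewrite ee; field].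
have -> : c1 * n%:R + e / 2 * (c2 * n%:R ^+ 2 + c3 * n%:R) = (c1 + e / 2 * c3) * n%:R + e / 2 * (c2 * n%:R ^+ 2) by ring.
rewrite t2; move: t1 t3; have := mulr_ge0 (ltW p0) (sqr_ge0 (n%:R : R)).
move: (_ * n%:R) (_^-1 * _) (n%:R ^+ 2) => X Y Z; clear; lra.
Qed.

Lemma tcst_ge0 (a : R) r k : 0 < a -> 0 <= tcst a r k.
Proof.
move=> a0; elim: r k => [|r IH] k //=.
by rewrite addr_ge0 // mulr_ge0 // ?invr_ge0 ?(ltW a0) // addr_ge0 // mulr_ge0.
Qed.

(** Multiplication by [s] turns numbers of cells into areas, so [b] disappears. In [dbl_mean] the
    ring contributes of order [n], up to a logarithm, and the whole box [n ^ 2] with the free factor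
    [e]; vertices bordering two large clusters therefore have vanishing density. *)
Lemma dbl_cell (k2 eps : R) : 0 < k2 -> 0 < eps -> exists n0 : nat, forall n b s, (n0 <= n)%N ->
  (0 < b)%N -> 0 < s <= 1 -> s * (16 * b ^ 2)%:R <= k2 ->
  s * bmean s (fun O => #|dbl (@cadj b n) block (block @: cT) O|%:R) <= eps * n%:R ^+ 2.
Proof.
move=> k20 eps0.
have p441 : 0 < 441%:R :> R by rewrite ltr0n.
have p160 : 0 < 160%:R :> R by rewrite ltr0n.
have p10 : 0 < 10%:R :> R by rewrite ltr0n.
have p4 : 0 < 4%:R :> R by rewrite ltr0n.
have := @quad_small (10%:R * k2) (441%:R * (4%:R * k2)) 160%:R 160%:R (4%:R * k2) eps.
case; rewrite ?mulr_gt0 // => e e0 [n0 H].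
exists n0 => n b s nn b0 s01 sb; have {H} H := H n nn.
have /andP[s0 s1] := s01.
apply: le_trans (_ : _ <= _) H.
apply: le_trans (@dbl_mean _ _ (@cadjC b n) R _ block (block @: cT) 441 _ _ s e s01 e0) _.
- by move=> x y; apply: block_adj.
- by move=> y; apply: cl_nb_cell.
have nR : (s * (64 * n ^ 2 * b ^ 2)%:R <= 4%:R * k2 * n%:R ^+ 2).
  rewrite (_ : 64 * n ^ 2 * b ^ 2 = 4 * (16 * b ^ 2) * n ^ 2)%N; last first.
    by rewrite mulnAC !mulnA.
  rewrite natrM natrM natrX mulrA ler_wpM2r ?sqr_ge0 //.
  by rewrite [s * _]mulrCA ler_wpM2l // ltW.
rewrite srcs_cT // card_cell //.
have B1 : #|block @: @cT b n|%:R <= 160%:R * n%:R :> R by rewrite -natrM ler_nat card_block_cT.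
apply: lerD; first apply: lerD.
- apply: le_trans (_ : s * (160 * n * b ^ 2)%:R <= _).
    by rewrite ler_wpM2l ?(ltW s0) // ler_nat card_cT.
  rewrite (_ : 160 * n * b ^ 2 = 10 * (16 * b ^ 2) * n)%N; last by rewrite mulnAC mulnA.
  by rewrite natrM natrM mulrA ler_wpM2r // [s * _]mulrCA ler_wpM2l // ltW.
- rewrite ler_wpM2l //; first by rewrite divr_ge0 ?ltW.
  apply: lerD => //; rewrite natrM [s * _]mulrCA -[leRHS]mulrA ler_wpM2l // ltW //.
- rewrite ler_wpM2l ?invr_ge0 ?mulr_ge0 ?(ltW e0) //; apply: ler_pM => //.
    by rewrite /harm sumr_ge0 // => i _; rewrite divr_ge0 ?addr_ge0 ?mulr_ge0 ?ltW.
  apply: le_trans (harm_ln _ (ltW s0)) _; rewrite ler_ln ?posrE ?lerD2l //.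
    by rewrite ltr_wpDr // mulr_ge0 // ltW.
  by rewrite ltr_wpDr // mulr_ge0 ?sqr_ge0 // mulr_ge0 // ltW.
Qed.

(** The central square of half side [M], measured in blocks of side 1/4; any two of its cells
    satisfy the distance bound [8 * M]. *)
Definition twoarm b N M K (O : {set cell b N}) :=
  twoK cadj block (block @: cT) bdist (wnd b N (4 * N - 4 * M, 4 * N - 4 * M)%N (8 * M)%N) (8 * M)%N K O.

Lemma shift_bounds M g (u : 'I_g) : (0 < M)%N ->
  let t := (4 * (2 * (M * g)) - 4 * M - 8 * M * u)%N in
  [/\ t + 8 * (M * g) <= 8 * (2 * (M * g)),
      4 * (2 * (M * g)) - 4 * M = 8 * M * u + t & 8 * M * u + 8 * M <= 8 * (M * g)]%N.
Proof.
move=> M0 t; have h : (M * u + M <= M * g)%N by rewrite -mulnSr leq_mul2l ltn_ord orbT.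
by rewrite /t -!mulnA; move: (M * u)%N (M * g)%N h => X Y h; split; lia.
Qed.

Lemma large_mesh (k1 : R) s (b K : nat) : 0 < k1 -> (K.+1 <= b)%N -> (2 <= b)%N ->
  k1 / (4 * b)%:R ^+ 2 <= s -> [/\ (K <= b * b)%N & k1 / 32%:R <= (b * b - K)%:R * s].
Proof.
move=> k10 Kb b2 hs.
have h : (b <= b * b)%N by rewrite leq_pmulr // ltnW.
have h2 : (2 * b <= b * b)%N by rewrite leq_mul2r b2 orbT.
split; first lia.
have c0 : 0 < (16 * (b * b))%:R :> R by rewrite ltr0n; lia.
apply: le_trans (_ : (b * b - K)%:R * (k1 / (16 * (b * b))%:R) <= _); last first.
  rewrite ler_wpM2l //; move: hs; congr (_ / _ <= _).
  by rewrite -natrX expnMn -mulnn.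
rewrite mulrCA ler_wpM2l ?(ltW k10) // ler_pdivlMr // mulrC ler_pdivrMr ?ltr0n // -natrM ler_nat.
lia.
Qed.

Lemma div_uniq c X i : (0 < c)%N -> (c * i <= X)%N -> (X < c * i + c)%N -> (X %/ c)%N = i.
Proof.
move=> c0 h1 h2; apply/eqP; rewrite eqn_leq -ltnS ltn_divLR // leq_divRL //.
by rewrite mulSn addnC [(i * c)%N]mulnC h1 h2.
Qed.

(** Averaging over translates: each of the [g * g] disjoint windows of the small box bounds the same
    probability [P], and their shares of [dbl] add up to at most the total. So [P] is at most a
    constant depending on [M] and [K] times the density of [dbl]. *)
Lemma twoarm_small (k1 k2 eps : R) (M K : nat) : 0 < k1 -> 0 < k2 -> 0 < eps -> (0 < M)%N ->
  exists N b0 : nat, (M <= N)%N /\ forall b s, (b0 <= b)%N ->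
    k1 / (4 * b)%:R ^+ 2 <= s -> s <= k2 / (4 * b)%:R ^+ 2 ->
    bmean s (fun O => (@twoarm b N M K O)%:R) <= eps.
Proof.
move=> k10 k20 eps0 M0.
have a0 : 0 < k1 / 32%:R by rewrite divr_gt0 ?ltr0n.
pose tc := tcst (k1 / 32%:R) (8 * M)%N.-1 K + 1.
have tc0 : 0 < tc by rewrite ltr_wpDl // tcst_ge0.
(* Chosen so that [g ^ 2 * P <= tc * e * n ^ 2] with [n = M * g] becomes [P <= eps]. *)
pose e := eps / (tc * M%:R ^+ 2).
have e0 : 0 < e by rewrite divr_gt0 // mulr_gt0 // exprn_gt0 // ltr0n.
have [n0 Hn] := dbl_cell k20 e0.
pose g := n0.+1; pose n := (M * g)%N.
exists (2 * n)%N, (K + 8 * M + 2 + Num.bound k2)%N; split.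
  by rewrite /n mulnCA leq_pmulr // muln_gt0.
move=> b s hb s1 s2.
have [hbK b2] : ((K + (8 * M)%N.-1).+1 <= b)%N /\ (2 <= b)%N by move: hb; move: (Num.bound k2) => B; clear -M0; lia.
have bk2 : k2 <= b%:R.
  by apply/ltW/(lt_le_trans (archi_boundP (ltW k20))); rewrite ler_nat (leq_trans _ hb) // leq_addl.
have b0 : (0 < b)%N by exact: ltnW.
have [KL aL] := large_mesh k10 hbK b2 s1.
have qE : (4 * b)%:R ^+ 2 = (16 * b ^ 2)%:R :> R by rewrite -natrX expnMn.
have q0 : 0 < (4 * b)%:R ^+ 2 :> R by rewrite exprn_gt0 // ltr0n muln_gt0.
have s0 : 0 < s by apply: lt_le_trans s1; rewrite divr_gt0.
have s2' : s * (16 * b ^ 2)%:R <= k2 by rewrite -qE -ler_pdivlMr.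
have s01 : 0 < s <= 1.
  rewrite s0 /=; apply: le_trans s2 _; rewrite ler_pdivrMr // mul1r (le_trans bk2) //.
  rewrite -natrX ler_nat expnMn; apply: (@leq_trans (b ^ 2)); last by rewrite leq_pmull.
  by rewrite -mulnn leq_pmulr.
have s01' : 0 <= s <= 1 by case/andP: s01 => _ ->; rewrite ltW.
have nn0 : (n0 <= n)%N by rewrite /n (leq_trans (leqnSn n0)) // leq_pmull.
have H := Hn n b s nn0 b0 s01 s2'.
pose D (u : 'I_g * 'I_g) := wnd b n (8 * M * u.1, 8 * M * u.2)%N (8 * M)%N.
set P := bmean s _.
have Pu u : P <= tc * (s * bmean s (fun O => #|dbl (@cadj b n) block (block @: cT) O :&: D u|%:R)).
  have [t1 e1 w1] := shift_bounds u.1 M0; have [t2 e2 w2] := shift_bounds u.2 M0.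
  apply: le_trans (_ : bmean s (fun O => (twoK (@cadj b n) block (block @: cT) bdist (D u) (8 * M)%N K O)%:R) <= _).
    rewrite /P -(bmean_inj _ _ (@sh_inj b n (2 * n) _ _ b0 t1 t2)).
    apply: ler_bmean => // O; rewrite ler_nat.
    case tw: (twoarm _ _ _) => //; rewrite lt0b.
    exact: (@pull_two b n (2 * n) _ _ b0 t1 t2 O (8 * M * u.1, 8 * M * u.2)%N
      (4 * (2 * n) - 4 * M, 4 * (2 * n) - 4 * M)%N (8 * M)%N (8 * M)%N K e1 e2 w1 w2 tw).
  have E8 : (8 * M)%N = (8 * M)%N.-1.+1 by rewrite prednK // muln_gt0.
  rewrite {1}E8.
  apply: (le_trans (y := tcst (k1 / 32%:R) (8 * M)%N.-1 K *
      (s * bmean s (fun O => #|dbl (@cadj b n) block (block @: cT) O :&: D u|%:R)))).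
    apply: (@twoK_le R _ (@cadj b n) (@cadjC b n) _ block (block @: cT) bdist _ _ (D u) (b * b)) => //.
    - by move=> x y; apply: block_adj.
    - by move=> x y; apply: bdist_adj.
    - by move=> x y r; apply: closer_cell.
  rewrite ler_wpM2r //; first by rewrite mulr_ge0 ?(ltW s0) // bmean_ge0.
  by rewrite /tc lerDl.
have : \sum_(u : 'I_g * 'I_g) P <= tc * (e * n%:R ^+ 2).
  apply: le_trans (_ : tc * (s * bmean s (fun O => #|dbl (@cadj b n) block (block @: cT) O|%:R)) <= _); last first.
    by rewrite ler_wpM2l // ltW.
  apply: le_trans (ler_sum _ (fun u _ => Pu u)) _.
  rewrite -mulr_sumr ler_wpM2l ?(ltW tc0) // -mulr_sumr ler_wpM2l ?(ltW s0) // -bmean_sum.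
  apply: ler_bmean => // O; rewrite -natr_sum ler_nat.
  set A := dbl _ _ _ _.
  rewrite (eq_bigr (fun u => \sum_(x in A) (x \in D u)))%N; last first.
    move=> u _; rewrite -sum1_card (eq_bigl (fun x => (x \in A) && (x \in D u))) => [|x]; last by rewrite in_setI.
    by rewrite big_mkcondr; apply: eq_bigr => x _; case: ifP.
  rewrite exchange_big /= -sum1_card; apply: leq_sum => x _.
  have [/existsP[u xu]|h] := boolP [exists u, x \in D u]; last first.
    rewrite big1 // => u _; move: h; rewrite negb_exists => /forallP/(_ u)/negbTE ->.
    by [].
  rewrite (bigD1 u) //= big1 ?addn0 ?leq_b1 // => v vu.
  apply/eqP; rewrite eqb0; apply: contra vu => xv; apply/eqP.
  move: xu xv; rewrite !inE /= => /andP[/andP[a1 a2] /andP[a3 a4]] /andP[/andP[a5 a6] /andP[a7 a8]].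
  have c0 : (0 < 8 * M)%N by rewrite muln_gt0.
  rewrite [u]surjective_pairing [v]surjective_pairing; congr (_, _); apply: val_inj => /=.
    by rewrite -(div_uniq c0 a1 a2) -(div_uniq c0 a5 a6).
  by rewrite -(div_uniq c0 a3 a4) -(div_uniq c0 a7 a8).
rewrite sumr_const card_prod card_ord -[P *+ _]mulr_natl => h.
rewrite -(ler_pM2l (x := (g * g)%:R)) ?ltr0n ?muln_gt0 //; apply: le_trans h _.
rewrite /e /n natrM le_eqVlt; apply/orP; left; apply/eqP; rewrite natrM; field.
by rewrite pnatr_eq0 -lt0n M0 gt_eqF.
Qed.

End TwoArmDecay.

Local Close Scope ring_scope.

(** * Splitting a crossing at an intermediate box *)

Section CrossSplit.
Context {R : realFieldType}.
Variables (b n N : nat).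
Hypotheses (b0 : 0 < b) (nN : n <= N).

Lemma center_shift : 4 * N - 4 * n + 8 * n <= 8 * N. Proof. by clear b0; lia. Qed.

Let csh : cell b n -> cell b N := sh b0 center_shift center_shift.

Lemma center_cS M : M <= n -> @cS b N M \subset csh @: @cS b n M.
Proof.
move=> Mn; apply/subsetP => x; rewrite inE => /andP[/andP[h1 h2] /andP[h3 h4]].
have e : (4 * N - 4 * n) * b = N * (4 * b) - n * (4 * b).
  by rewrite mulnBl; congr (_ - _); rewrite mulnCA mulnA.
have sd : side b n = n * (4 * b) + n * (4 * b) by rewrite /side; clear; lia.
have h5 : n * (4 * b) <= N * (4 * b) by rewrite leq_mul2r nN orbT.
have h6 : M * (4 * b) <= n * (4 * b) by rewrite leq_mul2r Mn orbT.
have [y yE] : exists y, x = csh y.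
  by apply: sh_onto; rewrite e sd; move: h1 h2 h3 h4 h5 h6;
    move: (N * (4 * b)) (n * (4 * b)) (M * (4 * b)) => *; lia.
rewrite yE; apply: imset_f; rewrite inE; move: h1 h2 h3 h4; rewrite yE /= e.
by move: h5 h6; move: (N * (4 * b)) (n * (4 * b)) (M * (4 * b)) => *; lia.
Qed.

Lemma perc_shrink M (O : {set cell b N}) F : M <= n -> perc cadj (cS M) cT O F ->
  perc cadj (cS M) cT (csh @^-1: O) (pullF b0 center_shift center_shift F).
Proof. by move=> Mn; apply: pull_perc; exact: center_cS. Qed.

(** After its last visit to the inner box [A] a path is within one step of it, at most
    [4 * b + 1 <= 2 * (4 * b)] cells away, hence in [cS M']; from there on it uses neither cells nor
    edges of [A]. *)
Lemma perc_outer M' (O : {set cell b N}) F : n + 2 <= M' -> n + 2 <= N ->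
  perc cadj (cS M') cT O F ->
  perc cadj (cS M') cT (O :\: csh @: [set: cell b n]) (F :\: [set csh @: (e : {set cell b n}) | e in [set: {set cell b n}]]).
Proof.
move=> nM n2N; set A := csh @: _; set E := [set _ | e in _].
have e : (4 * N - 4 * n) * b = N * (4 * b) - n * (4 * b).
  by rewrite mulnBl; congr (_ - _); rewrite mulnCA mulnA.
have sd : side b n = n * (4 * b) + n * (4 * b) by rewrite /side; clear; lia.
have h5 : (n + 2) * (4 * b) <= N * (4 * b) by rewrite leq_mul2r n2N orbT.
have h6 : (n + 2) * (4 * b) <= M' * (4 * b) by rewrite leq_mul2r nM orbT.
have Acoord x : x \in A -> N * (4 * b) <= x.1 + n * (4 * b) /\ x.1 < N * (4 * b) + n * (4 * b) /\
     (N * (4 * b) <= x.2 + n * (4 * b) /\ x.2 < N * (4 * b) + n * (4 * b)).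
  case/imsetP => y _ ->; have := ltn_ord y.1; have := ltn_ord y.2; rewrite /= e.
  move: (nat_of_ord y.1) (nat_of_ord y.2) => i j; rewrite sd; move: h5; rewrite mulnDl.
  by move: (N * (4 * b)) (n * (4 * b)) => *; lia.
have AT x : x \in A -> x \notin cT.
  move/Acoord => [a1 [a2 [a3 a4]]]; rewrite inE negbK.
  have sN : side b N = N * (4 * b) + N * (4 * b) by rewrite /side; clear; lia.
  move: a1 a2 a3 a4 h5; move: (nat_of_ord x.1) (nat_of_ord x.2) => i j; rewrite sN mulnDl.
  have : 5 * b <= 2 * (4 * b) by clear; lia.
  by move: (N * (4 * b)) (n * (4 * b)) (2 * (4 * b)) (5 * b) => *; lia.
have AS x z : x \in A -> cadj x z -> z \in cS M'.
  move/Acoord => [a1 [a2 [a3 a4]]] /cadj_dist[c1 c2 c3 c4]; rewrite inE.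
  move: a1 a2 a3 a4 c1 c2 c3 c4 h6; rewrite mulnDl.
  have : (4 * b).+1 <= 2 * (4 * b) by move: b0; clear; lia.
  move: (nat_of_ord x.1) (nat_of_ord x.2) (nat_of_ord z.1) (nat_of_ord z.2) => i j k l.
  by move: (N * (4 * b)) (n * (4 * b)) (M' * (4 * b)) (2 * (4 * b)) (4 * b) => *; lia.
have sub : reach cadj (cS M') O F \subset A :|: reach cadj (cS M') (O :\: A) (F :\: E).
  apply: reach_min => [x xS xO|x z].
    by rewrite inE; have [//|xA] := boolP (x \in A); rewrite reachS // inE xA.
  rewrite !in_setU => xAr /and4P[xO zO xz eF]; have [//|zA] := boolP (z \in A).
  have zO' : z \in O :\: A by rewrite inE zA.
  case/orP: xAr => [xA|xr]; first by rewrite reachS // (AS x).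
  apply: (reach_step xr); apply/and4P; split => //.
    by apply: (subsetP (reach_sub _ _ _ _)) xr.
  rewrite inE eF andbT; apply/imsetP => -[e' _ eE].
  case/negP: zA; have : z \in csh @: e' by rewrite -eE set22.
  by case/imsetP => y _ ->; apply: imset_f.
case/percP => z zT zr; apply/percP; exists z => //.
by have := subsetP sub z zr; rewrite inE => /orP[/AT|//]; rewrite zT.
Qed.

Local Open Scope ring_scope.

(** The first factor depends only on cells and edges inside the box of half side [n], the second
    only on the others, so they are independent. *)
Lemma cross_split (s p : R) M M' : 0 <= s <= 1 -> 0 <= p <= 1 ->
  (M <= n)%N -> (n + 2 <= M')%N -> (n + 2 <= N)%N ->
  mean2 s p (fun O F => (perc (@cadj b N) (cS M) cT O F)%:R) <=
  mean2 s p (fun O F => (perc (@cadj b n) (cS M) cT O F)%:R) *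
  mean2 s p (fun O F => (perc (@cadj b N) (cS M') cT O F)%:R).
Proof.
move=> s01 p01 Mn nM nN2.
set A := csh @: [set: cell b n]; set E := [set csh @: (e : {set cell b n}) | e in [set: {set cell b n}]].
pose f (O : {set cell b N}) F : R :=
  (perc cadj (cS M) cT (csh @^-1: O) (pullF b0 center_shift center_shift F))%:R.
pose g (O : {set cell b N}) F : R := (perc cadj (cS M') cT (O :\: A) (F :\: E))%:R.
have cI : injective csh by exact: sh_inj.
apply: le_trans (_ : mean2 s p (fun O F => f O F * g O F) <= _).
  apply: ler_mean2 => // O F; rewrite /f /g -natrM ler_nat.
  case pe: (perc _ _ _ _ _) => //; rewrite perc_shrink // perc_outer //.
  apply/percP; case/percP: pe => z zT zr; exists z => //.
  move: zr; rewrite !in_reach => /exists_inP[x]; rewrite inE => /andP[xS xO] c.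
  apply/exists_inP; exists x => //; rewrite inE xO andbT; move: xS; rewrite !inE.
  have h : (M * (4 * b) <= M' * (4 * b))%N by rewrite leq_mul2r orbC (leq_trans Mn) // (leq_trans _ nM) // leq_addr.
  move: h; move: (N * _)%N (M * _)%N (M' * _)%N => *; lia.
rewrite (@mean2_indep _ _ s p A E) => [|O F|O F]; last 2 first.
- have e1 : csh @^-1: (O :&: A) = csh @^-1: O.
    by apply/setP => x; rewrite !inE [csh x \in A]imset_f ?andbT.
  have e2 : pullF b0 center_shift center_shift (F :&: E) = pullF b0 center_shift center_shift F.
    by apply/setP => x; rewrite !inE [_ @: x \in E]imset_f ?andbT.
  by rewrite /f e1 e2.
- by rewrite /g !setDDl !setUid.
apply: ler_pM; rewrite ?mean2_ge0 //.
  by rewrite /f (mean2_inj _ _ (fun O F => (perc cadj (cS M) cT O F)%:R) cI).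
apply: ler_mean2 => // O F; rewrite /g ler_nat.
by case pe: (perc _ _ _ _ _) => //; rewrite lt0b; apply: perc_mono pe; exact: subsetDl.
Qed.

End CrossSplit.

Local Open Scope ring_scope.

(** * Small densities do not percolate *)

Section Subcritical.

Lemma card_bd (V : finType) (adj : rel V) (S X : {set V}) D :
  (forall x, #|[set y | adj x y]| <= D)%N -> (#|bd adj S X| <= #|S| + #|X| * D)%N.
Proof.
move=> hD; apply: leq_trans (_ : #|S :|: \bigcup_(x in X) [set y | adj x y]| <= _)%N.
  apply/subset_leq_card/subsetP => y; rewrite !inE => /orP[->//|/exists_inP[x xX xy]].
  by apply/orP; right; apply/bigcupP; exists x; rewrite ?inE.
apply: leq_trans (leq_card_setU _ _) _; rewrite leq_add2l.
apply: (@leq_trans (\sum_(x in X) #|[set y | adj x y]|)).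
  elim/big_rec2: _ => [|x k B _ h]; first by rewrite cards0.
  by rewrite (leq_trans (leq_card_setU _ _)) // leq_add2l.
by rewrite -sum_nat_const; apply: leq_sum.
Qed.

(** [2 ^+ i * (1 + s) ^- t] is a martingale of the exploration: the mean factor of one step,
    [2 * s + (1 - s)], is cancelled by [(1 + s)^-1]. As the boundary of [k] vertices has at most
    [#|S| + k * D] elements, this is an exponential moment of the cluster size. *)
Lemma rc_tail (R : realFieldType) (V : finType) (adj : rel V) (S : {set V}) D l (s r : R) :
  (forall x, #|[set y | adj x y]| <= D)%N -> 0 <= s <= 1 -> 1 <= r -> r * (1 + s) ^+ D <= 2 ->
  r ^+ l * bmean s (fun O => (l <= #|rc adj S O|)%N%:R) <= (1 + s) ^+ #|S|.
Proof.
move=> hD s01 r1 hr; have /andP[s0 s1] := s01.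
have t1 : 1 <= 1 + s by lra.
have t0 : 0 < 1 + s by lra.
have := @explore_supermart _ adj R s (fun i t => 2 ^+ i * (1 + s) ^- t) S s01.
rewrite expr0 mul1r expr0 invr1 => h.
rewrite -bmeanZ -[leRHS]mulr1.
apply: le_trans (_ : (1 + s) ^+ #|S| * bmean s (fun O => 2 ^+ #|rc adj S O| * (1 + s) ^- #|bd adj S (rc adj S O)|) <= _).
  rewrite -bmeanZ; apply: ler_bmean => // O.
  set k := #|rc adj S O|; set t := #|bd _ _ _|.
  have ht : (t <= #|S| + k * D)%N by exact: card_bd.
  apply: le_trans (_ : r ^+ k <= _).
    case: leqP => lk; rewrite ?mulr1 ?mulr0; last by rewrite exprn_ge0 //; lra.
    by rewrite ler_weXn2l.
  rewrite mulrCA; apply: le_trans (_ : 2 ^+ k * (1 + s) ^- (k * D) <= _).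
    rewrite ler_pdivlMr ?exprn_gt0 // [(k * D)%N]mulnC exprM -exprMn.
    by apply: lerXn2r => //; rewrite nnegrE ?mulr_ge0 ?exprn_ge0 ?ler0n //; lra.
  rewrite ler_wpM2l ?exprn_ge0 // ler_pdivlMr ?exprn_gt0 // mulrC ler_pdivrMr ?exprn_gt0 //.
  by rewrite -exprD ler_weXn2l.
rewrite ler_wpM2l ?exprn_ge0 ?(ltW t0) //; apply: h => i t.
rewrite le_eqVlt; apply/orP; left; apply/eqP.
rewrite !exprS; field.
by rewrite !gt_eqF ?exprn_gt0.
Qed.

Definition off (n i : nat) := (maxn i (4 * n) - minn i (4 * n))%N.
Definition height n (z : cell 1 n) := maxn (off n z.1) (off n z.2).

(** At [b = 1] a step changes the height by at most 5, so a crossing has a cell in every layer of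
    thickness 5 that it passes. *)
Lemma perc_long n M l (O : {set cell 1 n}) : (M + 5 * l + 5 <= n)%N ->
  perc cadj (cS M) cT O [set: _] -> (l <= #|rc cadj (cS M) O|)%N.
Proof.
move=> hn /percP[t tT tr]; rewrite -/(rc _ _ _) in tr.
pose phi (z : cell 1 n) := ((height z - 4 * M) %/ 5)%N.
have step x z : cadj x z -> (phi z <= phi x + 1)%N.
  move=> /cadj_dist[h1 h2 h3 h4].
  have h : (height z <= height x + 5)%N.
    rewrite /height /off; move: h1 h2 h3 h4.
    move: (nat_of_ord x.1) (nat_of_ord x.2) (nat_of_ord z.1) (nat_of_ord z.2) => i j k m; lia.
  by rewrite /phi addnC -divnMDl // leq_div2r // mul1n; move: h; clear; lia.
have pS x : x \in cS M -> phi x = 0%N.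
  rewrite inE /phi /height /off => /andP[/andP[h1 h2] /andP[h3 h4]].
  apply: divn_small; move: h1 h2 h3 h4; rewrite !muln1.
  by move: (nat_of_ord x.1) (nat_of_ord x.2) => i j; lia.
have pT : (l <= phi t)%N.
  rewrite /phi leq_divRL //; move: tT; rewrite inE /height /off.
  by move: hn; move: (nat_of_ord t.1) (nat_of_ord t.2) => i j hn; rewrite sideE; lia.
have all j : (0 < j <= l)%N -> exists2 z, z \in rc cadj (cS M) O & phi z = j.
  move=> /andP[j0 jl].
  have [/exists_inP[z zr /eqP zj]|h] := boolP [exists z in rc cadj (cS M) O, phi z == j]; first by exists z.
  suff /subsetP/(_ t tr) : rc cadj (cS M) O \subset [set z in rc cadj (cS M) O | phi z < j]%N.
    by rewrite inE tr /= ltnNge (leq_trans jl pT).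
  apply: rc_min => [x xS xO|x z]; rewrite !inE; first by rewrite rcS // pS.
  move=> /andP[xr xj] xz zO; have zr := rc_step xr xz zO; rewrite zr /=.
  have zj : phi z != j by apply: contra h => zj; apply/exists_inP; exists z.
  by rewrite ltn_neqAle zj (leq_trans (step _ _ xz)) // addn1.
rewrite cardE -(size_map phi) -[leqLHS](size_iota 1).
apply: uniq_leq_size (iota_uniq _ _) _ => j; rewrite mem_iota => /andP[j0 jl].
have [|z zr zj] := all j; first by rewrite j0 -ltnS -(add1n l).
by apply/mapP; exists z; rewrite ?mem_enum.
Qed.

(** A cell has at most [121 = 11 ^ 2] neighbours at [b = 1], and [(1 + s) ^+ 121 <= e^(1/3) <= 3/2]
    permits the rate [r = 4/3] in [rc_tail]. *)
Lemma subcritical_decay (R : realType) (s : R) M (c : R) : 0 <= s -> s * 121 <= 3^-1 -> 0 < c ->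
  exists2 n, (M <= n)%N & bmean s (fun O => (perc (@cadj 1 n) (cS M) cT O [set: _])%:R) < c.
Proof.
move=> s0 hs c0.
have s01 : 0 <= s <= 1 by rewrite s0; lra.
have s2 : 1 + s <= 2 by lra.
have s3 : 0 <= 1 + s by lra.
have hr : 4 / 3 * (1 + s) ^+ 121 <= 2.
  have e1 : (1 + s) ^+ 121 <= expR (s * 121).
    by rewrite expRM_natr; apply: lerXn2r; rewrite ?nnegrE ?expR_ge0 ?expR_ge1Dx //; lra.
  have e2 : expR (s * 121) * (1 - 3^-1) <= 1.
    apply: le_trans (ler_wpM2l (expR_ge0 _) (_ : _ <= expR (- (s * 121)))) _; last by rewrite -expRD subrr expR0.
    by apply: le_trans (expR_ge1Dx _); lra.
  by move: ((1 + s) ^+ 121) (expR (s * 121)) e1 e2 => u v; clear; lra.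
have r1 : 1 <= 4 / 3 :> R by lra.
pose K : R := 2 ^+ ((4 * M + (4 * M).+1) ^ 2).
have K0 : 0 < K by rewrite exprn_gt0.
pose l := Num.bound (3 * K / c).
have lc : K < c * (4 / 3) ^+ l.
  have bern k : 1 + k%:R / 3 <= (4 / 3) ^+ k :> R.
    elim: k => [|k IH]; first by rewrite mul0r addr0.
    rewrite exprS; apply: le_trans (ler_wpM2l _ IH); last lra.
    have : 0 <= k%:R :> R by []. by rewrite -natr1; lra.
  have : 3 * K / c < l%:R by apply: archi_boundP; rewrite divr_ge0 ?mulr_ge0 ?ltW.
  rewrite ltr_pdivrMr // => h; have := ler_wpM2l (ltW c0) (bern l); lra.
exists (M + 5 * l + 5)%N; first by rewrite -addnA leq_addr.
set n := (M + 5 * l + 5)%N.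
have deg (x : cell 1 n) : (#|[set y | cadj x y]| <= 121)%N.
  apply: (@card_window2 _ x.1 x.2 5) => y; rewrite inE => /cadj_dist[].
  by split.
have := @rc_tail R _ (@cadj 1 n) (cS M) 121 l s (4 / 3) deg s01 r1 hr.
set P := bmean s _ => h1 {hr hs}.
have h2 : (1 + s) ^+ #|@cS 1 n M| <= K.
  apply: (le_trans (lerXn2r _ _ _ s2)); rewrite ?nnegrE //.
  rewrite ler_weXn2l ?ler1n //; apply: (@card_window2 _ (4 * n) (4 * n)) => x.
  by rewrite inE !muln1 => /andP[/andP[? ?] /andP[? ?]]; split; rewrite ![(4 * _)%N]mulnC // ltnW.
apply: le_lt_trans (_ : _ <= P) _.
  apply: ler_bmean => // O; rewrite ler_nat; case pe: (perc _ _ _ _ _) => //.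
  by rewrite lt0b; apply: perc_long pe.
have r0 : 0 < (4 / 3) ^+ l :> R by rewrite exprn_gt0 // divr_gt0.
rewrite -(ltr_pM2l r0); apply: le_lt_trans (le_trans h1 h2) _; by rewrite mulrC.
Qed.

End Subcritical.

From mathcomp Require Import finmap.
From mathcomp Require Import all_classical all_reals all_analysis.
Require Import Defs.
Import Order.TTheory GRing.Theory Num.Theory.
Import numFieldNormedType.Exports.
Local Open Scope classical_set_scope.
Local Open Scope ring_scope.

(** * Exchanging sites for bonds *)

Section Russo.
Context {R : realType}.

Lemma is_derive_fsum (J : finType) (h : J -> R -> R) (dh : J -> R) (t : R) :
  (forall j, is_derive t 1 (h j) (dh j)) ->
  is_derive t 1 (fun x => \sum_j h j x) (\sum_j dh j).
Proof.
move=> hd; have -> : (fun x => \sum_j h j x) = \sum_j h j.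
  by apply/funext => x; rewrite fct_sumE.
by elim/big_ind2 : _ => // [|? ? ? ? ? ?]; [exact: is_derive_cst|exact: is_deriveD].
Qed.

Section Weight.
Context {I : finType}.
Implicit Type X : {set I}.

Definition dbweight (u : R) X : R :=
  #|X|%:R * u ^+ #|X|.-1 * (1 - u) ^+ #|~: X| - #|~: X|%:R * u ^+ #|X| * (1 - u) ^+ #|~: X|.-1.

Lemma is_derive_bweight (u : R -> R) (du t : R) X : is_derive t 1 u du ->
  is_derive t 1 (fun x => bweight (u x) X) (dbweight (u t) X * du).
Proof.
move=> ud; have -> : (fun x => bweight (u x) X) = u ^+ #|X| * (cst 1 - u) ^+ #|~: X|.
  by apply/funext => x; rewrite bweightE /GRing.mul /= !exprfctE.
have u1 : is_derive t 1 (cst 1 - u) (0 - du) by exact: is_deriveB.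
have := is_deriveM (is_deriveX #|X| ud) (is_deriveX #|~: X| u1).
move=> h; apply: (is_derive_eq h); rewrite /dbweight !exprfctE /= /GRing.scale /=.
have -> : (cst 1 - u) t = 1 - u t by [].
by ring.
Qed.

Lemma dbweightE (u : R) X : 0 < u < 1 ->
  dbweight u X * u = bweight u X * (#|X|%:R - #|~: X|%:R * (u / (1 - u))).
Proof.
move=> /andP[u0 u1]; rewrite /dbweight bweightE.
have v0 : 1 - u != 0 by rewrite subr_eq0 eq_sym lt_eqF.
case: #|X| => [|a]; case: #|~: X| => [|b] /=; rewrite ?exprS ?expr0; field => //.
Qed.

(** Russo's formula for the logarithmic derivative: exchanging the state of [i] turns [u / (1 - u)]
    times the term of an absent [i] into the term [f (X :\ i)] of a present one. Only present
    pivotal elements are counted. *)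
Lemma bmean_russo (u : R) (f : {set I} -> R) : 0 < u < 1 ->
  bmean u (fun X => (#|X|%:R - #|~: X|%:R * (u / (1 - u))) * f X) =
  bmean u (fun X => \sum_(i in X) (f X - f (X :\ i)%SET)).
Proof.
move=> /andP[u0 u1]; have v0 : 1 - u != 0 by rewrite subr_eq0 eq_sym lt_eqF.
rewrite [RHS](_ : _ = bmean u (fun X => \sum_i ((i \in X)%:R * f X - (i \in X)%:R * f (X :\ i)%SET))); last first.
  apply: bmean_eq => X; rewrite big_mkcond; apply: eq_bigr => i _.
  by case: (i \in X); rewrite ?mul1r ?mul0r ?subrr.
rewrite bmean_sum; under eq_bigr => i _.
  rewrite bmeanB (_ : bmean _ (fun X => _ * f (X :\ i)%SET) =
     u / (1 - u) * bmean u (fun X => (i \notin X)%:R * f X)).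
  over.
    rewrite (bmean_in u i (fun X => f (X :\ i)%SET)) bmean_notin mulrA divfK //.
    congr (_ * _); apply: bmean_eq => X; congr f.
    by apply/setP => j; rewrite !inE; case: eqP.
rewrite sumrB -mulr_sumr -!bmean_sum -bmeanZ -bmeanB; apply: bmean_eq => X.
rewrite !natr_card mulrBl !mulr_suml; congr (_ - _).
rewrite mulr_sumr; apply: eq_bigr => i _; rewrite inE.
by rewrite mulrAC mulrC.
Qed.

End Weight.

Section Curve.
Context {V : finType}.
Variables (adj : rel V) (S T : {set V}).
Local Notation perc := (perc adj S T).

Definition theta (s p : R) := mean2 s p (fun O F => (perc O F)%:R).

Lemma sum_piv (O : {set V}) (F : {set {set V}}) : \sum_(i in O) ((perc O F)%:R - (perc (O :\ i)%SET F)%:R) =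
  #|piv adj S T O F|%:R :> R.
Proof.
rewrite natr_card big_mkcond; apply: eq_bigr => i _; rewrite inE.
case: (i \in O) => //=; have [pi|_] := boolP (perc (O :\ i)%SET F).
  by rewrite (perc_mono _ _ pi) ?subrr // subsetDl.
by rewrite subr0 andbT.
Qed.

Lemma sum_pive (O : {set V}) (F : {set {set V}}) : \sum_(e in F) ((perc O F)%:R - (perc O (F :\ e)%SET)%:R) =
  #|pive adj S T O F|%:R :> R.
Proof.
rewrite natr_card big_mkcond; apply: eq_bigr => i _; rewrite inE.
case: (i \in F) => //=; have [pi|_] := boolP (perc O (F :\ i)%SET).
  by rewrite (perc_mono _ _ pi) ?subrr // subsetDl.
by rewrite subr0 andbT.
Qed.

Lemma is_derive_theta (s p : R -> R) (ds dp t : R) :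
  is_derive t 1 s ds -> is_derive t 1 p dp ->
  is_derive t 1 (fun x => theta (s x) (p x))
   (\sum_(O : {set V}) (bweight (s t) O * (\sum_(F : {set {set V}}) dbweight (p t) F * dp * (perc O F)%:R) +
      bmean (p t) (fun F => (perc O F)%:R) * (dbweight (s t) O * ds))).
Proof.
move=> sd pd; apply: is_derive_fsum => O.
have d1 := is_derive_bweight O sd.
have d2 : is_derive t 1 (fun x => bmean (p x) (fun F => (perc O F)%:R))
   (\sum_(F : {set {set V}}) dbweight (p t) F * dp * (perc O F)%:R).
  apply: is_derive_fsum => F.
  have := is_deriveM (is_derive_bweight F pd) (is_derive_cst ((perc O F)%:R : R) t 1).
  by move=> h; apply: (is_derive_eq h); rewrite /GRing.scale /= mulr0 add0r mulrC.
exact: (is_deriveM d1 d2).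
Qed.

(** Derivatives proportional to [s] and [p] themselves are what the logarithmic form of Russo's
    formula requires; this is why the curve of [theta_curve] is exponential. *)
Lemma theta_russo (s p a b : R) : 0 < s < 1 -> 0 < p < 1 ->
  \sum_(O : {set V}) (bweight s O * (\sum_(F : {set {set V}}) dbweight p F * (b * p) * (perc O F)%:R) +
      bmean p (fun F => (perc O F)%:R) * (dbweight s O * (a * s))) =
  a * mean2 s p (fun O F => #|piv adj S T O F|%:R) +
  b * mean2 s p (fun O F => #|pive adj S T O F|%:R).
Proof.
move=> s01 p01; rewrite big_split /= addrC; congr (_ + _).
  transitivity (a * bmean s (fun O => (#|O|%:R - #|~: O|%:R * (s / (1 - s))) *
       bmean p (fun F => (perc O F)%:R))).
    rewrite {2}/bmean mulr_sumr; apply: eq_bigr => O _.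
    rewrite [bweight s O * (_ * _)]mulrA -dbweightE //.
    by move: (bmean _ _) (dbweight _ _) => ? ?; ring.
  congr (_ * _); rewrite bmean_russo //; apply: bmean_eq => O.
  under eq_bigr do rewrite -bmeanB.
  rewrite -bmean_sum; apply: bmean_eq => F; exact: sum_piv.
rewrite -mean2Z; apply: eq_bigr => O _; congr (_ * _).
transitivity (b * bmean p (fun F => (#|F|%:R - #|~: F|%:R * (p / (1 - p))) * (perc O F)%:R)).
  rewrite /bmean mulr_sumr; apply: eq_bigr => F _.
  rewrite [bweight p F * (_ * _)]mulrA -dbweightE //.
  by move: (dbweight _ _) => ?; ring.
by rewrite bmean_russo // -bmeanZ; apply: bmean_eq => F; rewrite sum_pive.
Qed.

End Curve.

(** [H] is nondecreasing: its derivative is a positive factor times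
    [e + b - (1 + c) * q + 2 * c * th], and [q <= e] by [card_pive] reduces its sign to the
    hypothesis on [solo] and [blob]. *)
Lemma theta_curve (V : finType) (adj : rel V) (S T : {set V}) (s p c tau : R) :
  irreflexive adj -> 0 <= c -> 0 <= tau -> 0 < s -> s * expR tau <= 1 -> 0 < p <= 1 ->
  (forall s' p', s <= s' -> s' <= s * expR tau -> s' < 1 ->
     p * expR (- (1 + c) * tau) <= p' -> p' < p ->
     c * mean2 s' p' (fun O F => #|solo adj S T O F|%:R) <=
     mean2 s' p' (fun O F => #|blob adj S T O F|%:R) + 2 * c * theta adj S T s' p') ->
  theta adj S T s p <= expR (2 * c * tau) * theta adj S T (s * expR tau) (p * expR (- (1 + c) * tau)).
Proof.
move=> adjxx c0 tau0 s0 stau /andP[p0 p1] hyp.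
pose sf (x : R) : R := s * expR x.
pose pf (x : R) : R := p * expR (- (1 + c) * x).
pose H (x : R) : R := expR (2 * c * x) * theta adj S T (sf x) (pf x).
have dlin (k x : R) : is_derive x 1 (fun y => expR (k * y) : R) (k * expR (k * x)).
  have := @is_derive1_comp _ expR ( *%R k) x _ _ (is_derive_expR _) (is_deriveZ k (is_derive_id x 1)).
  by move=> h; apply: (is_derive_eq h); rewrite /GRing.scale /= mulr1 mulrC.
have dsf (x : R) : is_derive x 1 sf (1 * sf x).
  have := is_deriveZ s (is_derive_expR x); move=> h; apply: (is_derive_eq h).
  by rewrite mul1r.
have dpf (x : R) : is_derive x 1 pf (- (1 + c) * pf x).
  have := is_deriveZ p (dlin (- (1 + c)) x); move=> h; apply: (is_derive_eq h).
  by rewrite /pf /GRing.scale /=; ring.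
have dth (x : R) := is_derive_theta adj S T (dsf x) (dpf x).
have dH (x : R) := is_deriveM (dlin (2 * c) x) (dth x).
have -> : theta adj S T s p = H 0.
  by rewrite /H /sf /pf !mulr0 !expR0 !mulr1 mul1r.
have -> : expR (2 * c * tau) * theta adj S T (s * expR tau) (p * expR (- (1 + c) * tau)) = H tau by [].
have dHd (x : R) : derivable H x 1 by case: (dH x).
apply: (@ger0_derive1_le_cc _ H 0 tau) => //.
- move=> x; rewrite in_itv /= => /andP[x0 xt].
  rewrite derive1E; have [_ ->] := dH x.
  have sx : 0 < sf x < 1.
    rewrite mulr_gt0 ?expR_gt0 //=; apply: lt_le_trans stau.
    by rewrite ltr_pM2l // ltr_expR.
  have px : 0 < pf x < 1.
    rewrite mulr_gt0 ?expR_gt0 //=; apply: lt_le_trans p1.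
    by rewrite gtr_pMr // expR_lt1 pmulr_llt0 // oppr_lt0; lra.
  rewrite theta_russo // /GRing.scale /=.
  have [sx0 sx1] := andP sx; have [px0 px1] := andP px.
  have sx01 : 0 <= sf x <= 1 by rewrite !ltW.
  have px01 : 0 <= pf x <= 1 by rewrite !ltW.
  have h1 : c * mean2 (sf x) (pf x) (fun O F => #|solo adj S T O F|%:R) <=
     mean2 (sf x) (pf x) (fun O F => #|blob adj S T O F|%:R) + 2 * c * theta adj S T (sf x) (pf x).
    apply: hyp => //.
    - by rewrite /sf; apply: ler_peMr; [exact: ltW|rewrite -expR0 ler_expR ltW].
    - by rewrite /sf ler_pM2l // ler_expR ltW.
    - rewrite /pf ler_pM2l // ler_expR ler_wnM2l ?ltW //; lra.
    - by rewrite /pf gtr_pMr // expR_lt1 pmulr_llt0 // oppr_lt0; lra.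
  have h2 : mean2 (sf x) (pf x) (fun O F => #|pive adj S T O F|%:R) <=
            mean2 (sf x) (pf x) (fun O F => #|solo adj S T O F|%:R) :> R.
    by apply: ler_mean2 => // O F; rewrite ler_nat card_pive.
  have h3 : mean2 (sf x) (pf x) (fun O F => #|piv adj S T O F|%:R) =
            mean2 (sf x) (pf x) (fun O F => #|solo adj S T O F|%:R) +
            mean2 (sf x) (pf x) (fun O F => #|blob adj S T O F|%:R) :> R.
    rewrite -mean2D; apply: bmean_eq => O; apply: bmean_eq => F.
    have sub1 : solo adj S T O F \subset piv adj S T O F by apply/fintype.subsetP => y; rewrite inE => /andP[].
    rewrite -natrD /blob cardsD (finset.setIidPr sub1) addnC subnK //.
    exact: subset_leq_card.
  rewrite h3; set e := mean2 _ _ (fun O F => #|solo _ _ _ _ _|%:R) in h1 h2 h3 *.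
  set b := mean2 _ _ (fun O F => #|blob _ _ _ _ _|%:R) in h1 h3 *.
  set q := mean2 _ _ (fun O F => #|pive _ _ _ _ _|%:R) in h2 *.
  set th := theta _ _ _ _ _ in h1 *.
  have E0 : 0 < expR (2 * c * x) by exact: expR_gt0.
  have -> : expR (2 * c * x) * (1 * (e + b) + - (1 + c) * q) + th * (2 * c * expR (2 * c * x)) =
    expR (2 * c * x) * (e + b - (1 + c) * q + 2 * c * th) by ring.
  apply: mulr_ge0; first exact: ltW.
  have : (1 + c) * q <= (1 + c) * e by apply: ler_wpM2l => //; lra.
  lra.
- apply: continuous_subspaceT => x.
  exact/differentiable_continuous/derivable1_diffP.
- by rewrite in_itv /= lexx.
- by rewrite in_itv /= lexx andbT.
Qed.

End Russo.

(** * Finite families of independent events as random sets *)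

Section Pattern.
Context {R : realType} d {Omega : measurableType d} (P : probability Omega R).
Context {I : finType}.
Variable A : I -> set Omega.
Hypothesis mA : forall i, measurable (A i).

Definition patt (w : Omega) : {set I} := [set i | `[< A i w >]]%SET.

Lemma in_patt w i : (i \in patt w) <-> A i w.
Proof. by rewrite inE; split => [/asboolP|?]; last exact/asboolP. Qed.

Lemma measurable_patt (f : pred {set I}) : measurable [set w | f (patt w)].
Proof.
have m1 (X : {set I}) : measurable [set w | patt w = X].
  have -> : [set w | patt w = X] = \bigcap_(i in [set: I]) (if i \in X then A i else ~` A i).
    apply/seteqP; split => [w /= <- i _|w /= h].
      case: ifPn => [/in_patt //|iX Ai]; move/negP: iX; apply.
      exact/in_patt.
    apply/setP => i; have := h i Logic.I; case: ifPn => [iX Ai|iX nAi].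
      exact/in_patt.
    by apply/negP => /in_patt.
  apply: fin_bigcap_measurable => [|i _]; first exact: finite_finset.
  by case: ifPn => // _; apply: measurableC.
have -> : [set w | f (patt w)] = \bigcup_(X in [set X : {set I} | f X]) [set w | patt w = X].
  by apply/seteqP; split => [w fw|w [X /= fX wX]]; [exists (patt w)|rewrite /= wX].
apply: fin_bigcup_measurable => [|X _]; last exact: m1.
exact: finite_finset.
Qed.

Definition pattc (X : {set I}) : R := fine (P [set w | patt w = X]).

Lemma patt_prob (f : pred {set I}) :
  P [set w | f (patt w)] = (\sum_X pattc X * (f X)%:R)%:E.
Proof.
have m1 (X : {set I}) : measurable [set w | patt w = X].
  have := measurable_patt (pred1 X); congr (measurable _).
  by apply/seteqP; split => w /= /eqP.
pose U : set {set I} := [set X | f X].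
have fU : finite_set U by exact: finite_finset.
have -> : [set w | f (patt w)] = \bigcup_(X in U) [set w | patt w = X].
  by apply/seteqP; split => [w fw|w [X /= fX wX]]; [exists (patt w)|rewrite /= wX].
rewrite measure_fin_bigcup //; last by move=> X Y _ _ [w [/= <- <-]].
rewrite fsbig_finite //= -sumEFin.
transitivity (\sum_(X <- fset_set U) (pattc X)%:E)%E.
  by apply: eq_bigr => X _; rewrite /pattc fineK // fin_num_measure.
transitivity (\sum_(X : {set I} | f X) (pattc X)%:E)%E.
  rewrite -[RHS]big_filter; apply: perm_big; apply: uniq_perm; rewrite ?filter_uniq ?index_enum_uniq // => X.
  rewrite in_fset_set // mem_filter mem_index_enum andbT; apply/idP/idP; rewrite inE //.
rewrite big_mkcond; apply: eq_bigr => X _.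
by case: (f X); rewrite ?mulr1 ?mulr0.
Qed.

(** Empty events outside [J] amount to intersecting with [J]. Inside [J] the law is identified from
    probabilities of intersections, the form in which independence is given in [site_no_perc] and
    [bond_no_perc]. *)
Lemma patt_indep (p : R) (J : {set I}) (f : {set I} -> R) :
  (forall i, i \notin J -> A i = set0) ->
  (forall D : {set I}, D \subset J -> P (\bigcap_(i in [set` D]) A i) = (p ^+ #|D|)%:E) ->
  \sum_X pattc X * f X = bmean p (fun F => f (F :&: J)%SET).
Proof.
move=> AJ h; pose c X := \sum_(F : {set I} | (F :&: J)%SET == X) bweight p F.
have -> : bmean p (fun F => f (F :&: J)%SET) = \sum_X c X * f X.
  rewrite /bmean (partition_big (fun F => (F :&: J)%SET) xpredT) //=.
  apply: eq_bigr => X _; rewrite /c mulr_suml; apply: eq_bigr => F /eqP ->.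
  by [].
apply: eq_bigr => X _; congr (_ * _); apply: upsum_inj => {}X {f} /=; rename X into D.
have -> : \sum_(X : {set I} | D \subset X) pattc X = fine (P [set w | D \subset patt w]).
  rewrite (patt_prob (fun X : {set I} => D \subset X)) /= big_mkcond; apply: eq_bigr => X _.
  by case: (D \subset X); rewrite ?mulr1 ?mulr0.
have -> : \sum_(X : {set I} | D \subset X) c X = bmean p (fun F => (D \subset (F :&: J)%SET)%:R).
  rewrite /bmean [RHS](partition_big (fun F => (F :&: J)%SET) xpredT) //= [LHS]big_mkcond.
  apply: eq_bigr => X _; case: ifPn => DX.
    by rewrite /c; apply: eq_bigr => F /eqP ->; rewrite DX mulr1.
  by rewrite big1 // => F /eqP ->; rewrite (negbTE DX) mulr0.
have [DJ|DJ] := boolP (D \subset J); last first.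
  rewrite (@bmean_eq _ _ _ _ (fun=> 0)) ?bmean_cst => [|F]; last first.
    by rewrite finset.subsetI (negbTE DJ) andbF.
  have [i iD iJ] := fintype.subsetPn DJ.
  rewrite (_ : [set w | _] = set0) ?measure0 //.
  by apply/seteqP; split => // w /fintype.subsetP/(_ i iD)/in_patt; rewrite AJ.
rewrite (@bmean_eq _ _ _ _ (fun F => (D \subset F)%:R)) => [|F]; last by rewrite finset.subsetI DJ andbT.
rewrite bmean_sub; have := h D DJ => e.
rewrite (_ : [set w | _] = \bigcap_(i in [set` D]) A i) ?e //.
apply/seteqP; split => [w /fintype.subsetP hw i iD|w hw].
  exact/in_patt/hw.
by apply/fintype.subsetP => i iD; apply/in_patt/hw.
Qed.

End Pattern.

(** * Discretisation of the Gilbert graph *)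

Section Points.
Context {R : realType}.
Local Notation pt := (pt R).
Local Notation gadj := (@gadj R).
Implicit Types (V : set pt) (E : pt -> pt -> Prop) (x y z : pt) (b n M : nat).

Definition box (n : nat) : set pt :=
  [set x | (- n%:R <= x.1 < n%:R) && (- n%:R <= x.2 < n%:R)].
(** The margin 5/4 is [5 * b] cells of side [1 / (4 * b)], matching [cT]; it exceeds the range 1 of
    an edge, so no edge from [inner n] leaves the box. *)
Definition inner (n : nat) : set pt :=
  [set x | (- n%:R + 5 / 4 <= x.1 < n%:R - 5 / 4) && (- n%:R + 5 / 4 <= x.2 < n%:R - 5 / 4)].
Definition win V n : set pt := V `&` box n.
Definition locfin V := forall B : set pt, bounded2 B -> finite_set (V `&` B).
Definition pcross M n V E := exists x y, [/\ box M x, gconn (win V n) E x y & ~ inner n y].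

Lemma walk_rcons E x s y z : walk E x s y -> E y z -> walk E x (rcons s z) z.
Proof. by elim: s x => [x <-|w s IH x [? ?] ?] /=; split => //; apply: IH. Qed.

Lemma gconn_step V E x y z : gconn V E x y -> V z -> E y z -> gconn V E x z.
Proof.
move=> [xV [s [sV w]]] zV yz; split => //; exists (rcons s z); split; last exact: walk_rcons w yz.
by move=> u; rewrite mem_rcons inE => /orP[/eqP->|/sV//]; exact/mem_set.
Qed.

Lemma gconn_refl V E x : V x -> gconn V E x x.
Proof. by move=> xV; split; [exact/mem_set|exists [::]]. Qed.

Lemma gconn_ind V E (P : pt -> Prop) x y : P x -> (forall u v, V u -> V v -> P u -> E u v -> P v) ->
  gconn V E x y -> P y.
Proof.
move=> Px st [/set_mem xV [s [sV w]]]; elim: s x xV Px sV w => [x xV Px _ <-//|u s IH x xV Px sV /= [xu w]].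
have uV : V u by apply/set_mem/sV; rewrite mem_head.
by apply: (IH u) => // [|v vs]; [exact: st xu|apply: sV; rewrite inE vs orbT].
Qed.

Lemma gconnP V E x y : gconn V E x y -> V x /\ V y.
Proof.
move=> g; have xV : V x by case: g => /set_mem.
by split => //; apply: (gconn_ind (P := V)) g.
Qed.

Lemma bounded_box n : bounded2 (box n).
Proof.
exists n%:R => x /andP[/andP[? ?] /andP[? ?]].
by rewrite !ler_norml; split; apply/andP; split => //; exact: ltW.
Qed.

Lemma box_mono m n : (m <= n)%N -> box m `<=` box n.
Proof.
move=> mn x /andP[/andP[h1 h2] /andP[h3 h4]]; have k : m%:R <= n%:R :> R by rewrite ler_nat.
by apply/andP; split; apply/andP; split; lra.
Qed.

Lemma box_cover x : exists n, box n x.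
Proof.
exists (Num.bound (`|x.1| + `|x.2|)).+1.
have := archi_boundP (addr_ge0 (normr_ge0 x.1) (normr_ge0 x.2)).
set N := Num.bound _ => h; have := ler_norm x.1; have := ler_norm x.2.
have := ler_norm (- x.1); have := ler_norm (- x.2); rewrite !normrN.
have := normr_ge0 x.1; have := normr_ge0 x.2; rewrite /box /= -natr1 => *.
by apply/andP; split; apply/andP; split; lra.
Qed.

Lemma inner_box n : inner n `<=` box n.
Proof. by move=> x /andP[/andP[? ?] /andP[? ?]]; apply/andP; split; apply/andP; split; lra. Qed.

Lemma sq_le1 (u v : R) : u ^+ 2 + v ^+ 2 <= 1 -> -1 <= u <= 1.
Proof. by move=> h; apply/andP; split; nra. Qed.

Lemma inner_step n x y : inner n x -> gadj x y -> box n y.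
Proof.
move=> /andP[/andP[h1 h2] /andP[h3 h4]] [_ d].
have /andP[a1 a2] := sq_le1 d; rewrite addrC in d; have /andP[a3 a4] := sq_le1 d.
by apply/andP; split; apply/andP; split; lra.
Qed.

Lemma inf_comp_pcross V E M n x : locfin V -> (forall u v, E u v -> gadj u v) ->
  V x -> box M x -> (M <= n)%N -> infinite_set (gcomp V E x) -> pcross M n V E.
Proof.
move=> lV EG xV xM Mn inf; apply: contrapT => np.
have {}np z : gconn (win V n) E x z -> inner n z.
  by move=> g; apply: contrapT => nz; apply: np; exists x, z.
have xW : win V n x by split => //; exact: box_mono xM.
apply: inf; apply: sub_finite_set (lV _ (bounded_box n)) => y xy.
suff g : gconn (win V n) E x y by have [] := gconnP g.
apply: (gconn_ind (P := gconn (win V n) E x)) xy; first exact: gconn_refl.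
move=> u v uV vV g uv; apply: gconn_step (g) _ (uv); split => //.
by apply: inner_step (np _ g) _; exact: EG.
Qed.

(** Otherwise the finitely many points in [box M] would all have finite components, contained in a
    common [inner n], and no path from [box M] would leave that square. *)
Lemma pcross_inf V E M : locfin V -> (forall n, (M <= n)%N -> pcross M n V E) -> has_inf_component V E.
Proof.
move=> lV pc; apply: contrapT => ni.
have fin x : V x -> finite_set (gcomp V E x).
  move=> xV; apply: contrapT => inf; apply: ni; exists (gcomp V E x), x => //.
  exact/mem_set.
have bd x : exists nx, V x -> forall n, (nx <= n)%N -> gcomp V E x `<=` inner n.
  have [xV|?] := pselect (V x); last by exists 0%N.
  have /finite_seqP[s sE] := fin x xV.
  have [f hf] := @choice pt nat (fun y m => box m y) box_cover.
  (* The 2 exceeds the margin 5/4 of [inner]. *)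
  exists (2 + \max_(y <- s) f y)%N => _ n hn y xy.
  have ys : y \in s by move: xy; rewrite sE.
  have : (f y + 2 <= n)%N.
    by apply: leq_trans hn; rewrite addnC leq_add2l; apply: leq_bigmax_seq.
  move: (hf y) => /andP[/andP[h1 h2] /andP[h3 h4]] hn2.
  have : (f y)%:R + 2 <= n%:R :> R by rewrite -natrD ler_nat.
  by move=> *; apply/andP; split; apply/andP; split; lra.
have [g hg] := choice bd.
have /finite_seqP[s sE] := lV _ (bounded_box M).
have [x [y [xM xy ny]]] := pc (M + \max_(x <- s) g x)%N (leq_addr _ _).
have [[xV _] _] := gconnP xy; apply: ny; apply: (hg x xV).
  have xs : x \in s by have : (V `&` box M) x by []; rewrite sE.
  by rewrite -[leqLHS]add0n leq_add //; apply: leq_bigmax_seq.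
apply: (gconn_ind (P := gcomp V E x)) xy => [|u v [uV _] [vV _] g' uv]; first exact: gconn_refl.
exact: gconn_step g' vV uv.
Qed.

Definition incell b n (a : cell b n) x :=
  (a.1%:R <= (x.1 + n%:R) * (4 * b)%:R < a.1%:R + 1) && (a.2%:R <= (x.2 + n%:R) * (4 * b)%:R < a.2%:R + 1).
Definition occ b n V : {set cell b n} := [set a : cell b n | `[< exists2 x, V x & incell a x >]]%SET.

Lemma occP b n V (a : cell b n) : a \in occ b n V <-> exists2 x, V x & incell a x.
Proof. by rewrite inE; split => [/asboolP|?]; last exact/asboolP. Qed.

Section Level.
Variables b n : nat.
Hypothesis b0 : (0 < b)%N.
Implicit Types a : cell b n.
Local Notation q := ((4 * b)%:R : R).

Lemma q_gt0 : 0 < q. Proof. by rewrite ltr0n muln_gt0. Qed.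

Lemma nat_itv_eq (i j : nat) (t : R) : i%:R <= t < i%:R + 1 -> j%:R <= t < j%:R + 1 -> i = j.
Proof.
move=> /andP[h1 h2] /andP[h3 h4]; case: (ltngtP i j) => //; rewrite -(ler_nat R) -natr1 => ?; exfalso; lra.
Qed.

Lemma incell_inj a a' x : incell a x -> incell a' x -> a = a'.
Proof.
case: a a' => [a1 a2] [c1 c2] /andP[h1 h2] /andP[h3 h4].
by congr (_, _); apply: val_inj; [exact: nat_itv_eq h1 h3|exact: nat_itv_eq h2 h4].
Qed.

Lemma ge_floor (i k : nat) (t : R) : i%:R <= t < i%:R + 1 -> (k <= i)%N = (k%:R <= t).
Proof.
move=> /andP[h1 h2]; apply/idP/idP => [|h]; first by rewrite -(ler_nat R) => /le_trans; apply.
by rewrite -ltnS -(ltr_nat R) -natr1; lra.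
Qed.

Lemma incell_box a x : incell a x -> box n x.
Proof.
move=> /andP[/andP[h1 h2] /andP[h3 h4]]; have q0 := q_gt0.
have sE : (side b n)%:R = 2 * n%:R * q by rewrite /side !natrM.
have c1 : a.1%:R + 1 <= 2 * n%:R * q by rewrite natr1 -sE ler_nat ltn_ord.
have c2 : a.2%:R + 1 <= 2 * n%:R * q by rewrite natr1 -sE ler_nat ltn_ord.
have p1 : 0 <= a.1%:R :> R by []. have p2 : 0 <= a.2%:R :> R by [].
have e1 : 0 <= (x.1 + n%:R) * q by lra. have e2 : 0 <= (x.2 + n%:R) * q by lra.
rewrite pmulr_lge0 // in e1; rewrite pmulr_lge0 // in e2.
have e3 : (x.1 + n%:R) * q < 2 * n%:R * q by lra. have e4 : (x.2 + n%:R) * q < 2 * n%:R * q by lra.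
rewrite ltr_pM2r // in e3; rewrite ltr_pM2r // in e4.
by apply/andP; split; apply/andP; split; lra.
Qed.

Lemma incell_ex x : box n x -> exists a : cell b n, incell a x.
Proof.
move=> /andP[/andP[h1 h2] /andP[h3 h4]]; have q0 := q_gt0.
have sE : (side b n)%:R = 2 * n%:R * q by rewrite /side !natrM.
have H (t : R) : - n%:R <= t -> t < n%:R -> exists i : 'I_(side b n), i%:R <= (t + n%:R) * q < i%:R + 1.
  move=> t1 t2; have t0 : 0 <= (t + n%:R) * q by rewrite mulr_ge0 ?(ltW q0) //; lra.
  have /andP[k1 k2] := truncn_itv t0.
  have lt : (Num.trunc ((t + n%:R) * q) < side b n)%N.
    rewrite -(ltr_nat R) (le_lt_trans k1) // sE ltr_pM2r //; lra.
  by exists (Ordinal lt); rewrite /= k1 natr1.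
have [i hi] := H _ h1 h2; have [j hj] := H _ h3 h4.
by exists (i, j); rewrite /incell hi.
Qed.

Lemma cS_box M a x : incell a x -> (a \in cS M) <-> box M x.
Proof.
move=> /andP[h1 h2]; rewrite inE; have q0 := q_gt0.
have E (i : nat) (t : R) : i%:R <= (t + n%:R) * q < i%:R + 1 ->
    ((n * (4 * b) <= i + M * (4 * b)) && (i < n * (4 * b) + M * (4 * b)))%N = (- M%:R <= t < M%:R).
  move=> h; congr (_ && _).
    have h' : (i + M * (4 * b))%:R <= (t + n%:R) * q + M%:R * q < (i + M * (4 * b))%:R + 1.
      by rewrite natrD natrM; move/andP: h => [? ?]; apply/andP; split; lra.
    by rewrite (ge_floor _ h') natrM -mulrDl ler_pM2r //; apply/idP/idP; lra.
  rewrite ltnNge (ge_floor _ h) -ltNge natrD !natrM -mulrDl ltr_pM2r //; apply/idP/idP; lra.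
by rewrite (E _ _ h1) (E _ _ h2); split.
Qed.

Lemma cT_inner a x : incell a x -> (a \in cT) <-> ~ inner n x.
Proof.
move=> /andP[h1 h2]; rewrite inE; have q0 := q_gt0.
have b00 : 0 < b%:R :> R by rewrite ltr0n.
have E (i : nat) (t : R) : i%:R <= (t + n%:R) * q < i%:R + 1 ->
    (5 * b <= i < side b n - 5 * b)%N = (- n%:R + 5 / 4 <= t < n%:R - 5 / 4).
  move=> h; congr (_ && _).
    rewrite (ge_floor _ h) (_ : (5 * b)%:R = 5 / 4 * q) ?ler_pM2r //; last by rewrite !natrM; field.
    by apply/idP/idP; lra.
  rewrite ltn_subRL addnC.
  have h' : (i + 5 * b)%:R <= (t + n%:R) * q + 5 / 4 * q < (i + 5 * b)%:R + 1.
    have -> : (i + 5 * b)%:R = i%:R + 5 / 4 * q by rewrite natrD !natrM; field.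
    by move/andP: h => [? ?]; apply/andP; split; lra.
  rewrite ltnNge (ge_floor _ h') -ltNge -mulrDl (_ : (side b n)%:R = 2 * n%:R * q); last by rewrite /side !natrM.
  by rewrite ltr_pM2r //; apply/idP/idP; lra.
rewrite (E _ _ h1) (E _ _ h2); split; first by move/negP.
by move=> h; apply/negP.
Qed.

Lemma gap_le (i j : nat) (t u : R) : i%:R <= t < i%:R + 1 -> j%:R <= u < j%:R + 1 ->
  (gap i j)%:R ^+ 2 <= (t - u) ^+ 2 /\ `|t - u| <= (gap i j)%:R + 2.
Proof.
move=> h1 h2; wlog ij : i j t u h1 h2 / (i <= j)%N.
  move=> W; have [ij|/ltnW ij] := leqP i j; first exact: W.
  by rewrite gapC -normrN -[(t - u) ^+ 2]sqrrN opprB; apply: W.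
move/andP: h1 => [h1 h2']; move/andP: h2 => [h3 h4].
have [ji|ji] : j = i \/ j = (i + gap i j).+1 by rewrite /gap; lia.
  rewrite -ji /gap maxnn minnn subnn /= expr0n add0r sqr_ge0; split => //.
  by rewrite ji in h3 h4; rewrite ler_norml; apply/andP; split; lra.
have jR : j%:R = i%:R + (gap i j)%:R + 1 :> R by rewrite -natrD natr1 -ji.
have g0 : 0 <= (gap i j)%:R :> R by [].
split; last by rewrite ler_norml; apply/andP; split; lra.
by rewrite -[(t - u) ^+ 2]sqrrN opprB ler_sqr ?nnegrE; lra.
Qed.

Lemma gadj_cadj a a' x y : incell a x -> incell a' y -> a != a' -> gadj x y -> cadj a a'.
Proof.
move=> /andP[h1 h2] /andP[h3 h4] ne [_ d]; rewrite /cadj ne /=.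
have [g1 _] := gap_le h1 h3; have [g2 _] := gap_le h2 h4.
rewrite -(ler_nat R) natrD !natrX.
have q0 : 0 <= q ^+ 2 by rewrite sqr_ge0.
have {}d := ler_wpM2r q0 d; rewrite mul1r in d; apply: le_trans d.
apply: le_trans (lerD g1 g2) _; rewrite le_eqVlt; apply/orP; left; apply/eqP; ring.
Qed.

(** Each coordinate difference exceeds the gap by at most two cell sides; with gaps at most [q] the
    squares exceed [q ^ 2] by at most [8 * q + 8 <= 16 * q]. *)
Lemma cadj_near a a' x y : incell a x -> incell a' y -> cadj a a' ->
  (x.1 - y.1) ^+ 2 + (x.2 - y.2) ^+ 2 <= 1 + 16 / q.
Proof.
move=> /andP[h1 h2] /andP[h3 h4] /andP[_ c].
have [_] := gap_le h1 h3; have [_] := gap_le h2 h4.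
have q0 := q_gt0; have q1 : 1 <= q by rewrite ler1n muln_gt0.
rewrite -(ler_nat R) natrD !natrX in c.
set g1 := (gap a.1 _)%:R in c *; set g2 := (gap a.2 _)%:R in c *.
have p1 : 0 <= g1 by []. have p2 : 0 <= g2 by [].
have D (t u : R) : (t + n%:R) * q - (u + n%:R) * q = (t - u) * q by ring.
rewrite !D !normrM (ger0_norm (ltW q0)) => k2 k1.
have l1 : (`|x.1 - y.1| * q) ^+ 2 <= (g1 + 2) ^+ 2 by rewrite ler_sqr ?nnegrE ?mulr_ge0 ?(ltW q0) //; lra.
have l2 : (`|x.2 - y.2| * q) ^+ 2 <= (g2 + 2) ^+ 2 by rewrite ler_sqr ?nnegrE ?mulr_ge0 ?(ltW q0) //; lra.
rewrite !exprMn !real_normK ?num_real // in l1 l2.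
have g1q : g1 <= q by rewrite -ler_sqr ?nnegrE ?(ltW q0) //; apply: le_trans c; rewrite lerDl sqr_ge0.
have g2q : g2 <= q by rewrite -ler_sqr ?nnegrE ?(ltW q0) //; apply: le_trans c; rewrite lerDr sqr_ge0.
have q2 : 0 < q ^+ 2 by rewrite exprn_gt0.
rewrite -(ler_pM2r q2) (_ : (1 + 16 / q) * q ^+ 2 = q ^+ 2 + 16 * q); last first.
  by rewrite mulrDl mul1r expr2 mulrA divfK // gt_eqF.
rewrite mulrDl; clear -l1 l2 c g1q g2q q1; move: l1 l2 c; rewrite !sqrrD; lra.
Qed.

Lemma incell_near a x y : incell a x -> incell a y -> `|x.1 - y.1| * q < 1 /\ `|x.2 - y.2| * q < 1.
Proof.
have q0 := q_gt0.
move=> /andP[/andP[? ?] /andP[? ?]] /andP[/andP[? ?] /andP[? ?]].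
have D (t u : R) : `|t - u| * q = `|(t + n%:R) * q - (u + n%:R) * q|.
  by rewrite -mulrBl normrM (ger0_norm (ltW q0)) opprD addrACA subrr addr0.
by rewrite !D !ltr_norml; split; apply/andP; split; lra.
Qed.

(** The mesh resolves the configuration in the window: points correspond to occupied cells and, with
    [gadj_cadj], the two graphs coincide. *)
Definition spread_out V := forall a a' x y, win V n x -> win V n y -> x <> y ->
  incell a x -> incell a' y -> a != a' /\ (cadj a a' -> gadj x y).

Lemma occ_uniq V a x y : spread_out V -> win V n x -> win V n y -> incell a x -> incell a y -> x = y.
Proof.
move=> sV xV yV xa ya; apply: contrapT => xy.
by have [/eqP] := sV _ _ _ _ xV yV xy xa ya.
Qed.

Lemma spread_out_sub V V' : V' `<=` V -> spread_out V -> spread_out V'.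
Proof. by move=> VV sV a a' x y [xV xb] [yV yb]; apply: sV; split => //; exact: VV. Qed.

(** Passing to cells only adds connections, so this direction holds at every mesh. *)
Lemma pcross_perc M V : pcross M n V gadj -> perc cadj (cS M) cT (occ b n V) [set: _].
Proof.
move=> [x [y [xM xy ny]]]; have [[xV xn] [yV yn]] := gconnP xy.
have occx u a : win V n u -> incell a u -> a \in occ b n V.
  by move=> [uV _] ua; apply/occP; exists u.
have [a ya] := incell_ex yn; apply/percP; exists a; first exact/(cT_inner ya).
have : forall a : cell b n, incell a y -> a \in reach cadj (cS M) (occ b n V) [set: _].
  apply: (gconn_ind (P := fun y => forall a : cell b n, incell a y -> a \in reach cadj (cS M) (occ b n V) [set: _])) xy.
    by move=> c xc; apply: reachS; [exact/(cS_box M xc)|exact: occx xc].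
  move=> u v uW vW Pu uv c vc; have [_ un] := uW; have [d ud] := incell_ex un.
  have dr := Pu d ud; have [<-//|dc] := eqVneq d c.
  apply: (reach_step dr); apply/and4P; split; last by rewrite finset.in_setT.
  - exact: occx ud.
  - exact: occx vc.
  - exact: gadj_cadj ud vc dc uv.
exact.
Qed.

Lemma perc_pcross M V E (F : {set {set cell b n}}) : spread_out V -> (forall x y, E x y -> gadj x y) ->
  (forall a a' x y, win V n x -> win V n y -> incell a x -> incell a' y -> gadj x y ->
     (E x y <-> [set a; a']%SET \in F)) ->
  perc cadj (cS M) cT (occ b n V) F <-> pcross M n V E.
Proof.
move=> sV EG hF.
have occx u a : win V n u -> incell a u -> a \in occ b n V.
  by move=> [uV _] ua; apply/occP; exists u.
split => [/percP[a aT ar]|].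
  pose good : {set cell b n} := [set c | `[< exists x y, [/\ box M x, gconn (win V n) E x y & incell c y] >]]%SET.
  have /fintype.subsetP/(_ a ar) : reach cadj (cS M) (occ b n V) F \subset good.
    apply: reach_min => [c cS /occP[x xV xc]|c d].
      have xM : box M x by exact/(cS_box M xc).
      rewrite inE; apply/asboolP; exists x, x; split => //; apply: gconn_refl; split => //.
      exact: incell_box xc.
    rewrite [c \in good]inE [d \in good]inE => /asboolP[x [y [xM xy yc]]] /and4P[_ /occP[z zV zd] cd eF].
    have zW : win V n z by split => //; exact: incell_box zd.
    have [_ yW] := gconnP xy.
    have yz : y <> z by move=> yz; rewrite yz in yc; move: cd; rewrite (incell_inj yc zd) cadjxx.
    have [_ /(_ cd) g] := sV _ _ _ _ yW zW yz yc zd.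
    apply/asboolP; exists x, z; split => //; apply: (gconn_step xy zW).
    exact/(hF _ _ _ _ yW zW yc zd g).
  rewrite inE => /asboolP[x [y [xM xy ya]]]; exists x, y; split => //.
  exact/(cT_inner ya).
move=> [x [y [xM xy ny]]]; have [[xV xn] [yV yn]] := gconnP xy.
have [a ya] := incell_ex yn; apply/percP; exists a; first exact/(cT_inner ya).
have : forall a : cell b n, incell a y -> a \in reach cadj (cS M) (occ b n V) F.
  apply: (gconn_ind (P := fun y => forall a : cell b n, incell a y -> a \in reach cadj (cS M) (occ b n V) F)) xy.
    by move=> c xc; apply: reachS; [exact/(cS_box M xc)|exact: occx xc].
  move=> u v uW vW Pu uv c vc; have [_ un] := uW; have [d ud] := incell_ex un.
  have g := EG _ _ uv; have [nuv _] := g; have [dc _] := sV _ _ _ _ uW vW nuv ud vc.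
  apply: (reach_step (Pu d ud)); apply/and4P; split.
  - exact: occx ud.
  - exact: occx vc.
  - exact: gadj_cadj ud vc dc g.
  - exact/(hF _ _ _ _ uW vW ud vc g).
exact.
Qed.

End Level.

(** Only finitely many pairs matter. [2 / m] separates their cells, and [16 / |d - 1|] makes the
    error in [cadj_near] smaller than the excess of [d] over 1; pairs at distance exactly 1 are
    joined in both graphs. *)
Lemma spread_out_ex V n : locfin V -> exists b0, forall b, (b0 <= b)%N -> (0 < b)%N /\ spread_out b n V.
Proof.
move=> lV.
have pr (e : pt * pt) : exists b0, (0 < b0)%N /\ (e.1 <> e.2 -> forall b, (b0 <= b)%N ->
    forall a a' : cell b n, incell a e.1 -> incell a' e.2 -> a != a' /\ (cadj a a' -> gadj e.1 e.2)).
  case: e => x y /=; have [->|xy] := pselect (x = y); first by exists 1%N.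
  pose m := `|x.1 - y.1| + `|x.2 - y.2|; pose d := (x.1 - y.1) ^+ 2 + (x.2 - y.2) ^+ 2.
  have m0 : 0 < m.
    rewrite lt_neqAle addr_ge0 // andbT eq_sym paddr_eq0 // !normr_eq0 !subr_eq0.
    by apply/negP => /andP[/eqP h1 /eqP h2]; apply: xy; case: x y h1 h2 {m d} => ? ? [? ?] /= -> ->.
  exists (Num.bound (2 / m) + Num.bound (16 / `|d - 1|)).+1; split => // _ b hb a a' ax ay.
  have b0 : (0 < b)%N by exact: leq_trans hb.
  have q0 := q_gt0 b0.
  have bq : b%:R <= (4 * b)%:R :> R by rewrite ler_nat leq_pmull.
  split.
    apply/eqP => e; rewrite -e in ay; have [k1 k2] := incell_near b0 ax ay.
    have : 2 / m < b%:R.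
      by apply: lt_le_trans (archi_boundP _) _; rewrite ?divr_ge0 ?(ltW m0) // ler_nat (leq_trans _ hb) // ltnW // ltnS leq_addr.
    rewrite ltr_pdivrMr // => h.
    have : b%:R * m <= (4 * b)%:R * m by rewrite ler_pM2r.
    by rewrite /m mulrDr ![(4 * b)%:R * _]mulrC => h'; move: h h'; rewrite /m; lra.
  move=> c; split => //; rewrite -/d leNgt; apply/negP => d1.
  have := cadj_near b0 ax ay c; rewrite -/d; apply/negP; rewrite -ltNge.
  have dd : 0 < d - 1 by lra.
  have : 16 / `|d - 1| < b%:R.
    by apply: lt_le_trans (archi_boundP _) _; rewrite ?divr_ge0 // ler_nat (leq_trans _ hb) // ltnW // ltnS leq_addl.
  rewrite gtr0_norm // ltr_pdivrMr // => h; rewrite -ltrBrDl ltr_pdivrMr // mulrC.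
  by apply: lt_le_trans h _; rewrite ler_pM2r.
have [f hf] := choice pr.
have /finite_seqP[s sE] := lV _ (bounded_box n).
exists (\max_(x <- s) \max_(y <- s) f (x, y)).+1 => b hb; split; first exact: leq_trans hb.
move=> a a' x y xW yW xy xa ya.
have xs : x \in s by have := xW; rewrite /win sE.
have ys : y \in s by have := yW; rewrite /win sE.
have [_ h] := hf (x, y); apply: (h xy b _ a a' xa ya).
apply: leq_trans (ltnW hb); apply: leq_trans (leq_bigmax_seq _ xs _) => //.
by apply: (leq_bigmax_seq (F := fun y => f (x, y)) _ ys).
Qed.
End Points.

(** * Percolation on a fixed configuration *)

Section Quenched.
Context {R : realType} d {Omega : measurableType d} (P : probability Omega R).
Local Notation pt := (pt R).
Local Notation gadj := (@gadj R).
Variables (V : set pt) (b n M : nat) (p : R).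
Hypotheses (b0 : (0 < b)%N) (sV : spread_out b n V).

Section Bond.
Variable B : pt -> pt -> set Omega.
Hypothesis BC : forall x y, B x y = B y x.
Hypothesis mB : forall x y, x \in V -> y \in V -> gadj x y -> measurable (B x y).
Hypothesis iB : forall s, edge_list V gadj s ->
  P (\big[setI/setT]_(e <- s) B e.1 e.2) = (p ^+ size s)%:E.

Definition joins (e : {set cell b n}) x y := exists a a',
  [/\ e = [set a; a']%SET, incell a x, incell a' y, win V n x & win V n y /\ gadj x y].

Lemma joins_uniq e x y x' y' : joins e x y -> joins e x' y' ->
  (x = x' /\ y = y') \/ (x = y' /\ y = x').
Proof.
move=> [a [a' [-> ax ay xW [yW g]]]] [c [c' [e' cx cy xW' [yW' g']]]].
have [gn _] := g; have [ne _] := sV xW yW gn ax ay.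
have u z z' (k : cell b n) : win V n z -> win V n z' -> incell k z -> incell k z' -> z = z'.
  by move=> h1 h2 h3 h4; exact: (occ_uniq sV h1 h2 h3 h4).
have : a \in [set c; c']%SET by rewrite -e' finset.set21.
have : a' \in [set c; c']%SET by rewrite -e' finset.set22.
rewrite !finset.in_set2 => /orP[]/eqP ? /orP[]/eqP ?; subst.
- by rewrite eqxx in ne.
- by right; split; [exact: u ax cy|exact: u ay cx].
- by left; split; [exact: u ax cx|exact: u ay cy].
- by rewrite eqxx in ne.
Qed.

(** [J] collects the pairs of cells that carry a Gilbert edge and [pe] orients them. Distinct pairs
    give edges that are neither equal nor reversed, so they form an [edge_list]; adjacent occupied
    cells always form a pair in [J], so [perc] sees only [F :&: J]. *)
Lemma quenched_bond (C := [set w | pcross M n V (fun x y => gadj x y /\ B x y w)]) :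
  measurable C /\ P C = (bmean p (fun F => (perc cadj (cS M) cT (occ b n V) F)%:R))%:E.
Proof.
pose J : {set {set cell b n}} := [set e | `[< exists xy, joins e xy.1 xy.2 >]]%SET.
have JP e : e \in J <-> exists xy, joins e xy.1 xy.2.
  by rewrite inE; split => [/asboolP|?]; last exact/asboolP.
have ex (e : {set cell b n}) : exists xy : pt * pt, e \in J -> joins e xy.1 xy.2.
  by have [/JP[xy h]|] := boolP (e \in J); [exists xy|exists (0, 0)].
have [pe hpe] := choice ex.
pose A e := if e \in J then B (pe e).1 (pe e).2 else set0.
have mA e : measurable (A e).
  rewrite /A; case: ifPn => // /hpe[a [a' [_ _ _ [xV _] [[yV _] g]]]].
  by apply: mB => //; exact/mem_set.
have AB e x y w : joins e x y -> (e \in patt A w) <-> B x y w.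
  move=> j; have eJ : e \in J by apply/JP; exists (x, y).
  rewrite in_patt /A eJ; have [[-> ->]|[-> ->]] := joins_uniq (hpe _ eJ) j => //.
  by rewrite BC.
have CE : C = [set w | perc cadj (cS M) cT (occ b n V) (patt A w)].
  have hh w : perc cadj (cS M) cT (occ b n V) (patt A w) <->
      pcross M n V (fun x y => gadj x y /\ B x y w).
    apply: perc_pcross => // [x y []//|a a' x y xW yW xa ya g].
    rewrite (AB _ x y) //; last by exists a, a'.
    by split => [[]|].
  by apply/seteqP; split => w /hh.
rewrite CE; split; first exact: (measurable_patt mA (fun F => perc cadj (cS M) cT (occ b n V) F)).
rewrite (patt_prob P mA (fun F => perc cadj (cS M) cT (occ b n V) F)) (patt_indep mA (p := p) (J := J)).
- congr (_%:E); apply: bmean_eq => F; congr (nat_of_bool _)%:R.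
  rewrite /perc (@eq_reach _ _ _ _ (F :&: J)%SET F) // => a a' aO aO' c.
  rewrite finset.in_setI (_ : [set a; a']%SET \in J) ?andbT //.
  move/occP: aO => [x xV xa]; move/occP: aO' => [y yV ya].
  have xW : win V n x by split => //; exact: incell_box xa.
  have yW : win V n y by split => //; exact: incell_box ya.
  have xy : x <> y by move=> xy; rewrite xy in xa; move: c; rewrite (incell_inj xa ya) cadjxx.
  have [_ /(_ c) g] := sV xW yW xy xa ya.
  by apply/JP; exists (x, y); exists a, a'.
- by move=> e /negbTE eJ; rewrite /A eJ.
- move=> D DJ; have DJ' e : e \in D -> e \in J by move/(fintype.subsetP DJ).
  have el : edge_list V gadj [seq pe e | e <- enum D].
    split.
    - rewrite map_inj_in_uniq ?enum_uniq // => e e'; rewrite !mem_enum => /DJ' eJ /DJ' eJ' ee.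
      have [a [a' [eE ax ay xW [yW g]]]] := hpe e eJ; have [c [c' [eE' cx cy _ _]]] := hpe e' eJ'.
      by rewrite -ee in cx cy; rewrite eE eE' (incell_inj ax cx) (incell_inj ay cy).
    - move=> f /mapP[e]; rewrite mem_enum => /DJ' eJ ->; apply/negP => /mapP[e'].
      rewrite mem_enum => /DJ' eJ' ee.
      have [a [a' [eE ax ay xW [yW g]]]] := hpe e eJ; have j' := hpe e' eJ'.
      have [c [c' [eE' cx cy _ _]]] := j'; rewrite -ee /= in cx cy.
      have e2 : e' = e.
        by rewrite eE eE' (incell_inj ax cy) (incell_inj ay cx) finset.setUC.
      have [gn _] := g; apply: gn; move: ee; rewrite e2; case: (pe e) => u v /= [-> _].
      by [].
    - move=> f /mapP[e]; rewrite mem_enum => /DJ' /hpe[a [a' [_ _ _ [xV _] [[yV _] g]]]] ->.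
      by split => //; exact/mem_set.
  have := iB el; rewrite size_map -cardE => <-; congr (P _).
  rewrite big_map -bigcap_seq; apply/seteqP; split => w h e /= eD.
    have eD' : e \in D by rewrite -mem_enum.
    by have := h e eD'; rewrite /A DJ'.
  have eD' : e \in enum D by rewrite mem_enum.
  by have := h e eD'; rewrite /A DJ'.
Qed.

End Bond.

Section Site.
Variable A : pt -> set Omega.
Hypothesis mA : forall v, v \in V -> measurable (A v).
Hypothesis iA : forall s : seq pt, uniq s -> (forall v, v \in s -> v \in V) ->
  P (\big[setI/setT]_(v <- s) A v) = (p ^+ size s)%:E.

Lemma quenched_site (C := [set w | pcross M n [set v | V v /\ A v w] gadj]) :
  measurable C /\ P C = (bmean p (fun U => (perc cadj (cS M) cT (U :&: occ b n V) [set: _])%:R))%:E.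
Proof.
pose J := occ b n V.
have ex (a : cell b n) : exists x : pt, a \in J -> win V n x /\ incell a x.
  have [/occP[x xV xa]|] := boolP (a \in J); last by exists (0, 0).
  by exists x => _; split => //; split => //; exact: incell_box xa.
have [pc hpc] := choice ex.
pose A' a := if a \in J then A (pc a) else set0.
have mA' a : measurable (A' a).
  by rewrite /A'; case: ifPn => // /hpc[[xV _] _]; apply: mA; exact/mem_set.
have pO w : patt A' w = occ b n [set v | V v /\ A v w].
  apply/setP => a; apply/idP/idP.
    move/in_patt; rewrite /A'; case: ifPn => // aJ Aw; have [[xV _] xa] := hpc a aJ.
    by apply/occP; exists (pc a).
  move/occP => [x [xV Ax] xa]; have aJ : a \in J by apply/occP; exists x.
  apply/in_patt; rewrite /A' aJ; have [xW' xa'] := hpc a aJ.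
  have xW : win V n x by split => //; exact: incell_box xa.
  by rewrite (occ_uniq sV xW' xW xa' xa).
have CE : C = [set w | perc cadj (cS M) cT (patt A' w) [set: _]].
  have hh w : perc cadj (cS M) cT (patt A' w) [set: _] <-> pcross M n [set v | V v /\ A v w] gadj.
    rewrite pO; apply: perc_pcross => //; first by apply: spread_out_sub sV => x [].
    by move=> *; rewrite finset.in_setT.
  by apply/seteqP; split => w /hh.
rewrite CE; split; first exact: (measurable_patt mA' (fun F => perc cadj (cS M) cT F [set: _])).
rewrite (patt_prob P mA' (fun F => perc cadj (cS M) cT F [set: _])) (patt_indep mA' (p := p) (J := J)) //.
- by move=> e /negbTE eJ; rewrite /A' eJ.
- move=> D DJ; have DJ' e : e \in D -> e \in J by move/(fintype.subsetP DJ).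
  have := @iA [seq pc a | a <- enum D]; rewrite size_map -cardE => <-.
  - congr (P _); rewrite big_map -bigcap_seq; apply/seteqP; split => w h e /= eD.
      have eD' : e \in D by rewrite -mem_enum.
      by have := h e eD'; rewrite /A' DJ'.
    have eD' : e \in enum D by rewrite mem_enum.
    by have := h e eD'; rewrite /A' DJ'.
  - rewrite map_inj_in_uniq ?enum_uniq // => e e'; rewrite !mem_enum => /DJ' /hpc[_ ca] /DJ' /hpc[_ ca'] ee.
    by rewrite -ee in ca'; exact: incell_inj ca ca'.
  - by move=> f /mapP[e]; rewrite mem_enum => /DJ'/hpc[[xV _] _] ->; exact/mem_set.
Qed.

End Site.
End Quenched.

Lemma minmax_eq (i j k l : nat) : minn i j = minn k l -> maxn i j = maxn k l ->
  (i = k /\ j = l) \/ (i = l /\ j = k).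
Proof.
by case: (leqP i j) => ?; case: (leqP k l) => ? h1 h2; [left|right|right|left]; split; lia.
Qed.

(** * Poisson processes *)

Section Poisson.
Context {R : realType}.
Local Notation pt := (pt R).
Local Notation gadj := (@gadj R).

Definition rect (a c h k : R) : set pt := `[a, a + h[ `*` `[c, c + k[.

Lemma measurable_rect a c h k : measurable (rect a c h k).
Proof. by apply: measurableX; exact: measurable_itv. Qed.

Lemma bounded_rect a c h k : bounded2 (rect a c h k).
Proof.
exists (`|a| + `|h| + `|c| + `|k|) => x [/=]; rewrite !in_itv /= => /andP[? ?] /andP[? ?].
have := ler_norm a; have := ler_norm (- a); have := ler_norm h; have := ler_norm (- h).
have := ler_norm c; have := ler_norm (- c); have := ler_norm k; have := ler_norm (- k).
rewrite !normrN => *; split; rewrite ler_norml; apply/andP; split; lra.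
Qed.

Lemma leb2_rect a c h k : 0 <= h -> 0 <= k -> leb2 (rect a c h k) = (h * k)%:E.
Proof.
move=> h0 k0; rewrite /leb2 product_measure1E; try exact: measurable_itv.
have L (u v : R) : 0 <= v -> lebesgue_measure [set` `[u, u + v[] = v%:E.
  move=> v0; rewrite lebesgue_measure_itv /= lte_fin ltrDl.
  move: v0; rewrite le_eqVlt => /orP[/eqP<-|->]; first by rewrite ltxx.
  by rewrite EFinN -EFinD addrAC subrr add0r.
by rewrite EFinM; congr (_ * _)%E; exact: L.
Qed.

Variables (d : measure_display) (Omega : measurableType d) (Q : probability Omega R).
Variables (eta : Omega -> set pt) (lam : R).
Hypothesis PPP : is_PPP Q eta lam.

Definition void (B : set pt) : set Omega := [set w | eta w `&` B = set0].

Lemma card0_void (B : set pt) : [set w | (eta w `&` B #= `I_0)%card] = void B.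
Proof.
by apply/seteqP; split => w /=; rewrite II0 card_eq0 => /eqP.
Qed.

Lemma measurable_void B : measurable B -> bounded2 B -> measurable (void B).
Proof.
move=> mB bB; rewrite -card0_void.
have [_ /(_ [:: B] [:: 0%N] erefl)[]] := PPP.
- by move=> C; rewrite inE => /eqP->.
- by move=> [|i] [|j].
- by move=> /(_ 0%N isT).
Qed.

Lemma ppp_void (I : eqType) (B : I -> set pt) (v : R) (s : seq I) : uniq s ->
  (forall i, i \in s -> [/\ measurable (B i), bounded2 (B i) & leb2 (B i) = v%:E]) ->
  (forall i j, i \in s -> j \in s -> i != j -> B i `&` B j = set0) ->
  Q (\big[setI/setT]_(i <- s) void (B i)) = (expR (- (lam * v)) ^+ size s)%:E.
Proof.
move=> us hB dB.
have [_ /(_ (map B s) (nseq (size s) 0%N))] := PPP; rewrite !size_map size_nseq => /(_ erefl)[].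
- by move=> C /mapP[i /hB[? ? _] ->].
- move=> i j si sj ij; case: s us hB dB si sj => // x0 s us hB dB si sj.
  rewrite !(nth_map x0) //; apply: dB; rewrite ?mem_nth //.
  by rewrite nth_uniq //; apply/eqP.
move=> _; case: (posnP (size s)) => [/size0nil ->|s0]; first by rewrite !big_nil big_ord0 probability_setT.
have [x0 _] : exists x0 : I, True by case: s s0 {us hB dB} => // x s; exists x.
rewrite (big_nth x0) big_mkord => e.
rewrite (eq_bigr (fun i : 'I_(size s) => [set w | (eta w `&` nth set0 [seq B i | i <- s] i #= `I_(nth 0%N (nseq (size s) 0%N) i))%card])).
  rewrite e; congr (_%:E); rewrite (eq_bigr (fun=> expR (- (lam * v)))).
    by rewrite prodr_const card_ord.
  move=> i _; rewrite nth_nseq ltn_ord (nth_map x0) // /poisson_mass expr0 fact0 divr1 mul1r.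
  by have [] := hB (nth x0 s i) (mem_nth _ (ltn_ord i)) => _ _ ->.
move=> i _; rewrite nth_nseq ltn_ord (nth_map x0) //.
by rewrite card0_void.
Qed.

Section Cell.
Variables (b n : nat).
Hypothesis b0 : (0 < b)%N.
Local Notation q := ((4 * b)%:R : R).
Definition sprob : R := 1 - expR (- (lam / q ^+ 2)).

Lemma incell_rect (a : cell b n) : [set x | incell a x] = rect (a.1%:R / q - n%:R) (a.2%:R / q - n%:R) q^-1 q^-1.
Proof.
have q0 : 0 < q by exact: q_gt0.
have E (i t : R) : (i <= (t + n%:R) * q < i + 1) = (i / q - n%:R <= t < i / q - n%:R + q^-1).
  have -> : i / q - n%:R + q^-1 = (i + 1) / q - n%:R by rewrite mulrDl mul1r addrAC.
  by rewrite lerBlDr ler_pdivrMr // ltrBrDr ltr_pdivlMr.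
apply/seteqP; split => x; rewrite /rect /= !in_itv /= /incell !E; first by move/andP.
by case=> -> ->.
Qed.

(** The Poisson law gives the probability that several disjoint cells are all empty, which is what
    [patt_indep] needs; occupation is then the complementary pattern. *)
Lemma ppp_occ (f : pred {set cell b n}) :
  measurable [set w | f (occ b n (eta w))] /\
  Q [set w | f (occ b n (eta w))] = (bmean sprob (fun O => (f O)%:R))%:E.
Proof.
have q0 : 0 < q by exact: q_gt0.
pose A (a : cell b n) := void [set x | incell a x].
have mA a : measurable (A a).
  by apply: measurable_void; rewrite incell_rect; [exact: measurable_rect|exact: bounded_rect].
have oE w : occ b n (eta w) = (~: patt A w)%SET.
  apply/setP => a; rewrite finset.in_setC; apply/idP/negP.
    move=> /occP[x xe xa] /in_patt; rewrite /A /void /= => h.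
    by have : (eta w `&` [set x | incell a x]) x by []; rewrite h.
  move=> na; apply/occP; apply: contrapT => h; apply: na; apply/in_patt.
  by apply/seteqP; split => // x [xe xa]; apply: h; exists x.
have -> : [set w | f (occ b n (eta w))] = [set w | (fun X => f (~: X)%SET) (patt A w)].
  by apply/seteqP; split => w /=; rewrite oE.
split; first exact: (measurable_patt mA (fun X => f (~: X)%SET)).
rewrite (patt_prob Q mA (fun X => f (~: X)%SET)).
rewrite (@patt_indep _ _ _ _ _ _ mA (expR (- (lam / q ^+ 2))) [set: cell b n]%SET (fun X => (f (~: X)%SET)%:R)).
- rewrite -(bmeanC _ (fun X => (f X)%:R)); congr (_%:E); apply: bmean_eq => X.
  by rewrite finset.setIT.
- by move=> i; rewrite finset.in_setT.
- move=> D _; rewrite cardE -[RHS](@ppp_void _ (fun a : cell b n => [set x | incell a x]) (q ^- 2)) ?enum_uniq //.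
  + congr (Q _); rewrite -bigcap_seq; apply/seteqP; split => w h e /= eD.
      by apply: h; rewrite /= -mem_enum.
    by apply: h; rewrite /= mem_enum.
  + move=> a _; rewrite incell_rect; split; [exact: measurable_rect|exact: bounded_rect|].
    by rewrite leb2_rect ?invr_ge0 ?(ltW q0) // -invfM expr2.
  + move=> a a' _ _ ne; apply/seteqP; split => // x [xa xa']; move: ne.
    by rewrite (incell_inj xa xa') eqxx.
Qed.

End Cell.

(* The void events of disjoint rectangles of the process itself serve as
   independent coins. *)
Lemma coins (V : set pt) (p : R) : 0 < lam -> countable V -> 0 < p <= 1 ->
  exists B : pt -> pt -> set Omega, [/\ forall x y, B x y = B y x,
    forall x y, measurable (B x y) &
    forall s, edge_list V gadj s -> Q (\big[setI/setT]_(e <- s) B e.1 e.2) = (p ^+ size s)%:E].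
Proof.
move=> l0 cV /andP[p0 p1].
have [g gI] := countable_injP V cV.
(* A rectangle of area [h] is empty with probability [expR (- (lam * h)) = p]. *)
pose h := - ln p / lam.
have h0 : 0 <= h by rewrite divr_ge0 ?(ltW l0) // oppr_ge0 -ln1 ler_ln ?posrE.
(* The index is symmetric in the ends of the edge, and distinct indices give rectangles over
   disjoint unit intervals. *)
pose c x y := choice.pickle (minn (g x) (g y), maxn (g x) (g y)).
pose rc (m : nat) := rect m%:R 0 1 h.
exists (fun x y => void (rc (c x y))); split.
- by move=> x y; rewrite /c minnC maxnC.
- by move=> x y; apply: measurable_void; [exact: measurable_rect|exact: bounded_rect].
move=> s [us ns sV].
have -> : p = expR (- (lam * h)).
  by rewrite /h [lam * _]mulrC divfK ?gt_eqF // opprK lnK ?posrE.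
apply: (@ppp_void _ (fun e => rc (c e.1 e.2)) h) => // [e _|e f es fs ef].
  split; [exact: measurable_rect|exact: bounded_rect|].
  by rewrite leb2_rect // mul1r.
have [e1 e2 _] := sV e es; have [f1 f2 _] := sV f fs.
have ce : c e.1 e.2 != c f.1 f.2.
  apply/eqP => /(pcan_inj choice.pickleK)[k1 k2].
  have [[m1 m2]|[m1 m2]] : (g e.1 = g f.1 /\ g e.2 = g f.2) \/ (g e.1 = g f.2 /\ g e.2 = g f.1).
    exact: minmax_eq.
    by move/eqP: ef; apply; rewrite [e]surjective_pairing [f]surjective_pairing (gI _ _ e1 f1 m1) (gI _ _ e2 f2 m2).
  have := ns e es; rewrite (gI _ _ e1 f2 m1) (gI _ _ e2 f1 m2) -surjective_pairing fs.
  by [].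
apply/seteqP; split => // x [[/= x1 _] [/= x2 _]].
move: x1 x2; rewrite !in_itv /= => x1 x2; move/eqP: ce; apply.
exact: nat_itv_eq x1 x2.
Qed.

End Poisson.

(** * Dilation of a Poisson process *)

Section Scaling.
Context {R : realType}.
Local Notation pt := (pt R).
Local Notation mu := (@lebesgue_measure R).

Lemma measurable_scale1 (k : R) : measurable_fun [set: measurableTypeR R] ( *%R k : measurableTypeR R -> measurableTypeR R).
Proof. exact: measurable_realfun.mulrl_measurable. Qed.

Lemma lebesgue_scale (k : R) (k0 : 0 < k) (A : set (measurableTypeR R)) : measurable A ->
  mu ( *%R k @^-1` A) = (k^-1%:E * mu A)%E.
Proof.
move=> mA.
have <- : (k%:E * mu ( *%R k @^-1` A))%E = mu A.
  have [m mE] : exists m : {measure set (measurableTypeR R) -> \bar R}, forall A, m A = mu ( *%R k @^-1` A).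
    unshelve refine (ex_intro _ (pushforward mu ( *%R k : _ -> measurableTypeR R) : {measure set _ -> \bar R}) _) => //.
  rewrite -mE; transitivity (mscale (NngNum (ltW k0)) m A) => //.
  apply/esym/lebesgue_measure_unique => //= _ [[a c]] _ <-.
  rewrite /mscale /= mE (_ : _ @^-1` _ = [set` `]a / k, c / k]]); last first.
    apply/seteqP; split => x /=; rewrite !in_itv /= ltr_pdivrMr // ler_pdivlMr // mulrC //.
  rewrite !lebesgue_measure_itv /= !lte_fin ltr_pM2r ?invr_gt0 //.
  case: ifP => _; last by rewrite mule0.
  by rewrite -EFinM -mulrBl mulrC divfK ?gt_eqF.
by rewrite muleA -EFinM mulVf ?gt_eqF // mul1e.
Qed.

Definition dil (k : R) (x : pt) : pt := (k * x.1, k * x.2).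

Lemma measurable_dil (k : R) : measurable_fun [set: pt] (dil k).
Proof.
apply: measurable_fun_pair.
  by apply: measurableT_comp; [exact: measurable_scale1|exact: measurable_fst].
by apply: measurableT_comp; [exact: measurable_scale1|exact: measurable_snd].
Qed.

Lemma leb2_dil (k : R) (A : set pt) : 0 < k -> measurable A ->
  leb2 (dil k @^-1` A) = ((k ^- 2)%:E * leb2 A)%E.
Proof.
move=> k0 mA; have k20 : 0 < k ^+ 2 by rewrite exprn_gt0.
have <- : ((k ^+ 2)%:E * leb2 (dil k @^-1` A))%E = leb2 A.
  have [m mE] : exists m : {measure set (measurableTypeR R * measurableTypeR R)%type -> \bar R},
    forall A, m A = leb2 (dil k @^-1` A).
    unshelve refine (ex_intro _ (pushforward (mu \x mu)%E (dil k : _ -> measurableTypeR R * measurableTypeR R) : {measure set _ -> \bar R}) _) => //.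
    exact (measurable_dil k).
  rewrite -mE; transitivity (mscale (NngNum (ltW k20)) m A) => //.
  refine (esym (@product_measure_unique _ _ _ _ R mu mu (mscale (NngNum (ltW k20)) m) _ A mA)) => B C mB mC.
  transitivity ((k ^+ 2)%:E * leb2 (dil k @^-1` (B `*` C)))%E; first by rewrite -mE.
  rewrite (_ : dil k @^-1` (B `*` C) = ( *%R k @^-1` B) `*` ( *%R k @^-1` C)); last first.
    by apply/seteqP; split => x [].
  rewrite /leb2 product_measure1E; last 2 first.
  - by rewrite -[X in measurable X]setTI; apply: measurable_scale1.
  - by rewrite -[X in measurable X]setTI; apply: measurable_scale1.
  transitivity ((k ^+ 2)%:E * ((k^-1%:E * mu B) * (k^-1%:E * mu C)))%E.
    by congr (_ * (_ * _))%E; exact: lebesgue_scale.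
  by rewrite (muleACA k^-1%:E) -EFinM (muleA (k ^+ 2)%:E) -EFinM -invfM -expr2 divff ?mul1e // gt_eqF.
by rewrite muleA -EFinM mulVf ?gt_eqF // mul1e.
Qed.

(** [dil k] is a bijection, so the count in [B] is a count of [eta] in a set of [k ^+ 2] times the
    area. *)
Lemma ppp_dil d (Omega : measurableType d) (Q : probability Omega R) (eta : Omega -> set pt) (lam k : R) :
  0 < k -> is_PPP Q eta lam -> is_PPP Q (fun w => dil k @^-1` eta w) (lam * k ^+ 2).
Proof.
move=> k0 [fin law]; have kn : k != 0 by rewrite gt_eqF.
have dK : cancel (dil k) (dil k^-1) by move=> [x y]; rewrite /dil /= !mulKf.
have dK' : cancel (dil k^-1) (dil k) by move=> [x y]; rewrite /dil /= !mulVKf.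
have bdil B : bounded2 B -> bounded2 (dil k^-1 @^-1` B).
  move=> [M hM]; exists (k * M) => x /hM[/= h1 h2]; move: h1 h2.
  have ik : 0 < k^-1 by rewrite invr_gt0.
  by rewrite !normrM (gtr0_norm ik) !ler_pdivrMl.
have img w B : dil k @^-1` eta w `&` B = dil k^-1 @` (eta w `&` (dil k^-1 @^-1` B)).
  apply/seteqP; split => [x [h1 h2]|_ [x [h1 h2] <-]].
    by exists (dil k x); rewrite ?dK //; split => //=; rewrite dK.
  by split => //=; rewrite dK'.
have cardE w B m : (dil k @^-1` eta w `&` B #= `I_m)%card = (eta w `&` (dil k^-1 @^-1` B) #= `I_m)%card.
  rewrite img; apply/idP/idP => h.
    apply: card_eq_trans h; rewrite card_eq_sym; apply: inj_card_eq.
    by move=> x y _ _; exact: (can_inj dK').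
  apply: card_eq_trans h; apply: inj_card_eq.
  by move=> x y _ _; exact: (can_inj dK').
split => [w B bB|Bs ks sz hB dB].
  by rewrite img; apply: finite_image; exact/fin/bdil.
have := law (map (fun B => dil k^-1 @^-1` B) Bs) ks; rewrite size_map => /(_ sz).
have nthE i : nth set0 [seq dil k^-1 @^-1` B | B <- Bs] i = dil k^-1 @^-1` nth set0 Bs i.
  have [h|h] := ltnP i (size Bs); first by rewrite (nth_map set0).
  by rewrite !nth_default ?size_map // preimage_set0.
case=> [B' /mapP[B /hB[mB bB] ->]|i j hi hj ij|].
- split; last exact: bdil.
  by rewrite -[X in measurable X]setTI; apply: measurable_dil.
- by rewrite !nthE -preimage_setI dB // preimage_set0.
move=> mev qev.
have evE i : [set w | (eta w `&` nth set0 [seq dil k^-1 @^-1` B | B <- Bs] i #= `I_(nth 0%N ks i))%card] =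
   [set w | (dil k @^-1` eta w `&` nth set0 Bs i #= `I_(nth 0%N ks i))%card].
  by apply/seteqP; split => w /=; rewrite nthE cardE.
split => [i hi|]; first by rewrite -evE; exact: mev.
rewrite (eq_bigr (fun i : 'I_(size Bs) => [set w | (eta w `&` nth set0 [seq dil k^-1 @^-1` B | B <- Bs] i #= `I_(nth 0%N ks i))%card])).
  have E (i : 'I_(size Bs)) : lam * fine (leb2 (nth set0 [seq dil k^-1 @^-1` B | B <- Bs] i)) =
      lam * k ^+ 2 * fine (leb2 (nth set0 Bs i)).
    have [mB _] := hB _ (mem_nth set0 (ltn_ord i)).
    rewrite nthE leb2_dil ?invr_gt0 // exprVn invrK -mulrA; congr (_ * _).
    have k20 : (0 < (k ^+ 2)%:E)%E by rewrite lte_fin exprn_gt0.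
    case: (leb2 _) => [r //| |]; first by rewrite gt0_muley // mulr0.
    by rewrite gt0_muleNy // mulr0.
  refine (etrans qev _); apply: f_equal; apply: eq_bigr => i _.
  by move: (E i) => ->; reflexivity.
by move=> i _; rewrite evE.
Qed.

End Scaling.

(** * Limits of events and negligible sets *)

Section Negligible.
Context {R : realType} d {Omega : measurableType d} (Q : probability Omega R).
Implicit Types (F A : nat -> set Omega) (S : set Omega) (e : R).

Lemma measure_bigcup_le F e : (forall n, measurable (F n)) -> (forall n, F n `<=` F n.+1) ->
  (forall n, (Q (F n) <= e%:E)%E) -> (Q (\bigcup_n F n) <= e%:E)%E.
Proof.
move=> mF iF hF.
have nd : nondecreasing_seq F by apply/nondecreasing_seqP => n; apply/subsetPset; exact: iF.
have c := nondecreasing_cvg_mu (mu := Q) mF (bigcup_measurable (fun n _ => mF n)) nd.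
rewrite -(cvg_lim _ c) //; apply: lime_le; first by apply/cvg_ex; eexists; exact: c.
by apply: nearW.
Qed.

Definition eventually_in A : set Omega := \bigcup_m \bigcap_(k in [set k | (m <= k)%N]) A k.

Lemma measurable_eventually A : (forall n, measurable (A n)) -> measurable (eventually_in A).
Proof. by move=> mA; apply: bigcupT_measurable => m; apply: bigcap_measurable => [|k _]; [exists m => /=; exact: leqnn|exact: mA]. Qed.

(** What holds from [m] on holds at any chosen [k >= m], so a bound along a subsequence of meshes
    suffices. *)
Lemma eventually_le A e : (forall n, measurable (A n)) ->
  (forall m, exists2 k, (m <= k)%N & (Q (A k) <= e%:E)%E) -> (Q (eventually_in A) <= e%:E)%E.
Proof.
move=> mA hA.
have mI m : measurable (\bigcap_(k in [set k | (m <= k)%N]) A k).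
  by apply: bigcap_measurable => [|k _]; [exists m => /=; exact: leqnn|exact: mA].
apply: measure_bigcup_le => // [m w h k mk|m]; first by apply: h; exact: ltnW.
have [k mk hk] := hA m; apply: le_trans hk; apply: le_measure; rewrite ?inE //.
by move=> w; apply.
Qed.

Lemma negligible_small S :
  (forall e, 0 < e -> exists U, [/\ measurable U, S `<=` U & (Q U <= e%:E)%E]) -> Q.-negligible S.
Proof.
move=> h.
have ex (m : nat) : exists U, [/\ measurable U, S `<=` U & (Q U <= (m.+1%:R^-1)%:E)%E].
  by apply: h; rewrite invr_gt0.
have [f hf] := choice ex.
exists (\bigcap_m f m); split.
- by apply: bigcapT_measurable => m; have [] := hf m.
- apply/eqP; rewrite eq_le measure_ge0 andbT; apply/lee_addgt0Pr => e e0; rewrite add0e.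
  have [m hm] : exists m : nat, m.+1%:R^-1 <= e.
    exists (Num.bound e^-1); rewrite -[leRHS]invrK lef_pV2 ?posrE ?invr_gt0 //.
    by apply/ltW/(lt_le_trans (archi_boundP _)); rewrite ?invr_ge0 ?(ltW e0) // ler_nat.
  have [mf _ lf] := hf m; apply: le_trans (_ : (Q (f m) <= _)%E).
    apply: le_measure; rewrite ?inE //; first by apply: bigcapT_measurable => k; have [] := hf k.
    by move=> w; apply.
  by apply: le_trans lf _; rewrite lee_fin.
- by move=> w Sw m _; have [_ + _] := hf m; apply.
Qed.

Lemma measure_bigcap_ge F e : (forall n, measurable (F n)) -> (forall n, F n.+1 `<=` F n) ->
  (forall n, (e%:E <= Q (F n))%E) -> (e%:E <= Q (\bigcap_n F n))%E.
Proof.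
move=> mF dF hF; have mI : measurable (\bigcap_n F n) by exact: bigcapT_measurable.
have := @measure_bigcup_le (fun n => ~` F n) (1 - e).
rewrite -setC_bigcap probability_setC // => h.
have {h} : (1 - Q (\bigcap_n F n) <= (1 - e)%:E)%E.
  apply: h => n; [exact: measurableC|by apply: subsetC; exact: dF|].
  rewrite probability_setC // EFinB; apply: leeB => //; exact: hF.
by rewrite -(@fineK _ (Q _)) ?fin_num_measure // -EFinB !lee_fin; lra.
Qed.

End Negligible.

Section Connectivity.
Context {R : realType}.
Local Notation pt := (pt R).
Local Notation gadj := (@gadj R).
Implicit Types (V : set pt) (E : pt -> pt -> Prop) (x y z : pt) (b n M : nat).

Lemma gconn_mono V V' E E' x y : V `<=` V' -> (forall u v, E u v -> E' u v) ->
  gconn V E x y -> gconn V' E' x y.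
Proof.
move=> VV EE xy; have [xV _] := gconnP xy.
apply: (gconn_ind (P := gconn V' E' x)) xy; first exact/gconn_refl/VV.
by move=> u v uV vV xu uv; apply: gconn_step xu (VV _ vV) _; exact: EE.
Qed.

Lemma exit_inner V E n x y : (forall u v, E u v -> gadj u v) -> box n x ->
  gconn V E x y -> ~ inner n y -> exists2 z, gconn (win V n) E x z & ~ inner n z.
Proof.
move=> EG xn xy ny; apply: contrapT => np.
have {}np z : gconn (win V n) E x z -> inner n z.
  by move=> g; apply: contrapT => nz; apply: np; exists z.
have [xV _] := gconnP xy.
apply: ny; apply: (np _); apply: (gconn_ind (P := gconn (win V n) E x)) xy; first by apply: gconn_refl.
move=> u v uV vV g uv; apply: gconn_step (g) _ (uv); split => //.
by apply: inner_step (np _ g) _; exact: EG.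
Qed.

Lemma pcross_mono V E M n N : (forall u v, E u v -> gadj u v) -> (M <= n)%N -> (n <= N)%N ->
  pcross M N V E -> pcross M n V E.
Proof.
move=> EG Mn nN [x [y [xM xy ny]]].
have ny' : ~ inner n y.
  move=> h; apply: ny; move: h => /andP[/andP[? ?] /andP[? ?]].
  have k : n%:R <= N%:R :> R by rewrite ler_nat.
  by apply/andP; split; apply/andP; split; lra.
have xy' : gconn V E x y by apply: gconn_mono xy => // u [].
have [z xz nz] := exit_inner EG (box_mono Mn xM) xy' ny'.
by exists x, z.
Qed.

Lemma inf_comp_exit V E n x : locfin V -> (forall u v, E u v -> gadj u v) ->
  V x -> box n x -> infinite_set (gcomp V E x) -> exists2 z, gconn (win V n) E x z & ~ inner n z.
Proof.
move=> lV EG xV xn inf; have [z xz nz] : exists2 z, gconn V E x z & ~ inner n z.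
  apply: contrapT => h; apply: inf; apply: sub_finite_set (lV _ (bounded_box n)) => y xy.
  have [_ yV] := gconnP xy; split => //; apply: inner_box.
  by apply: contrapT => ny; apply: h; exists y.
exact: exit_inner EG xn xz nz.
Qed.

Lemma gconn_clu V b n (a c : cell b n) x y : (0 < b)%N ->
  incell a x -> incell c y -> gconn (win V n) gadj x y -> c \in clu cadj (occ b n V) a.
Proof.
move=> b0 ax cy xy.
have occx u (k : cell b n) : win V n u -> incell k u -> k \in occ b n V.
  by move=> [uV _] ua; apply/occP; exists u.
have [xW _] := gconnP xy; move: c cy.
apply: (gconn_ind (P := fun y => forall c : cell b n, incell c y -> c \in clu cadj (occ b n V) a)) xy.
  by move=> c xc; rewrite (incell_inj xc ax); apply: clu_refl; exact: occx ax.
move=> u v uW vW Pu uv c vc; have [_ un] := uW; have [k uk] := incell_ex b0 un.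
have kr := Pu k uk; have [<-//|kc] := eqVneq k c.
by apply: (rc_step kr); [exact: gadj_cadj uk vc kc uv|exact: occx vc].
Qed.

Lemma clu_gconn V b n (a c : cell b n) x y : (0 < b)%N -> spread_out b n V ->
  win V n x -> win V n y -> incell a x -> incell c y -> c \in clu cadj (occ b n V) a -> gconn (win V n) gadj x y.
Proof.
move=> b0 sV xW yW ax cy.
pose good : {set cell b n} := [set c | `[< exists2 y, gconn (win V n) gadj x y & incell c y >]]%SET.
have /fintype.subsetP h : clu cadj (occ b n V) a \subset good.
  apply: rc_min => [k|k l].
    rewrite finset.in_set1 => /eqP -> _; rewrite inE; apply/asboolP; exists x => //.
    exact: gconn_refl.
  rewrite [k \in good]inE [l \in good]inE => /asboolP[z xz zk] kl /occP[u uV ul].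
  have uW : win V n u by split => //; exact: incell_box ul.
  have [_ zW] := gconnP xz.
  have zu : z <> u by move=> zu; rewrite zu in zk; move: kl; rewrite (incell_inj zk ul) cadjxx.
  have [_ /(_ kl) g] := sV _ _ _ _ zW uW zu zk ul.
  by apply/asboolP; exists u => //; exact: gconn_step xz uW g.
move/h; rewrite inE => /asboolP[z xz cz]; have [_ zW] := gconnP xz.
by rewrite -(occ_uniq sV zW yW cz cy).
Qed.

End Connectivity.

Lemma window_dist (lo w i j : nat) : (lo <= i)%N -> (i < lo + w)%N -> (lo <= j)%N -> (j < lo + w)%N ->
  (maxn i j - minn i j <= w)%N.
Proof. by move=> *; lia. Qed.

Lemma wnd_le b M N : (M <= N)%N -> (M * (4 * b) <= N * (4 * b))%N.
Proof. by move=> h; rewrite leq_mul2r h orbT. Qed.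

Lemma wnd_lo b M N : (M <= N)%N -> ((4 * N - 4 * M) * b = N * (4 * b) - M * (4 * b))%N.
Proof. by move=> h; rewrite mulnBl; congr (_ - _)%N; rewrite mulnCA mulnA. Qed.

Lemma wnd_hi b M N : (M <= N)%N -> ((4 * N - 4 * M + 8 * M) * b = N * (4 * b) + M * (4 * b))%N.
Proof.
move=> h; rewrite (_ : (4 * N - 4 * M + 8 * M = 4 * N + 4 * M)%N); last by lia.
by rewrite mulnDl; congr (_ + _)%N; rewrite mulnCA mulnA.
Qed.

Section AlmostSure.
Context {R : realType}.
Local Notation pt := (pt R).
Local Notation gadj := (@gadj R).

Lemma sprob_bounds (lam : R) : 0 < lam -> exists b0 : nat, forall b, (b0 <= b)%N ->
  [/\ (0 < b)%N, lam / 2 / (4 * b)%:R ^+ 2 <= sprob lam b, sprob lam b <= lam / (4 * b)%:R ^+ 2 &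
      0 <= sprob lam b <= 1].
Proof.
move=> l0; exists (Num.bound lam).+1 => b hb.
have b0 : (0 < b)%N by exact: leq_trans hb.
have q0 : 0 < (4 * b)%:R ^+ 2 :> R by rewrite exprn_gt0 // ltr0n muln_gt0.
have lb : lam <= b%:R by apply/ltW/(lt_le_trans (archi_boundP (ltW l0))); rewrite ler_nat ltnW.
have bq : b%:R <= (4 * b)%:R ^+ 2 :> R.
  rewrite -natrX ler_nat expnMn; apply: (@leq_trans (b ^ 2)); last by rewrite leq_pmull.
  by rewrite -mulnn leq_pmulr.
pose t := lam / (4 * b)%:R ^+ 2.
have t0 : 0 < t by rewrite divr_gt0.
have t1 : t <= 1 by rewrite ler_pdivrMr // mul1r (le_trans lb).
have e1 := expR_ge1Dx (- t); have e2 := expR_ge1Dx t; have e0 := expR_gt0 (- t).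
have e3 : expR (- t) * (1 + t) <= 1.
  by apply: le_trans (ler_wpM2l (ltW e0) e2) _; rewrite -expRD addrC subrr expR0.
rewrite /sprob -/t; split => //.
- by rewrite mulrAC -/t; nra.
- lra.
- by apply/andP; split; nra.
Qed.

Lemma sprob_mono (l1 l2 : R) (b : nat) : (0 < b)%N -> l1 <= l2 -> sprob l1 b <= sprob l2 b.
Proof.
move=> b0 h; rewrite /sprob lerD2l lerN2 ler_expR lerN2 ler_pM2r //.
by rewrite invr_gt0 exprn_gt0 // ltr0n muln_gt0.
Qed.

Lemma sprob_range (lam : R) b : 0 <= lam -> 0 <= sprob lam b <= 1.
Proof.
move=> l0; rewrite /sprob lerBlDr lerDl expR_ge0 andbT subr_ge0 expR_le1.
by rewrite oppr_le0 divr_ge0 ?sqr_ge0.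
Qed.

Section Process.
Variables (d : measure_display) (Omega : measurableType d) (Q : probability Omega R).
Variables (eta : Omega -> set pt) (lam : R).
Hypotheses (PPP : is_PPP Q eta lam) (lam0 : 0 < lam).

Lemma locfin_ppp w : locfin (eta w).
Proof. by case: PPP => h _ B; exact: h. Qed.

(** Transfer from cells to the process: [S] is covered by the lower limit of cell events, so its own
    measurability does not enter. *)
Lemma level_negligible (S : set Omega) :
  (forall e : R, 0 < e -> exists n (f : forall b, pred {set cell b n}),
     (forall m, exists b, [/\ (m <= b)%N, (0 < b)%N & bmean (sprob lam b) (fun O => (f b O)%:R) <= e]) /\
     (forall w, S w -> exists b1, forall b, (b1 <= b)%N -> (0 < b)%N -> f b (occ b n (eta w)))) ->
  Q.-negligible S.
Proof.
move=> H; apply: negligible_small => e /H[n [f [fe fS]]].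
pose A b := [set w | (0 < b)%N && f b (occ b n (eta w))].
have mA b : measurable (A b).
  rewrite /A; case: (posnP b) => [->|b0]; last by have [] := ppp_occ (n := n) PPP b0 (f b).
  by rewrite (_ : [set _ | _] = set0) //; apply/seteqP; split.
exists (eventually_in A); split; first exact: measurable_eventually.
  move=> w /fS[b1 h]; exists b1.+1 => // b /= hb; have b0 : (0 < b)%N by exact: leq_trans hb.
  by rewrite /A /= b0 h // ltnW.
apply: eventually_le => // m; have [b [mb b0 hb]] := fe m; exists b => //.
have [_ E] := ppp_occ (n := n) PPP b0 (f b).
by rewrite (_ : A b = [set w | f b (occ b n (eta w))]) ?E ?lee_fin //; rewrite /A b0.
Qed.

(** Two infinite components meeting [box M.+1] reach the ring without being joined inside [box N],
    which is a two-arm event at every fine mesh. The number [K] of points near the centre is fixed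
    beforehand because [N] in [twoarm_small] depends on it. *)
Lemma uniq_as : Q.-negligible [set w | exists x y, [/\ eta w x, eta w y,
  infinite_set (gcomp (eta w) gadj x), infinite_set (gcomp (eta w) gadj y) & ~ gconn (eta w) gadj x y]].
Proof.
pose G M K := [set w | exists x y, [/\ (eta w `&` box M.+1) x, (eta w `&` box M.+1) y,
  infinite_set (gcomp (eta w) gadj x), infinite_set (gcomp (eta w) gadj y) &
  ~ gconn (eta w) gadj x y /\ exists2 s : seq pt, (size s <= K)%N & eta w `&` box M.+1 = [set` s]]].
apply: (@negligibleS _ _ _ Q (\bigcup_M \bigcup_K G M K)).
  move=> w [x [y [xV yV ix iy nxy]]].
  have [m1 h1] := box_cover x; have [m2 h2] := box_cover y.
  have /finite_seqP[s sE] := locfin_ppp w (bounded_box (maxn m1 m2).+1).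
  exists (maxn m1 m2) => //; exists (size s) => //; exists x, y; split => //; last by split => //; exists s.
    by split => //; apply: box_mono h1; apply: leqW; exact: leq_maxl.
  by split => //; apply: box_mono h2; apply: leqW; exact: leq_maxr.
apply: negligible_bigcup => M; apply: negligible_bigcup => K.
apply: level_negligible => e e0.
have l2 : 0 < lam / 2 by rewrite divr_gt0.
have [N [b0 [MN hb0]]] := twoarm_small K l2 lam0 e0 (ltn0Sn M).
have [b0' hb0'] := sprob_bounds lam0.
exists N, (fun b O => @twoarm b N M.+1 K O); split.
  move=> m; exists (maxn m (maxn b0 b0')); rewrite leq_maxl.
  set b := maxn m _; have b1 : (b0 <= b)%N by rewrite /b !leq_max leqnn !orbT.
  have b2 : (b0' <= b)%N by rewrite /b !leq_max leqnn !orbT.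
  by have [? ? ? _] := hb0' b b2; split => //; exact: hb0.
move=> w [x [y [[xV xM] [yV yM] ix iy [nxy [s sK sE]]]]].
have [b1 hb1] := spread_out_ex N (locfin_ppp w).
exists b1 => b hb bb; have [_ sV] := hb1 b hb.
have xN := box_mono MN xM; have yN := box_mono MN yM.
have [a ax] := incell_ex bb xN; have [c cy] := incell_ex bb yN.
have D (k : cell b N) (z : pt) : incell k z -> box M.+1 z ->
    k \in wnd b N (4 * N - 4 * M.+1, 4 * N - 4 * M.+1)%N (8 * M.+1)%N.
  move=> kz zM; have := (cS_box bb M.+1 kz).2 zM; rewrite !inE /=.
  rewrite !leq_divRL // !ltn_divLR //.
  by rewrite (wnd_lo b MN) (wnd_hi b MN); have := wnd_le b MN;
     move: (N * (4 * b))%N (M.+1 * (4 * b))%N => X Y h; lia.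
have aD := D a x ax xM; have cD := D c y cy yM.
have xW : win (eta w) N x by []. have yW : win (eta w) N y by [].
have rcz (k : cell b N) z : win (eta w) N z -> incell k z -> infinite_set (gcomp (eta w) gadj z) ->
    k \in rc cadj (srcs block (block @: @cT b N)%SET) (occ b N (eta w)).
  move=> [zV zN] kz iz; rewrite srcs_cT //.
  have [u zu nu] := inf_comp_exit (locfin_ppp w) (fun _ _ h => h) zV zN iz.
  have [_ [uV uN]] := gconnP zu; have [l lu] := incell_ex bb uN.
  have lO : l \in occ b N (eta w) by apply/occP; exists u.
  have kO : k \in occ b N (eta w) by apply/occP; exists z.
  have lT : l \in cT by exact/(cT_inner bb lu).
  have lk := gconn_clu bb kz lu zu.
  apply: (fintype.subsetP (clu_in (rcS cadj lT lO))).
  by apply: clu_sym => //; exact: cadjC.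
apply/andP; split.
  apply/twoP; exists a, c; split => //; last split; [|exact: rcz ix|exact: rcz iy|].
    move: aD cD; rewrite !inE /= /bdist /cheb => /andP[/andP[? ?] /andP[? ?]] /andP[/andP[? ?] /andP[? ?]].
    by rewrite geq_max; apply/andP; split; apply: window_dist; eassumption.
  apply/negP => h; apply: nxy; apply: gconn_mono (clu_gconn bb sV xW yW ax cy h) => // u [].
  by [].
apply: leq_trans sK; rewrite cardE.
have ex (z : pt) : exists k : cell b N, (exists k' : cell b N, incell k' z) -> incell k z.
  by have [[k kz]|nz] := pselect (exists k' : cell b N, incell k' z); [exists k|exists a => /nz].
have [g hg] := choice ex.
rewrite -(size_map g s); apply: uniq_leq_size (enum_uniq _) _ => k.
rewrite mem_enum inE => /andP[/occP[z zV kz] kD]; apply/mapP; exists z.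
  have : (eta w `&` box M.+1) z; last by rewrite sE.
  split => //; apply/(cS_box bb M.+1 kz); move: kD; rewrite !inE /=.
  rewrite !leq_divRL // !ltn_divLR //.
  by rewrite (wnd_lo b MN) (wnd_hi b MN); have := wnd_le b MN;
     move: (N * (4 * b))%N (M.+1 * (4 * b))%N => X Y h; lia.
have kg : incell (g z) z by apply: hg; exists k.
exact: incell_inj kz kg.
Qed.

End Process.
End AlmostSure.

(** * Almost sure behaviour *)

Section Percolates.
Context {R : realType}.
Local Notation pt := (pt R).
Local Notation gadj := (@gadj R).

Definition cperc b n M (O : {set cell b n}) (F : {set {set cell b n}}) := perc cadj (cS M) cT O F.
Definition cth b n M (s p : R) := mean2 s p (fun O F => (@cperc b n M O F)%:R).
Definition sth b n M (s : R) := bmean s (fun O => (@cperc b n M O [set: _])%:R).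

Lemma cth1 b n M s : cth b n M s 1 = sth b n M s.
Proof. by rewrite /cth /mean2; apply: bmean_eq => O; rewrite bmean1_id. Qed.

Lemma cth_range b n M (s p : R) : 0 <= s <= 1 -> 0 <= p <= 1 -> 0 <= cth b n M s p <= 1.
Proof.
move=> s01 p01; rewrite /cth; apply/andP; split; first by apply: mean2_ge0 => // O F; rewrite ler0n.
have E1 : mean2 s p (fun (O : {set cell b n}) (F : {set {set cell b n}}) => 1) = 1 :> R.
  by rewrite /mean2 (@bmean_eq _ _ _ _ (fun=> 1)) ?bmean_cst // => O; rewrite bmean_cst.
by rewrite -[leRHS]E1; apply: ler_mean2 => // O F; rewrite lern1 leq_b1.
Qed.

(** Concavity of [1 - e^(-x)], which vanishes at 0. Thinned cells are thereby dominated by the cells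
    of a process of intensity [p * lam]. *)
Lemma sprob_thin (p lam : R) b : 0 <= p <= 1 -> sprob lam b * p <= sprob (p * lam) b.
Proof.
move=> /andP[p0 p1]; rewrite /sprob -mulrA; set t := lam / _; rewrite -[p * t]opprK.
have e0 := expR_gt0 (- (p * t)).
have h1 : expR (- (p * t)) * (1 + (- t + p * t)) <= expR (- t).
  apply: le_trans (ler_wpM2l (ltW e0) (expR_ge1Dx _)) _; rewrite -expRD.
  by rewrite (_ : - (p * t) + (- t + p * t) = - t) //; ring.
have h2 : expR (- (p * t)) * (1 + p * t) <= 1.
  apply: le_trans (ler_wpM2l (ltW e0) (expR_ge1Dx _)) _; rewrite -expRD addrC subrr expR0.
  by [].
have h3 := ler_wpM2l p0 h1.
have p1' : 0 <= 1 - p by lra.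
have h4 := ler_wpM2l p1' h2.
rewrite opprK; set E := expR (- (p * t)) in h3 h4 *; move: (expR (- t)) h3 h4 => X h3 h4; nra.
Qed.

(** The contrapositive needs just one mesh and one box for each [e], as [pcross_perc] holds at all
    of them; therefore the lower bound is uniform. *)
Lemma percolates_bound (a : R) : 0 < a -> ~ no_inf_comp_as a -> exists M (c : R), 0 < c /\
  forall b n, (0 < b)%N -> (M <= n)%N -> c <= sth b n M (sprob a b).
Proof.
move=> a0 np; apply: contrapT => H; apply: np => d Omega Q eta PPP.
apply: (@negligibleS _ _ _ Q (\bigcup_M [set w | exists x, [/\ eta w x, box M x & infinite_set (gcomp (eta w) gadj x)]])).
  move=> w [C [x xV [-> inf]]]; have [m hm] := box_cover x; exists m => //; exists x; split => //.
  exact: set_mem.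
apply: negligible_bigcup => M; apply: negligible_small => e e0.
have [b [n [b0 Mn lt]]] : exists b n, [/\ (0 < b)%N, (M <= n)%N & sth b n M (sprob a b) < e].
  apply: contrapT => h; apply: H; exists M, e; split => // b n b0 Mn; rewrite leNgt; apply/negP => lt.
  by apply: h; exists b, n.
have [mU QU] := ppp_occ (n := n) PPP b0 (fun O => @cperc b n M O [set: _]).
exists [set w | @cperc b n M (occ b n (eta w)) [set: _]]; split => //; last by rewrite QU lee_fin ltW.
move=> w [x [xV xM inf]]; apply: pcross_perc => //.
exact: inf_comp_pcross (locfin_ppp PPP w) (fun _ _ h => h) xV xM Mn inf.
Qed.

Section Process.
Variables (d : measure_display) (Omega : measurableType d) (Q : probability Omega R).
Variables (eta : Omega -> set pt) (lam : R).
Hypotheses (PPP : is_PPP Q eta lam) (lam0 : 0 < lam).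

(** If the means exceeded [e] at arbitrarily fine meshes, [L n], the upper limit of the cell events,
    would have probability at least [e] for every [n]. It is the crossing event, decreasing in [n],
    and the intersection consists of configurations with an infinite component. *)
Lemma noinf_small M (e : R) : Q.-negligible [set w | has_inf_component (eta w) gadj] -> 0 < e ->
  exists2 n, (M <= n)%N & exists b1, forall b, (b1 <= b)%N -> (0 < b)%N -> sth b n M (sprob lam b) <= e.
Proof.
move=> ni e0; apply: contrapT => H.
pose A n b := [set w | (0 < b)%N && @cperc b n M (occ b n (eta w)) [set: _]].
have mA n b : measurable (A n b).
  rewrite /A; case: (posnP b) => [->|b0].
    by rewrite (_ : [set _ | _] = set0) //; apply/seteqP; split.
  by have [] := ppp_occ (n := n) PPP b0 (fun O => @cperc b n M O [set: _]).
pose U n B := \bigcup_(b in [set b | (B <= b)%N]) A n b.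
have mU n B : measurable (U n B) by apply: bigcup_measurable => b _.
pose L n := \bigcap_B U n B.
have LE n w : L n w <-> pcross M n (eta w) gadj.
  split => [h|pc B _]; last first.
    by exists B.+1 => /=; [exact: leqnSn|rewrite /A /=; exact: pcross_perc].
  have [b1 hb1] := spread_out_ex n (locfin_ppp PPP w).
  have [b /= hb /andP[b0 pc]] := h b1 I; have [_ sV] := hb1 b hb.
  apply/(@perc_pcross _ _ _ b0 M _ gadj [set: _] sV) => // *.
  by rewrite finset.in_setT.
have mL n : measurable (L n) by exact: bigcapT_measurable.
have QL n : (M <= n)%N -> (e%:E <= Q (L n))%E.
  move=> Mn; apply: measure_bigcap_ge => // [B w [b /= hb h]|B]; first by exists b => //=; exact: ltnW.
  have [b [hb b0 lt]] : exists b, [/\ (B <= b)%N, (0 < b)%N & e < sth b n M (sprob lam b)].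
    apply: contrapT => h; apply: H; exists n => //; exists B => b hb b0; rewrite leNgt; apply/negP => lt.
    by apply: h; exists b.
  have [_ E] := ppp_occ (n := n) PPP b0 (fun O => @cperc b n M O [set: _]).
  apply: le_trans (_ : (Q (A n b) <= _)%E).
    by rewrite (_ : A n b = [set w | @cperc b n M (occ b n (eta w)) [set: _]]) ?E ?lee_fin ?ltW // /A b0.
  by apply: le_measure; rewrite ?inE //; move=> w Aw; exists b.
pose F j := L (M + j)%N.
have Fe : (e%:E <= Q (\bigcap_j F j))%E.
  apply: measure_bigcap_ge => [j|j w|j]; [exact: mL| |by apply: QL; exact: leq_addr].
  by move=> /LE h; apply/LE; apply: pcross_mono h; rewrite ?leq_addr // leq_add2l.
have F0 : Q (\bigcap_j F j) = 0%E.
  apply: measure_negligible; first by apply: bigcapT_measurable => j; exact: mL.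
  apply: negligibleS ni => w h; apply: (pcross_inf (M := M)); first exact: (locfin_ppp PPP w).
  by move=> n Mn; apply/LE; rewrite -(subnKC Mn); exact: h.
by move: Fe; rewrite F0 lee_fin leNgt e0.
Qed.

Definition vsite b n M (p : R) (V : set pt) := bmean p (fun U => (@cperc b n M (U :&: occ b n V)%SET [set: _])%:R).
Definition vbond b n M (p : R) (V : set pt) := bmean p (fun F => (@cperc b n M (occ b n V) F)%:R).

(** Markov's inequality for the crossing probability given the configuration. Its mean belongs to
    cells of density [sprob lam b * p], at most that of the non-percolating intensity [a] by
    [sprob_thin]. *)
Lemma site_as (p a : R) : 0 <= p <= 1 -> 0 < a -> p * lam <= a ->
  (forall M e, 0 < e -> exists2 n, (M <= n)%N &
     exists b1, forall b, (b1 <= b)%N -> (0 < b)%N -> sth b n M (sprob a b) <= e) ->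
  Q.-negligible [set w | exists M m : nat, forall n, (M <= n)%N ->
     exists B, forall b, (B <= b)%N -> (0 < b)%N -> m.+1%:R^-1 <= vsite b n M p (eta w)].
Proof.
move=> p01 a0 pa small.
apply: (@negligibleS _ _ _ Q (\bigcup_M \bigcup_m [set w | forall n, (M <= n)%N ->
     exists B, forall b, (B <= b)%N -> (0 < b)%N -> m.+1%:R^-1 <= vsite b n M p (eta w)])).
  by move=> w [M [m h]]; exists M => //; exists m.
apply: negligible_bigcup => M; apply: negligible_bigcup => m.
apply: (level_negligible PPP) => e e0.
have m0 : 0 < m.+1%:R^-1 :> R by rewrite invr_gt0.
have [n Mn [b1 hb1]] := small M (e * m.+1%:R^-1) (mulr_gt0 e0 m0).
exists n, (fun b O => m.+1%:R^-1 <= bmean p (fun U => (@cperc b n M (U :&: O)%SET [set: _])%:R)); split.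
  move=> k; exists (maxn k b1).+1; set b := (maxn k b1).+1.
  have bk : (k <= b)%N by apply: leqW; exact: leq_maxl.
  have bb1 : (b1 <= b)%N by apply: leqW; exact: leq_maxr.
  split => //; have s01 := sprob_range b (ltW lam0).
  have sa01 := sprob_range b (ltW a0).
  have h := hb1 b bb1 isT.
  apply: le_trans (_ : bmean (sprob lam b) (fun O => m.+1%:R * bmean p (fun U => (@cperc b n M (U :&: O)%SET [set: _])%:R)) <= _).
    apply: ler_bmean => // O; case: (leP m.+1%:R^-1) => k1; last by rewrite mulr_ge0 // bmean_ge0.
    by rewrite -(ler_pM2l m0) mulKf // mulr1.
  rewrite bmeanZ -(ler_pM2l m0) mulKf // mulrC; apply: le_trans h.
  rewrite (@bmean_eq _ _ _ _ (fun O => bmean p (fun U => (@cperc b n M (O :&: U)%SET [set: _])%:R))); last first.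
    by move=> O; apply: bmean_eq => U; rewrite finset.setIC.
  rewrite (bmean_thin _ _ (fun O => (@cperc b n M O [set: _])%:R)) /sth; apply: bmean_mono.
  - have /andP[? ?] := s01; have /andP[? ?] := p01; rewrite mulr_ge0 //=.
    by apply: le_trans (sprob_thin _ _ p01) _; exact: sprob_mono.
  - by case/andP: sa01.
  - by move=> X Y XY; rewrite ler_nat; case h': (cperc M X _) => //; rewrite lt0b; apply: perc_mono h'.
move=> w /(_ n Mn)[B hB]; exists B => b hb b0; exact: hB.
Qed.

(** [L] is the infimum over boxes of the upper limit over meshes of the crossing probability from
    [M0]. With [n] such that crossings to [n] stay below [L + dl], [cross_split] leaves at least
    [(L - dl) / (L + dl) >= 1 - e] for the crossings from [n + 2] to [N]. *)
Lemma zero_one (p c : R) M0 b0 (e : R) : 0 < p <= 1 -> 0 < c -> 0 < e -> 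
  (forall b n, (b0 <= b)%N -> (0 < b)%N -> (M0 <= n)%N -> c <= cth b n M0 (sprob lam b) p) ->
  exists M, forall N, (M <= N)%N -> forall B, exists b, [/\ (B <= b)%N, (0 < b)%N & 1 - e <= cth b N M (sprob lam b) p].
Proof.
move=> /andP[p0 p1] c0 e0 H; have p01 : 0 <= p <= 1 by rewrite p1 ltW.
have s01 b := sprob_range b (ltW lam0).
pose A := [set x : R | forall N, (M0 <= N)%N -> forall B, exists b,
   [/\ (B <= b)%N, (0 < b)%N & x <= cth b N M0 (sprob lam b) p]].
have Ac : A c.
  move=> N MN B; exists (maxn B b0).+1; split => //; first by apply: leqW; exact: leq_maxl.
  by apply: H => //; apply: leqW; exact: leq_maxr.
have uA : has_ubound A.
  exists 1 => x /(_ M0 (leqnn _) 0%N)[b [_ _ h]]; apply: le_trans h _.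
  by have /andP[] := cth_range b M0 M0 (s01 b) p01.
pose L := sup A; have cL : c <= L by exact: ub_le_sup.
have L0 : 0 < L by exact: lt_le_trans cL.
pose dl := L * (e / 2); have dl0 : 0 < dl by rewrite mulr_gt0 // divr_gt0.
have nA : ~ A (L + dl).
  by move=> h; have : L + dl <= L := ub_le_sup uA h; lra.
have [n [Mn [B1 hB1]]] : exists n, (M0 <= n)%N /\ exists B, forall b, (B <= b)%N -> (0 < b)%N ->
    cth b n M0 (sprob lam b) p < L + dl.
  apply: contrapT => h; apply: nA => N MN B; apply: contrapT => h2; apply: h; exists N; split => //.
  exists B => b hb bp; rewrite ltNge; apply/negP => h3; apply: h2; exists b; split => //.
have [x Ax xL] : exists2 x, A x & L - dl < x.
  have hsA : has_sup A by split => //; exists c.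
  exact: sup_adherent dl0 hsA.
exists (n + 2)%N => N nN B.
have [b [hb bp xb]] := Ax N (leq_trans Mn (leq_trans (leq_addr 2 n) nN)) (maxn B B1).
exists b; rewrite bp; have [hB hb1] : (B <= b)%N /\ (B1 <= b)%N by apply/andP; rewrite -geq_max.
split => //; have lt := hB1 b hb1 bp.
have cs := cross_split bp (leq_trans (leq_addr 2 n) nN) (s01 b) p01 Mn (leqnn (n + 2)) nN.
have /andP[t0 _] := cth_range b N (n + 2) (s01 b) p01.
have : L - dl <= (L + dl) * cth b N (n + 2) (sprob lam b) p.
  apply: le_trans (ltW xL) (le_trans xb (le_trans cs _)).
  by rewrite ler_wpM2r // ltW.
set y := cth _ _ _ _ _ => hy; rewrite leNgt; apply/negP => ye.
have : (L + dl) * y < (L + dl) * (1 - e) by rewrite ltr_pM2l // addr_gt0.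
have : dl * e >= 0 by rewrite mulr_ge0 ?ltW.
by move: hy; rewrite /dl; nra.
Qed.

(** Once [coins] realises the bonds on the fixed configuration, both sides are probabilities of
    nested crossing events. *)
Lemma vbond_mono (p : R) w M n b : 0 < p <= 1 -> (M <= n)%N -> (0 < b)%N ->
  spread_out b n (eta w) -> spread_out b n.+1 (eta w) ->
  vbond b n.+1 M p (eta w) <= vbond b n M p (eta w).
Proof.
move=> p01 Mn b0 s1 s2.
have cV : countable (eta w).
  rewrite (_ : eta w = \bigcup_m (eta w `&` box m)); last first.
    by apply/seteqP; split => [x xV|x [m _ []//]]; have [m hm] := box_cover x; exists m.
  apply: bigcup_countable => // m _; apply: finite_set_countable.
  exact: locfin_ppp PPP w _ (bounded_box m).
have [B [BC mB iB]] := coins PPP lam0 cV p01.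
have [m1 e1] := quenched_bond M b0 s1 BC (fun x y _ _ _ => mB x y) iB.
have [m2 e2] := quenched_bond M b0 s2 BC (fun x y _ _ _ => mB x y) iB.
rewrite -lee_fin /vbond /cperc -e1 -e2; apply: le_measure; rewrite ?inE //.
by move=> w'; apply: pcross_mono => // u v [].
Qed.

(** Markov's inequality for the failure probability given the configuration, whose mean is at most
    [e / 2]. By [vbond_mono] the exceptional sets increase with the box, so their union costs no
    more than each of them. *)
Lemma bond_as (p c : R) M0 b0 : 0 < p <= 1 -> 0 < c ->
  (forall b n, (b0 <= b)%N -> (0 < b)%N -> (M0 <= n)%N -> c <= cth b n M0 (sprob lam b) p) ->
  Q.-negligible [set w | forall M, exists n, (M <= n)%N /\
     exists B, forall b, (B <= b)%N -> (0 < b)%N -> vbond b n M p (eta w) < 2^-1].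
Proof.
move=> p01 c0 H; apply: negligible_small => e e0.
have e20 : 0 < e / 2 by rewrite divr_gt0.
have p01' : 0 <= p <= 1 by case/andP: p01 => ? ->; rewrite ltW.
have [M hM] := zero_one p01 c0 e20 H.
pose A n b := [set w | (0 < b)%N && (vbond b n M p (eta w) < 2^-1)].
have mA n b : measurable (A n b).
  rewrite /A; case: (posnP b) => [->|bp].
    by rewrite (_ : [set _ | _] = set0) //; apply/seteqP; split.
  by have [] := ppp_occ (n := n) PPP bp (fun O => bmean p (fun F => (@cperc b n M O F)%:R) < 2^-1).
pose F j := eventually_in (A (M + j)%N).
have mF j : measurable (F j) by apply: measurable_eventually => b; exact: mA.
exists (\bigcup_j F j); split; first exact: bigcupT_measurable.
  move=> w /(_ M)[n [Mn [B hB]]]; exists (n - M)%N => //; rewrite /F subnKC //.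
  exists B.+1 => // b /= hb; have bp : (0 < b)%N by exact: leq_trans hb.
  by rewrite /A /= bp hB // ltnW.
apply: measure_bigcup_le => // [j w [B _ hB]|j].
  have [b1 hb1] := spread_out_ex (M + j) (locfin_ppp PPP w).
  have [b2 hb2] := spread_out_ex (M + j).+1 (locfin_ppp PPP w).
  exists (maxn B (maxn b1 b2)) => // b /=; rewrite !geq_max => /and3P[h0 h1 h2].
  have /andP[bp lt] := hB b h0; have [_ s1] := hb1 b h1; have [_ s2] := hb2 b h2.
  rewrite /A /= bp addnS; apply: le_lt_trans lt.
  by apply: vbond_mono => //; exact: leq_addr.
apply: eventually_le => [b|B]; first exact: mA.
have [b [hb bp h]] := hM (M + j)%N (leq_addr _ _) B; exists b => //.
have [_ E] := ppp_occ (n := (M + j)%N) PPP bp (fun O => bmean p (fun F => (@cperc b (M + j) M O F)%:R) < 2^-1).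
rewrite (_ : A (M + j)%N b = [set w | bmean p (fun F => (@cperc b (M + j) M (occ b (M + j) (eta w)) F)%:R) < 2^-1]); last by rewrite /A bp.
rewrite E lee_fin.
have s01 := sprob_range b (ltW lam0).
apply: le_trans (_ : bmean (sprob lam b) (fun O => 2 * (1 - bmean p (fun F => (@cperc b (M + j) M O F)%:R))) <= _).
  apply: ler_bmean => // O; set y := bmean p _.
  have y1 : y <= 1.
    rewrite -[leRHS](@bmean_cst _ {set cell b (M + j)} p 1).
    by apply: ler_bmean => // F'; rewrite lern1 leq_b1.
  case: (ltP y) => /= k; lra.
rewrite bmeanZ bmeanB bmean_cst.
move: h; rewrite /cth /mean2; set y := bmean (sprob lam b) _ => h; lra.
Qed.

End Process.
End Percolates.

(** * Critical values *)

Section Critical.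
Context {R : realType}.
Local Notation pt := (pt R).
Local Notation gadj := (@gadj R).

(** At [b = 1] a cell has area 1/16, so this intensity occupies it with probability at most
    [1 / (3 * 121)], within the range of [subcritical_decay]. *)
Lemma no_inf_comp_ex : exists2 a : R, 0 < a & no_inf_comp_as a.
Proof.
have a0 : 0 < 16 * (3 * 121)^-1 :> R by rewrite mulr_gt0 // invr_gt0 mulr_gt0.
exists (16 * (3 * 121)^-1) => //; apply: contrapT => /(percolates_bound a0)[M [c [c0 h]]].
have s01 := sprob_range 1 (ltW a0); have /andP[s0 _] := s01.
have hs : sprob (16 * (3 * 121)^-1) 1 * 121 <= 3^-1 :> R.
  apply: le_trans (_ : (3 * 121)^-1 * 121 <= _); last by rewrite invfM -mulrA mulVf ?mulr1.
  rewrite ler_pM2r // /sprob muln1 (_ : 16 * _ / _ = (3 * 121)^-1); last first.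
    by rewrite (_ : 4%:R ^+ 2 = 16 :> R) ?[16 * _]mulrC ?mulfK // -natrX.
  have := expR_ge1Dx (- (3 * 121)^-1 : R); move: (_^-1) => y; clear; lra.
have [n Mn lt] := subcritical_decay M s0 hs c0.
by have := h 1%N n isT Mn; rewrite leNgt lt.
Qed.

Lemma site_no_perc_of V C (p : R) : locfin V -> C `<=` V -> 0 <= p <= 1 ->
  (forall M m : nat, exists2 n, (M <= n)%N & forall B, exists b, [/\ (B <= b)%N, (0 < b)%N &
     vsite b n M p V < m.+1%:R^-1]) -> site_no_perc C gadj p.
Proof.
move=> lV CV p01 good d Omega P A mA iA.
have lC : locfin C by move=> B /lV; apply: sub_finite_set => x [/CV].
apply: (@negligibleS _ _ _ P (\bigcup_M [set w | forall n, (M <= n)%N -> pcross M n [set v | C v /\ A v w] gadj])).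
  move=> w [D [x /set_mem xV [-> inf]]]; have [M xM] := box_cover x; exists M => // n Mn.
  have lC' : locfin [set v | C v /\ A v w] by move=> B /lC; apply: sub_finite_set => y [[]].
  exact: inf_comp_pcross lC' (fun _ _ h => h) xV xM Mn inf.
apply: negligible_bigcup => M; apply: negligible_small => e e0.
have [m hm] : exists m : nat, m.+1%:R^-1 <= e.
  exists (Num.bound e^-1); rewrite -[leRHS]invrK lef_pV2 ?posrE ?invr_gt0 //.
  by apply/ltW/(lt_le_trans (archi_boundP _)); rewrite ?invr_ge0 ?(ltW e0) // ler_nat.
have [n Mn h] := good M m; have [b1 hb1] := spread_out_ex n lC.
have [b [hb b0 lt]] := h b1; have [_ sC] := hb1 b hb.
have [mU QU] := quenched_site M b0 sC mA iA.
exists [set w | pcross M n [set v | C v /\ A v w] gadj]; split => //.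
  by move=> w; apply.
rewrite QU lee_fin; apply: le_trans (ltW (lt_le_trans lt hm)).
apply: ler_bmean => // U; rewrite ler_nat; case pe: (perc _ _ _ _ _) => //; rewrite lt0b.
apply: perc_mono pe => //; apply: finset.setIS; apply/fintype.subsetP => a /occP[x xC xa].
by apply/occP; exists x => //; exact: CV.
Qed.

Section Bond.
Variables (d : measure_display) (Omega : measurableType d) (Q : probability Omega R).
Variables (eta : Omega -> set pt) (lam : R).
Hypotheses (PPP : is_PPP Q eta lam) (lam0 : 0 < lam).

(** [coins] realises bond percolation on the space of the process. With probability at least 1/2 all
    boxes are crossed from [M], which yields an infinite open cluster; uniqueness places it in
    [C]. *)
Lemma bond_perc_of V C (p p' : R) : locfin V -> inf_component V gadj C ->
  (forall x y, V x -> V y -> infinite_set (gcomp V gadj x) -> infinite_set (gcomp V gadj y) -> gconn V gadj x y) ->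
  0 < p' -> p' <= p <= 1 ->
  (exists M, forall n, (M <= n)%N -> forall B, exists b, [/\ (B <= b)%N, (0 < b)%N & 2^-1 <= vbond b n M p' V]) ->
  ~ bond_no_perc C gadj p.
Proof.
move=> lV [x0 /set_mem x0V [CE infC]] uniq p0 /andP[pp p1] [M good] np.
have CV : C `<=` V by rewrite CE => x h; have [] := gconnP h.
have cV : countable V.
  rewrite (_ : V = \bigcup_m (V `&` box m)); last first.
    by apply/seteqP; split => [x xV|x [m _ []//]]; have [m hm] := box_cover x; exists m.
  by apply: bigcup_countable => // m _; apply: finite_set_countable; exact: lV (bounded_box m).
have p01 : 0 < p <= 1 by rewrite p1 (lt_le_trans p0).
have [B [BC mB iB]] := coins PPP lam0 cV p01.
have ng : Q.-negligible [set w | has_inf_component C (fun x y => gadj x y /\ B x y w)].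
  apply: np => // s [us ns sC]; apply: iB; split => // e /sC[h1 h2 h3]; split => //.
    by apply/mem_set/CV/set_mem.
  by apply/mem_set/CV/set_mem.
pose F j := [set w | pcross M (M + j)%N V (fun x y => gadj x y /\ B x y w)].
have hF j : measurable (F j) /\ ((2^-1)%:E <= Q (F j))%E.
  have [b1 hb1] := spread_out_ex (M + j) lV.
  have [b [hb b0 h]] := good (M + j)%N (leq_addr _ _) b1; have [_ sV] := hb1 b hb.
  have [mU QU] := quenched_bond M b0 sV BC (fun x y _ _ _ => mB x y) iB.
  split => //; rewrite QU lee_fin; apply: le_trans h _.
  apply: bmean_mono => //; first by rewrite pp (ltW p0).
  by move=> X Y XY; rewrite ler_nat; case pe: (cperc M _ _) => //; rewrite lt0b; apply: perc_mono pe.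
have : ((2^-1)%:E <= Q (\bigcap_j F j))%E.
  apply: measure_bigcap_ge => [j|j w|j]; [by have [] := hF j| |by have [] := hF j].
  by apply: pcross_mono; rewrite ?leq_addr // ?leq_add2l // => u v [].
rewrite (_ : Q _ = 0%E) ?lee_fin ?invr_le0 ?leNgt ?ltr0n //.
apply: measure_negligible; first by apply: bigcapT_measurable => j; have [] := hF j.
apply: negligibleS ng => w h.
have [D [x /set_mem xV [DE inf]]] : has_inf_component V (fun x y => gadj x y /\ B x y w).
  by apply: (pcross_inf (M := M)) => // n Mn; rewrite -(subnKC Mn); exact: h.
rewrite DE in inf; have xi : infinite_set (gcomp V gadj x).
  apply: contra_not inf => fin; apply: sub_finite_set fin => y.
  by apply: gconn_mono => // u v [].
have xC : C x by rewrite CE; apply: uniq => //; rewrite -CE.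
exists (gcomp C (fun x y => gadj x y /\ B x y w) x), x; first exact/mem_set.
split => //; apply: contra_not inf => fin; apply: sub_finite_set fin => y xy.
apply: (gconn_ind (P := gconn C (fun x y => gadj x y /\ B x y w) x)) xy; first exact: gconn_refl.
move=> u v uV vV xu uv; apply: gconn_step (xu) _ (uv).
have [_ uC] := gconnP xu; move: uC; rewrite CE => uC.
by apply: gconn_step uC vV _; case: uv.
Qed.

(** [no_inf_comp_as a] quantifies over all processes of intensity [a]; this one makes it
    informative. *)
Lemma ppp_exists (a : R) : 0 < a -> exists eta' : Omega -> set pt, is_PPP Q eta' a.
Proof.
move=> a0; have al : 0 < a / lam by rewrite divr_gt0.
exists (fun w => dil (Num.sqrt (a / lam)) @^-1` eta w).
have := ppp_dil (k := Num.sqrt (a / lam)) _ PPP; rewrite sqrtr_gt0 => /(_ al).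
by rewrite sqr_sqrtr ?(ltW al) // mulrCA divff ?mulr1 // gt_eqF.
Qed.

Lemma sth_small (a : R) M e : 0 < a -> no_inf_comp_as a -> 0 < e -> exists2 n, (M <= n)%N &
  exists b1, forall b, (b1 <= b)%N -> (0 < b)%N -> sth b n M (sprob a b) <= e.
Proof.
move=> a0 na e0; have [eta' P'] := ppp_exists a0.
exact: (noinf_small P') (na _ _ _ _ P') e0.
Qed.

Lemma noinf_mono (a : R) : 0 < a -> no_inf_comp_as a -> lam <= a ->
  Q.-negligible [set w | has_inf_component (eta w) gadj].
Proof.
move=> a0 na la.
apply: (@negligibleS _ _ _ Q (\bigcup_M [set w | exists x, [/\ eta w x, box M x & infinite_set (gcomp (eta w) gadj x)]])).
  move=> w [C [x xV [-> inf]]]; have [m hm] := box_cover x; exists m => //; exists x; split => //.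
  exact: set_mem.
apply: negligible_bigcup => M; apply: negligible_small => e e0.
have [n Mn [b1 /(_ b1.+1 (leqnSn _) isT) h]] := sth_small M a0 na e0.
have [mU QU] := ppp_occ (n := n) PPP (ltn0Sn b1) (fun O => @cperc b1.+1 n M O [set: _]).
exists [set w | @cperc b1.+1 n M (occ b1.+1 n (eta w)) [set: _]]; split => //; last first.
  rewrite QU lee_fin; apply: le_trans h; apply: bmean_mono.
  - by rewrite sprob_mono // andbT; have /andP[] := sprob_range b1.+1 (ltW lam0).
  - by have /andP[] := sprob_range b1.+1 (ltW a0).
  - by move=> X Y XY; rewrite ler_nat; case pe: (cperc M _ _) => //; rewrite lt0b; apply: perc_mono pe.
move=> w [x [xV xM inf]]; apply: pcross_perc => //.
exact: inf_comp_pcross (locfin_ppp PPP w) (fun _ _ h => h) xV xM Mn inf.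
Qed.

End Bond.
(** [1 - e^(-t) >= t / (1 + t)] at [t = l2 / q] reduces the claim to [l1 * l2 <= (l2 - l1) * q],
    here with [q] the square of [4 * b]; [X] is the resulting threshold. *)
Lemma sprob_ge (l1 l2 : R) : 0 < l1 -> l1 < l2 -> exists b0, forall b, (b0 <= b)%N ->
  l1 / (4 * b)%:R ^+ 2 <= sprob l2 b.
Proof.
move=> l10 l12; have l20 : 0 < l2 by exact: lt_trans l12.
pose X := l1 * l2 / (l2 - l1).
have d0 : 0 < l2 - l1 by rewrite subr_gt0.
have X0 : 0 <= X by rewrite divr_ge0 ?mulr_ge0 ?ltW.
exists (Num.bound X).+1 => b hb; have b0 : (0 < b)%N by exact: leq_trans hb.
have Xb : X <= b%:R by apply/ltW/(lt_le_trans (archi_boundP X0)); rewrite ler_nat ltnW.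
have bq : b%:R <= (4 * b)%:R ^+ 2 :> R.
  rewrite -natrX ler_nat expnMn; apply: (@leq_trans (b ^ 2)); last by rewrite leq_pmull.
  by rewrite -mulnn leq_pmulr.
have q0 : 0 < (4 * b)%:R ^+ 2 :> R by rewrite exprn_gt0 // ltr0n muln_gt0.
have := le_trans Xb bq; rewrite /X /sprob; move: ((4 * b)%:R ^+ 2) q0 => q q0.
rewrite ler_pdivrMr // => h; set t := l2 / q.
have t0 : 0 < t by rewrite divr_gt0.
have e0 := expR_gt0 (- t).
have e3 : expR (- t) * (1 + t) <= 1.
  by apply: le_trans (ler_wpM2l (ltW e0) (expR_ge1Dx t)) _; rewrite -expRD addrC subrr expR0.
have tq : t * q = l2 by rewrite /t divfK // gt_eqF.
rewrite ler_pdivrMr //.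
have k : expR (- t) * (q + l2) <= q.
  by have := ler_wpM2r (ltW q0) e3; rewrite mul1r -mulrA mulrDl mul1r tq.
rewrite -(ler_pM2r (x := q + l2)) ?addr_gt0 //.
move: (expR (- t)) k e0 => E k e0.
have -> : (1 - E) * q * (q + l2) = q * (q + l2) - q * (E * (q + l2)) by ring.
have := ler_wpM2l (ltW q0) k; nra.
Qed.

Lemma cth_mono_s b n M (s s' p : R) : 0 <= s <= s' -> s' <= 1 -> 0 <= p <= 1 -> cth b n M s p <= cth b n M s' p.
Proof.
move=> ss s1 p01; apply: bmean_mono => // X Y XY; apply: ler_bmean => // F.
by rewrite ler_nat; case pe: (cperc M _ _) => //; rewrite lt0b; apply: perc_mono pe.
Qed.

(* First exchange at the trivial rate until [p < 1], then at the improved rate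
   [1 + c] for a time [t1]. The gain [c * t1 = 4 * h] pays for starting at the
   intensity [a = lc * e^h > lc] and for ending at [l' = lam * e^-h < lam], which
   absorbs the error in [sprob lam b ~ lam / (4 * b) ^+ 2]. *)
Lemma bond_supercritical (lc lam : R) : 0 < lc -> lc < lam -> (forall a, lc < a -> ~ no_inf_comp_as a) ->
  exists p : R, [/\ 0 < p <= 1, p * lam < lc & exists (c : R) (M b0 : nat), 0 < c /\
    forall b n, (b0 <= b)%N -> (0 < b)%N -> (M <= n)%N -> c <= cth b n M (sprob lam b) p].
Proof.
move=> lc0 lcl np; have lam0 : 0 < lam by exact: lt_trans lcl.
pose t1 := ln (lam / lc) / 2.
have r1 : 1 < lam / lc by rewrite ltr_pdivlMr // mul1r.
have t10 : 0 < t1 by rewrite divr_gt0 // ln_gt0.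
have e2t : expR (2 * t1) = lam / lc.
  by rewrite /t1 mulrCA divff // mulr1 lnK // posrE (lt_trans ltr01).
clearbody t1.
have k10 : 0 < lc / 2 by rewrite divr_gt0.
(* During the second exchange the bond parameter stays between [expR (- (3 * t1))], as [c <= 1], and
   [expR (- t0)], where [t0 >= t1 / 2]. *)
have ph1 : expR (- (t1 / 2)) < 1 :> R by rewrite expR_lt1 oppr_lt0 divr_gt0.
have [c [c0 c1 [b1 hcell]]] := solo_le_blob_cell k10 lam0 (expR_gt0 (- (3 * t1))) ph1.
pose h := c * t1 / 4; have h0 : 0 < h by rewrite /h divr_gt0 // mulr_gt0.
have ht : 4 * h <= t1 by rewrite /h; nra.
have hc : 4 * h = c * t1 by rewrite /h mulrCA divff ?mulr1.
clearbody h.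
pose a := lc * expR h; pose l' := lam * expR (- h); pose t0 := t1 - 2 * h.
have a_lc : lc < a by rewrite ltr_pMr // expR_gt1.
have a0 : 0 < a by exact: lt_trans a_lc.
have l'0 : 0 < l' by rewrite mulr_gt0 ?expR_gt0.
have l'l : l' < lam by rewrite gtr_pMr // expR_lt1 oppr_lt0.
have t00 : 0 < t0 by rewrite /t0; lra.
have at1 : a * (expR t0 * expR t1) = l'.
  rewrite -expRD /a /l' -mulrA -expRD.
  have -> : h + (t0 + t1) = 2 * t1 + - h by rewrite /t0; ring.
  by rewrite expRD e2t mulrA [lc * _]mulrC divfK // gt_eqF.
pose p := expR (- t0) * expR (- (1 + c) * t1).
have pE : p = expR (2 * h - 2 * t1 - c * t1) by rewrite /p -expRD; congr expR; rewrite /t0; ring.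
have p0 : 0 < p by rewrite pE expR_gt0.
have [M [c2 [c20 hst]]] := percolates_bound a0 (np _ a_lc).
exists p; split.
- by rewrite p0 pE expR_le1; lra.
(* Here [p * lam = lc * expR (- (2 * h))]. *)
- rewrite pE (_ : 2 * h - 2 * t1 - c * t1 = - (2 * h) + - (2 * t1)); last by rewrite -hc; ring.
  rewrite expRD [expR (- (2 * t1))]expRN e2t invf_div -mulrA divfK ?gt_eqF //.
  by rewrite gtr_pMl // expR_lt1 oppr_lt0 mulr_gt0.
have [b2 hs1] := sprob_bounds a0; have [b3 hs2] := sprob_ge l'0 l'l.
exists (c2 / expR (2 * c * t1)), M, (maxn b1 (maxn b2 b3)); split; first by rewrite divr_gt0 ?expR_gt0.
move=> b n; rewrite !geq_max => /and3P[hb1 hb2 hb3] b0 Mn.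
have [_ s1 s2 s01] := hs1 b hb2; have s3 := hs2 b hb3.
set s := sprob a b in s1 s2 s01; have /andP[l01 l02] := sprob_range b (ltW lam0).
have q0 : 0 < (4 * b)%:R ^+ 2 :> R by rewrite exprn_gt0 // ltr0n muln_gt0.
have s0 : 0 < s by apply: lt_le_trans s1; rewrite !divr_gt0.
have E0 : 0 < expR t0 * expR t1 :> R by rewrite mulr_gt0 ?expR_gt0.
have sl : s * expR t0 * expR t1 <= l' / (4 * b)%:R ^+ 2.
  by rewrite -mulrA -at1 mulrAC ler_pM2r.
have sl1 : s * expR t0 * expR t1 <= 1 by exact: le_trans sl (le_trans s3 l02).
have e1 : 1 <= expR t1 :> R by rewrite -expR0 ler_expR ltW.
have e0 : 1 <= expR t0 :> R by rewrite -expR0 ler_expR ltW.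
have se0 : 0 < s * expR t0 by rewrite mulr_gt0 ?expR_gt0.
have se1 : s * expR t0 <= 1 by apply: le_trans sl1; rewrite ler_pMr.
(* With [c = 0] the comparison required by [theta_curve] is just the nonnegativity of a mean. *)
have st1 := @theta_curve R _ (@cadj b n) (cS M) cT s 1 0 t0 (@cadjxx b n) (lexx 0) (ltW t00) s0 se1.
have {st1} st1 : cth b n M s 1 <= cth b n M (s * expR t0) (expR (- t0)).
  have := st1; rewrite ltr01 lexx => /(_ isT); rewrite mulr0 mul0r expR0 !mul1r addr0 mulN1r; apply.
  move=> s' p' h1 h2 h3 h4 h5; rewrite !mul0r addr0; apply: mean2_ge0 => [||O F]; last by rewrite ler0n.
    by apply/andP; split; [exact: le_trans (ltW s0) h1|exact: ltW].
  by apply/andP; split; [exact: le_trans (expR_ge0 _) h4|exact: ltW].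
have et0 : 0 < (expR (- t0) : R) <= 1 by rewrite expR_gt0 expR_le1 oppr_le0 ltW.
have st2 : cth b n M (s * expR t0) (expR (- t0)) <=
    expR (2 * c * t1) * cth b n M (s * expR t0 * expR t1) p.
  apply: theta_curve => //; [exact: cadjxx|exact: ltW|exact: ltW|].
  move=> s' p' h1 h2 h3 h4 h5; apply: hcell => //.
  - apply: le_trans h1; apply: le_trans (_ : s <= _); last by rewrite ler_pMr.
    apply: le_trans s1; rewrite ler_pM2r ?invr_gt0 // ler_pM2r ?invr_gt0 //; exact: ltW.
  - apply: le_trans h2 (le_trans sl _); rewrite ler_pM2r ?invr_gt0 //; exact: ltW.
  - apply: le_trans h4; rewrite -/p pE ler_expR; nra.
  - apply: le_trans (ltW h5) _; rewrite ler_expR /t0; lra.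
rewrite ler_pdivrMr ?expR_gt0 // mulrC.
apply: le_trans (hst b n b0 Mn) _; rewrite -/s -cth1; apply: le_trans st1 (le_trans st2 _).
rewrite ler_pM2l ?expR_gt0 //; apply: cth_mono_s => //.
  by rewrite (le_trans sl s3) andbT ltW // mulr_gt0 ?expR_gt0.
by rewrite (ltW p0) pE expR_le1; lra.
Qed.

End Critical.

Theorem theorem1 (R : realType) (d : measure_display) (Omega : measurableType d)
    (Q : probability Omega R) (eta : Omega -> set (pt R)) (lam : R) :
  lambda_c R < lam -> is_PPP Q eta lam ->
  {ae Q, forall w, forall C : set (pt R),
     inf_component (eta w) (@gadj R) C ->
     pc_bond C (@gadj R) < pc_site C (@gadj R)}.
Proof.
move=> lcl PPP; set A := [set a : R | 0 < a /\ no_inf_comp_as a].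
have lcE : lambda_c R = sup A by [].
have [a1 a10 na1] := @no_inf_comp_ex R.
(* An unbounded set has [sup] equal to 0 by convention. In that case some intensity above [lam] does
   not percolate, almost surely there is no infinite component, and the claim is vacuous. *)
have [uA|nuA] := pselect (has_ubound A); last first.
  have lam0 : 0 < lam by move: lcl; rewrite lcE sup_out // => -[].
  have [a [a0 na] la] : exists2 a, A a & lam <= a.
    apply: contrapT => h; apply: nuA; exists lam => a Aa; rewrite leNgt; apply/negP => /ltW la.
    by apply: h; exists a.
  apply: negligibleS (noinf_mono PPP lam0 a0 na la) => w /= h.
  by apply: contrapT => nh; apply: h => C hC; exfalso; apply: nh; exists C.
have Aa1 : A a1 by [].
have lc0 : 0 < sup A by exact: lt_le_trans a10 (ub_le_sup uA Aa1).
rewrite lcE in lcl; have lam0 : 0 < lam by exact: lt_trans lcl.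
have np a : sup A < a -> ~ no_inf_comp_as a.
  move=> la na; have : a <= sup A by apply: (ub_le_sup uA); split => //; exact: lt_trans la.
  by rewrite leNgt la.
have [p [p01 plc [c [M [b0 [c0 hc]]]]]] := bond_supercritical lc0 lcl np.
have /andP[p0 p1] := p01.
have [a [a0 na] pa] : exists2 a, A a & p * lam < a.
  have e0 : 0 < sup A - p * lam by rewrite subr_gt0.
  have hs : has_sup A by split => //; exists a1.
  by have [a Aa] := sup_adherent e0 hs; rewrite subKr; exists a.
have aA : a <= sup A := ub_le_sup uA (conj a0 na).
(* Site percolation at [p'] thins the process to the non-percolating intensity [a]; [p] and [p']
   will separate the two critical values. *)
pose p' := a / lam.
have p'lam : p' * lam = a by rewrite divfK // gt_eqF.
have pp' : p < p' by rewrite ltr_pdivlMr.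
have p'1 : p' <= 1 by rewrite ler_pdivrMr // mul1r (le_trans aA) // ltW.
have p'01 : 0 <= p' <= 1 by rewrite p'1 divr_ge0 ?ltW.
have N1 := uniq_as PPP lam0.
have N2 := bond_as PPP lam0 p01 c0 hc.
have N3 := site_as PPP lam0 p'01 a0 (eq_ind_r (fun x => x <= a) (lexx a) p'lam)
  (fun M e => sth_small PPP lam0 M a0 na).
apply: negligibleS (negligibleU (negligibleU N1 N2) N3) => w bad.
apply: contrapT => ngood; apply: bad => C hC.
have lV := locfin_ppp PPP w.
have CV : C `<=` eta w by case: hC => x _ [-> _] y h; have [] := gconnP h.
apply: (@le_lt_trans _ _ p); last apply: (lt_le_trans pp').
- rewrite leNgt; apply/negP => lt.
  pose S := [set r : R | 0 <= r <= 1 /\ bond_no_perc C (@gadj R) r].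
  (* Otherwise [sup S] would be 0 by convention, hence below [p]. *)
  have hS : has_sup S.
    by apply: contrapT => h; move: lt; rewrite /pc_bond -/S (sup_out h) ltNge (ltW p0).
  have e0 : 0 < pc_bond C (@gadj R) - p by rewrite subr_gt0.
  have [r [/andP[_ r1] nr]] := sup_adherent e0 hS; rewrite subKr => pr.
  apply: (bond_perc_of PPP lam0 lV hC _ p0 _ _ nr).
  + move=> x y xV yV xi yi; apply: contrapT => nxy; apply: ngood; left; left.
    by exists x, y.
  + by rewrite (ltW pr).
  + apply: contrapT => h; apply: ngood; left; right => K; apply: contrapT => h2; apply: h.
    exists K => n Kn B; apply: contrapT => h3; apply: h2; exists n; split => //.
    exists B => b hb b1; rewrite ltNge; apply/negP => h4; apply: h3.
    by exists b.
- apply: ub_le_sup; first by exists 1 => x [/andP[]].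
  split => //; apply: site_no_perc_of lV CV p'01 _ => K m.
  apply: contrapT => h; apply: ngood; right; exists K, m => n Kn.
  apply: contrapT => h2; apply: h; exists n => // B.
  apply: contrapT => h3; apply: h2; exists B => b hb b1; rewrite leNgt; apply/negP => h4.
  by apply: h3; exists b.
Qed.
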